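(* For every cardinal number $1\leq N\leq\infty$ there exist a power bounded operator $T$ on a Hilbert space and a quasiaffinity $X$ such that $XT=SX$, $\dim\ker T^*=N$, and $$\|X^*h_\lambda\|\asymp\|h_\lambda\|=\frac{1}{(1-|\lambda|^2)^{1/2}}\qquad(\lambda\in\mathbb D).$$
   Context: Hilbert spaces are complex and separable; operators and transformations are bounded linear maps; $N=\infty$ means countably infinite dimension. $\mathbb D$ is the open unit disc, $H^2$ the Hardy space on $\mathbb D$, $S\colon H^2\to H^2$, $(Sh)(z)=zh(z)$, the unilateral shift of multiplicity 1, and $h_\lambda(z)=\frac{1}{1-\overline\lambda z}$ for $z,\lambda\in\mathbb D$. $T$ is power bounded if $\sup_{n\geq 1}\|T^n\|<\infty$. A quasiaffinity is a transformation (here from the space of $T$ to $H^2$) with zero kernel and dense range. The notation $a(\lambda)\asymp b(\lambda)$ means that there are constants $c,C>0$ independent of $\lambda$ with $c\,b(\lambda)\leq a(\lambda)\leq C\,b(\lambda)$. *)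

(* Defs.v *)
From HB Require Import structures.
From mathcomp Require Import all_boot all_order all_algebra.
From mathcomp Require Import ring lra complex.
From mathcomp Require Import all_classical all_reals all_analysis.

Set Implicit Arguments.
Unset Strict Implicit.
Unset Printing Implicit Defensive.

Import Order.TTheory GRing.Theory Num.Theory.
Import numFieldNormedType.Exports.

Local Open Scope classical_set_scope.
Local Open Scope complex_scope.
Local Open Scope ring_scope.

(* R[i] with the topology and the normed module structure over itself given by
   its modulus; the norms below therefore take their values in R[i]. *)
HB.instance Definition _ (R : rcfType) := GRing.ComAlgebra.copy R[i] R[i]^o.
HB.instance Definition _ (R : rcfType) := Vector.copy R[i] R[i]^o.
HB.instance Definition _ (R : rcfType) := NormedModule.copy R[i] R[i]^o.
Section complex_topology.
Variable R : realType.
Implicit Types (x y z : R[i]).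

Lemma ltc_epsE (e : R[i]) : 0 < e -> e = (complex.Re e)%:C /\ 0 < complex.Re e.
Proof.
case: e => a b; rewrite ltcE /= => /andP[/eqP -> a0]; split => //.
Qed.

Lemma normCR (a : R) : `|a%:C| = `|a|%:C :> R[i].
Proof. by rewrite normc_def /= expr0n addr0 sqrtr_sqr. Qed.

Lemma cvg_realC (T : Type) (F : set_system T) (FF : Filter F) (u : T -> R) (l : R) :
  u @ F --> l -> (fun t => (u t)%:C : R[i]) @ F --> l%:C.
Proof.
move=> /cvgrPdist_lt ul; apply/cvgrPdist_lt => e /ltc_epsE[-> e0].
apply: filterS (ul _ e0) => t /=.
by rewrite -rmorphB/= normCR ltcR.
Qed.

Lemma normRe_le x : `|complex.Re x|%:C <= `|x|. Proof. exact: normc_ge_Re. Qed.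
Lemma normIm_le x : `|complex.Im x|%:C <= `|x|.
Proof.
rewrite normc_def lecR -sqrtr_sqr ler_wsqrtr//.
by rewrite lerDr sqr_ge0.
Qed.

Lemma cvg_Re (T : Type) (F : set_system T) (FF : Filter F) (u : T -> R[i]) (l : R[i]) :
  u @ F --> l -> (fun t => complex.Re (u t)) @ F --> complex.Re l.
Proof.
move=> /cvgrPdist_lt ul; apply/cvgrPdist_lt => e e0.
have e0' : 0 < e%:C :> R[i] by rewrite ltcR.
apply: filterS (ul _ e0') => t /= h.
rewrite -ltcR; apply: le_lt_trans h; rewrite -raddfB; exact: normRe_le.
Qed.

Lemma cvg_Im (T : Type) (F : set_system T) (FF : Filter F) (u : T -> R[i]) (l : R[i]) :
  u @ F --> l -> (fun t => complex.Im (u t)) @ F --> complex.Im l.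
Proof.
move=> /cvgrPdist_lt ul; apply/cvgrPdist_lt => e e0.
have e0' : 0 < e%:C :> R[i] by rewrite ltcR.
apply: filterS (ul _ e0') => t /= h.
rewrite -ltcR; apply: le_lt_trans h; rewrite -raddfB; exact: normIm_le.
Qed.

Lemma cvg_ReIm (T : Type) (F : set_system T) (FF : Filter F) (u : T -> R[i]) (l : R[i]) :
  (fun t => complex.Re (u t)) @ F --> complex.Re l ->
  (fun t => complex.Im (u t)) @ F --> complex.Im l ->
  u @ F --> l.
Proof.
move=> /(cvg_realC FF) cr /(cvg_realC FF) ci.
have -> : u = (fun t => (complex.Re (u t))%:C) \+ ((fun=> 'i%C) \* (fun t => (complex.Im (u t))%:C)).
  by apply/funext => t /=; rewrite -complexE.
rewrite [l]complexE; apply: (cvgD cr); apply: (cvgM (cvg_cst _) ci).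
Qed.

Lemma complex_complete (F : set_system R[i]) : ProperFilter F -> cauchy F -> cvg F.
Proof.
move=> FF /cauchy_ballP Fc.
have key (p : R[i] -> R) : (forall x y, `|p x - p y|%:C <= `|x - y|) ->
    cvg (p @ F).
  move=> pl; apply/cauchy_cvgP/cauchy_ballP => e e0.
  have e0' : 0 < e%:C :> R[i] by rewrite ltcR.
  have := Fc _ e0'; move=> [[A B] /= [FA FB] AB].
  exists (p @` A, p @` B) => /=.
    by split; [apply: filterS FA => x Ax; exists x|apply: filterS FB => x Ax; exists x].
  move=> [_ _] /= [[x Ax <-] [y By <-]]; have := AB (x, y) (conj Ax By).
  rewrite -!ball_normE /= -ltcR; apply: le_lt_trans; exact: pl.
apply/cvg_ex; exists ((lim (@complex.Re R @ F)) +i* (lim (@complex.Im R @ F)))%C.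
apply: (@cvg_ReIm _ F _ id) => /=.
  by apply: key => x y; rewrite -raddfB; exact: normRe_le.
by apply: key => x y; rewrite -raddfB; exact: normIm_le.
Qed.
HB.instance Definition _ := Uniform_isComplete.Build R[i] complex_complete.


Lemma cvgc_le (T : Type) (F : set_system T) {FF : ProperFilter F} (u : T -> R[i]) (l M : R[i]) :
  u @ F --> l -> (\forall t \near F, u t <= M) -> l <= M.
Proof.
move=> ul uM; rewrite lecE; apply/andP; split.
  apply/eqP/esym; apply: (cvg_unique _ (cvg_Im _ ul)).
    exact: Rhausdorff.
  apply: cvg_near_cst; apply: filterS uM => t.
  by rewrite lecE => /andP[/eqP -> _].
apply: (cvgr_to_le (cvg_Re _ ul)); apply: filterS uM => t.
by rewrite lecE => /andP[].
Qed.

Lemma cvgc_ge (T : Type) (F : set_system T) {FF : ProperFilter F} (u : T -> R[i]) (l M : R[i]) :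
  u @ F --> l -> (\forall t \near F, M <= u t) -> M <= l.
Proof.
move=> ul uM; rewrite -lerN2.
apply: (@cvgc_le T F FF (- u)); first exact: (cvgN ul).
by apply: filterS uM => t; rewrite lerN2.
Qed.

Lemma is_cvg_cseries (u : nat -> R[i]) (M : R[i]) : (forall n, 0 <= u n) ->
  (forall n, series u n <= M) -> cvgn (series u).
Proof.
move=> u0 uM.
have uE : series u = fun n => (series (fun n => complex.Re (u n)) n)%:C.
  apply/funext => n; rewrite /series/= rmorph_sum/=.
  by apply: eq_bigr => i _; rewrite RRe_real// ger0_real.
have : cvgn (series (fun n => complex.Re (u n))).
  apply: nondecreasing_is_cvgn.
    apply: nondecreasing_series => n _ _.
    by have := u0 n; rewrite lecE => /andP[].
  exists (complex.Re M) => _ [n _ <-].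
  by have := uM n; rewrite uE lecE => /andP[].
move=> /cvg_ex[l /(cvg_realC _) ul]; apply/cvg_ex; exists l%:C.
by rewrite uE; exact: ul.
Qed.

Lemma cseries_le_lim (u : nat -> R[i]) n : (forall n, 0 <= u n) ->
  cvgn (series u) -> series u n <= limn (series u).
Proof.
move=> u0 cu; apply: (@cvgc_ge nat \oo _ (series u) _ _ cu); near=> m.
have nm : (n <= m)%N by near: m; exact: nbhs_infty_ge.
rewrite -subr_ge0 sub_series nm.
by apply: sumr_ge0.
Unshelve. all: by end_near. Qed.

Lemma normed_ccvg (u : nat -> R[i]) :
  cvgn (series (fun n => `|u n|)) -> cvgn (series u).
Proof.
move=> /cauchy_cvgP/cauchy_seriesP uc.
apply/cauchy_cvgP/cauchy_seriesP => e /uc.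
apply: filterS => n /=; rewrite ger0_norm ?sumr_ge0//.
by apply: le_lt_trans; apply: ler_norm_sum.
Qed.

Definition sqsum (a : nat -> R[i]) := cvgn (series (fun n => `|a n| ^+ 2)).

Lemma sqsum_le_lim (a : nat -> R[i]) n : sqsum a ->
  series (fun n => `|a n| ^+ 2) n <= limn (series (fun n => `|a n| ^+ 2)).
Proof. by move=> ca; apply: cseries_le_lim => // i; rewrite exprn_ge0. Qed.

Lemma sqsum_le (a b : nat -> R[i]) (M : R[i]) : sqsum b -> 0 <= M ->
  (forall n, `|a n| ^+ 2 <= M * `|b n| ^+ 2) -> sqsum a.
Proof.
move=> cb M0 ab.
apply: (@is_cvg_cseries _ (M * limn (series (fun n => `|b n| ^+ 2)))) => n.
  by rewrite exprn_ge0.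
apply: (@le_trans _ _ (M * series (fun n => `|b n| ^+ 2) n)).
  by rewrite /series/= mulr_sumr ler_sum.
by apply: ler_wpM2l => //; exact: sqsum_le_lim.
Qed.

Lemma sqsumD2 (a b : nat -> R[i]) (u : nat -> R[i]) (K : R[i]) :
  sqsum a -> sqsum b -> 0 <= K -> (forall n, 0 <= u n) ->
  (forall n, u n <= K * (`|a n| ^+ 2 + `|b n| ^+ 2)) -> cvgn (series u).
Proof.
move=> ca cb K0 u0 uab.
apply: (@is_cvg_cseries _ (K * (limn (series (fun n => `|a n| ^+ 2)) +
   limn (series (fun n => `|b n| ^+ 2))))) => // n.
apply: (@le_trans _ _ (K * (series (fun n => `|a n| ^+ 2) n + series (fun n => `|b n| ^+ 2) n))).
  by rewrite /series/= -big_split mulr_sumr ler_sum.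
by apply: ler_wpM2l => //; apply: lerD; exact: sqsum_le_lim.
Qed.

Lemma sqsumD (a b : nat -> R[i]) : sqsum a -> sqsum b -> sqsum (fun n => a n + b n).
Proof.
move=> ca cb; apply: (sqsumD2 (K := 2) ca cb) => // n.
apply: (@le_trans _ _ ((`|a n| + `|b n|) ^+ 2)).
  by rewrite lerXn2r ?nnegrE ?addr_ge0// ler_normD.
rewrite -subr_ge0.
have -> : 2 * (`|a n| ^+ 2 + `|b n| ^+ 2) - (`|a n| + `|b n|) ^+ 2 = (`|a n| - `|b n|) ^+ 2 by ring.
by rewrite real_exprn_even_ge0// rpredB// normr_real.
Qed.

Lemma sqsumZ (k : R[i]) (a : nat -> R[i]) : sqsum a -> sqsum (fun n => k * a n).
Proof.
move=> ca; apply: (sqsum_le (M := `|k| ^+ 2) ca); first by rewrite exprn_ge0.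
by move=> n; rewrite normrM exprMn.
Qed.

Lemma sqsum0 : sqsum (fun=> 0).
Proof.
apply: (@is_cvg_cseries _ 0) => n; rewrite ?normr0 ?expr0n//=.
by rewrite /series/= big1// => i _; rewrite expr0n.
Qed.

Lemma is_cvg_inner (a b : nat -> R[i]) : sqsum a -> sqsum b ->
  cvgn (series (fun n => a n * (b n)^*)).
Proof.
move=> ca cb; apply: normed_ccvg.
apply: (sqsumD2 (K := 1) ca cb) => // n.
rewrite mul1r normrM norm_conjC.
have [ab|ba] := real_leP (normr_real (a n)) (normr_real (b n)).
  by rewrite (le_trans (ler_wpM2r _ ab))// -?expr2 ?lerDr// exprn_ge0.
by rewrite (le_trans (ler_wpM2l _ (ltW ba)))// -?expr2 ?lerDl// exprn_ge0.
Qed.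

Lemma sqsum_geo (z : R[i]) : `|z| < 1 -> sqsum (fun n => z ^+ n).
Proof.
move=> z1; apply: (@is_cvg_cseries _ (1 - `|z| ^+ 2)^-1) => n; first by rewrite exprn_ge0.
have z2 : `|z| ^+ 2 < 1 by rewrite expr_lt1.
have -> : (fun n => `|z ^+ n| ^+ 2) = geometric 1 (`|z| ^+ 2).
  by apply/funext => k; rewrite /= mul1r normrX -!exprM mulnC.
rewrite geometric_seriesE ?lt_eqF//= mul1r -[leRHS]mul1r ler_wpM2r//.
  by rewrite invr_ge0 subr_ge0 ltW.
Qed.



End complex_topology.
Arguments sqsumZ {R} k {a} ca : rename.
Arguments sqsumD {R a b} ca cb : rename.
Arguments is_cvg_inner {R a b} ca cb : rename.

Section taylor_series.
Variable R : realType.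
Lemma sqsum_bounded (a : nat -> R[i]) : sqsum a -> exists M, forall n, `|a n| <= M.
Proof.
move=> ca; exists (1 + limn (series (fun n => `|a n| ^+ 2))) => n.
have h : `|a n| ^+ 2 <= limn (series (fun n => `|a n| ^+ 2)).
  apply: le_trans (sqsum_le_lim n.+1 ca).
  by rewrite /series/= big_nat_recr//= lerDr sumr_ge0.
apply: le_trans (lerD (lexx 1) h).
have [a1|a1] := real_leP (normr_real (a n)) (@real1 R[i]).
  by apply: le_trans a1 _; rewrite lerDl.
by rewrite (@le_trans _ _ (`|a n| ^+ 2))// ?lerDr// ler_eXnr// ltW.
Qed.

Definition disc := {z : R[i] | `|z| < 1}.

Definition taylor (f : disc -> R[i]) (a : nat -> R[i]) :=
  forall z : disc, series (fun n => a n * val z ^+ n) @ \oo --> f z.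

Lemma geo_tail (r : R[i]) m N : 0 <= r -> r <= 2^-1 -> (m <= N)%N ->
  \sum_(m <= i < N) r ^+ i <= 2 * r ^+ m.
Proof.
move=> r0 r2 mN; rewrite -(subnKC mN) geometric_partial_tail.
have h1 : 2^-1 <= 1 - r by rewrite lerBrDr -lerBrDl (le_trans r2)// [leRHS](_ : _ = 2^-1)//; field.
have h0 : 0 < 1 - r by apply: lt_le_trans h1; rewrite invr_gt0.
rewrite geometric_seriesE; last by rewrite lt_eqF// -subr_gt0.
rewrite /= ler_pdivrMr//.
rewrite [leRHS](_ : _ = r ^+ m * (2 * (1 - r))); last by ring.
rewrite ler_wpM2l ?exprn_ge0//.
rewrite (@le_trans _ _ 1)//; first by rewrite gerBl exprn_ge0.
by rewrite -ler_pdivrMl// mulr1.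
Qed.

Lemma taylor0 (a : nat -> R[i]) (M : R[i]) : (forall n, `|a n| <= M) ->
  taylor (fun=> 0) a -> forall n, a n = 0.
Proof.
move=> aM ta; elim/ltn_ind => n IH.
have key (r : R[i]) : 0 < r -> r <= 2^-1 -> `|a n| <= 2 * M * r.
  move=> r0 r2.
  have r1 : `|r| < 1 by rewrite gtr0_norm// (le_lt_trans r2)// invf_lt1// ltr1n.
  have /cvg_norm := ta (exist _ r r1); move=> /=; rewrite normr0 => tr.
  suff : `|a n| * r ^+ n - 2 * M * r * r ^+ n <= 0.
    by rewrite -mulrBl pmulr_lle0 ?exprn_gt0// subr_le0.
  apply: (cvgc_ge tr); near=> N.
  have nN : (n < N)%N by near: N; exact: nbhs_infty_gt.
  rewrite /series/= (big_cat_nat (n := n))//=; last exact: ltnW.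
  rewrite [X in `|X + _|]big_nat big1 ?add0r; last first.
    by move=> i /andP[_ /IH ->]; rewrite mul0r.
  rewrite big_ltn//= lerBlDr.
  have -> : `|a n| * r ^+ n = `|a n * r ^+ n| by rewrite normrM (ger0_norm (exprn_ge0 _ (ltW r0))).
  rewrite -lerBlDl.
  set s := \sum_(_ <= _ < _) _.
  apply: (@le_trans _ _ `|s|).
    by rewrite lerBlDl -[X in `|X| <= _](addrK s) (le_trans (ler_normB _ _)).
  apply: (le_trans (ler_norm_sum _ _ _)).
  apply: (@le_trans _ _ (M * \sum_(n.+1 <= i < N) r ^+ i)).
    rewrite mulr_sumr ler_sum// => i _.
    by rewrite normrM (ger0_norm (exprn_ge0 _ (ltW r0))) ler_wpM2r// exprn_ge0// ltW.
  have -> : 2 * M * r * r ^+ n = M * (2 * r ^+ n.+1) by rewrite exprS; ring.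
  rewrite ler_wpM2l//; first exact: le_trans (aM 0%N).
  by apply: geo_tail => //; exact: ltW.
apply/eqP; apply: contraT => an0.
have t0 : 0 < `|a n| by rewrite normr_gt0.
have M0 : 0 < M by exact: lt_le_trans (aM n).
have /key : 0 < `|a n| / (4 * M) by rewrite divr_gt0// mulr_gt0.
have -> : 2 * M * (`|a n| / (4 * M)) = `|a n| / 2 by field; rewrite gt_eqF.
move=> h.
have : `|a n| <= `|a n| / 2.
  apply: h; rewrite ler_pdivrMr ?mulr_gt0// (le_trans (aM n))//.
  have -> : 2^-1 * (4 * M) = M + M :> R[i] by field.
  by rewrite lerDl ltW.
by rewrite ler_pdivlMr// mulrDr mulr1 gerDl lt_geF.
Unshelve. all: by end_near. Qed.

Lemma is_cvg_taylor (a : nat -> R[i]) (z : disc) : sqsum a ->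
  cvgn (series (fun n => a n * val z ^+ n)).
Proof.
move=> ca.
have zc : `|(val z)^*| < 1 by rewrite norm_conjC; exact: (valP z).
have -> : (fun n => a n * val z ^+ n) = (fun n => a n * (((val z)^*) ^+ n)^*).
  by apply/funext => n; rewrite rmorphXn/= conjCK.
exact: is_cvg_inner ca (sqsum_geo zc).
Qed.

End taylor_series.
Arguments is_cvg_taylor {R a} z ca : rename.
Arguments taylor0 {R a M} aM ta n: rename.

Section hardy_def.
Variable R : realType.

(* The Hardy space H^2: functions on the open unit disc that are sums of a power
   series with square-summable coefficients, normed by the l^2 norm of those
   (unique, see taylor_uniq) coefficients. *)
Definition in_hardy (f : disc R -> R[i]) := exists2 a : nat -> R[i], sqsum a & taylor f a.

Definition hardy_pred : {pred disc R -> R[i]} := fun f => `[< in_hardy f >].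

Lemma taylorD (f g : disc R -> R[i]) a b : taylor f a -> taylor g b ->
  taylor (f + g) (fun n => a n + b n).
Proof.
move=> fa gb z.
have -> : series (fun n => (a n + b n) * val z ^+ n) =
  series (fun n => a n * val z ^+ n) \+ series (fun n => b n * val z ^+ n).
  apply/funext => n; rewrite /series/= -big_split/=.
  by apply: eq_bigr => i _; rewrite mulrDl.
exact: (cvgD (fa z) (gb z)).
Qed.

Lemma taylorZ k (f : disc R -> R[i]) a : taylor f a ->
  taylor (k *: f) (fun n => k * a n).
Proof.
move=> fa z.
have -> : series (fun n => (k * a n) * val z ^+ n) =
  (fun=> k) \* series (fun n => a n * val z ^+ n).
  apply/funext => n; rewrite /series/= mulr_sumr/=.
  by apply: eq_bigr => i _; rewrite mulrA.
exact: (cvgM (cvg_cst k) (fa z)).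
Qed.

Lemma taylor_uniq (f : disc R -> R[i]) a b : sqsum a -> sqsum b ->
  taylor f a -> taylor f b -> a = b.
Proof.
move=> ca cb fa fb; apply/funext => n; apply/eqP; rewrite -subr_eq0 -mulN1r; apply/eqP.
pose c := fun n => a n + -1 * b n.
have cc : sqsum c := sqsumD ca (sqsumZ (-1) cb).
have [M cM] := sqsum_bounded cc.
apply: (taylor0 cM).
have -> : (fun=> 0) = f + (-1 *: f) by rewrite scaleN1r subrr.
exact: (taylorD fa (@taylorZ (-1) _ _ fb)).
Qed.

Lemma hardy_submod : submod_closed hardy_pred.
Proof.
split.
  apply/asboolP; exists (fun=> 0); first exact: sqsum0.
  move=> z.
  have -> : series (fun n => 0 * val z ^+ n) = fun=> 0.
    by apply/funext => n; rewrite /series/= big1// => i _; rewrite mul0r.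
  exact: cvg_cst.
move=> k f g /asboolP[a ca fa] /asboolP[b cb gb]; apply/asboolP.
exists (fun n => k * a n + b n); first exact: (sqsumD (sqsumZ k ca) cb).
exact: (taylorD (@taylorZ k _ _ fa) gb).
Qed.
HB.instance Definition _ := GRing.isSubmodClosed.Build _ _ hardy_pred hardy_submod.

End hardy_def.

Record hardy (R : realType) := Hardy { hardy_fun :> disc R -> R[i] ; _ : hardy_fun \in @hardy_pred R }.

Section hardy_theory.
Variable R : realType.
Local Notation disc := (disc R).
Implicit Types f g h : hardy R.

HB.instance Definition _ := [isSub for @hardy_fun R].
HB.instance Definition _ := [Choice of hardy R by <:].
HB.instance Definition _ := [SubChoice_isSubLmodule of hardy R by <:].

Lemma hardyP (f : hardy R) : in_hardy f.
Proof. by apply/asboolP; exact: (valP f). Qed.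

Definition coef (f : hardy R) : nat -> R[i] := sval (cid2 (hardyP f)).

Lemma coef_sqsum f : sqsum (coef f).
Proof. by rewrite /coef; case: cid2. Qed.
Arguments coef_sqsum : clear implicits.

Lemma coefP f : taylor f (coef f).
Proof. by rewrite /coef; case: cid2. Qed.
Arguments coefP : clear implicits.

Lemma coef_uniq f a : sqsum a -> taylor f a -> coef f = a.
Proof. by move=> ca fa; exact (taylor_uniq (coef_sqsum f) ca (coefP f) fa). Qed.

Lemma coefD f g n : coef (f + g) n = coef f n + coef g n.
Proof.
rewrite (@coef_uniq _ (fun n => coef f n + coef g n))//.
  exact: (sqsumD (coef_sqsum f) (coef_sqsum g)).
by rewrite [hardy_fun _](_ : _ = hardy_fun f + hardy_fun g)//; apply: taylorD; exact: coefP.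
Qed.

Lemma coefZ k f n : coef (k *: f) n = k * coef f n.
Proof.
rewrite (@coef_uniq _ (fun n => k * coef f n))//.
  by apply: sqsumZ; exact: coef_sqsum.
by rewrite [hardy_fun _](_ : _ = k *: hardy_fun f)//; apply: taylorZ; exact: coefP.
Qed.

Lemma coefN f n : coef (- f) n = - coef f n.
Proof. by rewrite -scaleN1r coefZ mulN1r. Qed.

Lemma coefB f g n : coef (f - g) n = coef f n - coef g n.
Proof. by rewrite coefD coefN. Qed.

Lemma coef_eq0 f : (forall n, coef f n = 0) -> f = 0.
Proof.
move=> f0; apply: val_inj; apply/funext => z.
apply: (cvg_unique _ (coefP f z)); first exact: norm_hausdorff.
have -> : series (fun n => coef f n * val z ^+ n) = fun=> 0.
  by apply/funext => n; rewrite /series/= big1// => i _; rewrite f0 mul0r.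
exact: cvg_cst.
Qed.

Lemma hardy_ofP (a : nat -> R[i]) : sqsum a ->
  (fun z : disc => limn (series (fun n => a n * val z ^+ n))) \in @hardy_pred R.
Proof.
move=> ca; apply/asboolP; exists a; first exact: ca.
move=> z; exact: (is_cvg_taylor z ca).
Qed.

Definition hardy_of a (ca : sqsum a) := Hardy (hardy_ofP ca).

Lemma coef_of a (ca : sqsum a) : coef (hardy_of ca) = a.
Proof. by apply: (coef_uniq ca) => z; exact: (is_cvg_taylor z ca). Qed.

Definition hardy_inner (f g : hardy R) : R[i] := limn (series (fun n => coef f n * (coef g n)^*)).

Lemma hardy_inner_cvg f g : series (fun n => coef f n * (coef g n)^*) @ \oo --> hardy_inner f g.
Proof. exact (is_cvg_inner (coef_sqsum f) (coef_sqsum g)). Qed.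

Lemma hardy_innerP k f g h : hardy_inner (k *: f + g) h = k * hardy_inner f h + hardy_inner g h.
Proof.
apply: cvg_lim; first exact: norm_hausdorff.
have -> : series (fun n => coef (k *: f + g) n * (coef h n)^*) =
  ((fun=> k) \* series (fun n => coef f n * (coef h n)^*)) \+ series (fun n => coef g n * (coef h n)^*).
  apply/funext => n; rewrite /series/= mulr_sumr -big_split/=.
  by apply: eq_bigr => i _; rewrite coefD coefZ mulrDl mulrA.
exact: (cvgD (cvgM (cvg_cst k) (@hardy_inner_cvg f h)) (@hardy_inner_cvg g h)).
Qed.

Lemma cvg_conj (u : nat -> R[i]) l : u @ \oo --> l -> (fun n => (u n)^*) @ \oo --> l^*.
Proof.
move=> /cvgrPdist_lt ul; apply/cvgrPdist_lt => e e0; apply: filterS (ul _ e0) => n.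
by rewrite -rmorphB/= norm_conjC.
Qed.

Lemma hardy_innerC f g : hardy_inner g f = (hardy_inner f g)^*.
Proof.
apply: cvg_lim; first exact: norm_hausdorff.
have -> : series (fun n => coef g n * (coef f n)^*) = fun m => (series (fun n => coef f n * (coef g n)^*) m)^*.
  apply/funext => n; rewrite /series/= rmorph_sum/=.
  by apply: eq_bigr => i _; rewrite rmorphM/= conjCK mulrC.
exact: cvg_conj (@hardy_inner_cvg f g).
Qed.

Lemma hardy_innerE f : hardy_inner f f = limn (series (fun n => `|coef f n| ^+ 2)).
Proof.
by rewrite /hardy_inner; congr (limn (series _)); apply/funext => n; rewrite normCK.
Qed.

Lemma hardy_inner_gt0 f : f != 0 -> 0 < hardy_inner f f.
Proof.
move=> f0.
have [n fn0] : exists n, coef f n != 0.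
  apply: contrapT => nf; move/negP: f0; apply; apply/eqP; apply: coef_eq0 => n.
  by apply/eqP; apply: contraT => fn; case: nf; exists n.
rewrite hardy_innerE; apply: lt_le_trans (sqsum_le_lim n.+1 (coef_sqsum f)).
rewrite /series/= big_nat_recr//= ltr_wpDl ?exprn_gt0 ?normr_gt0//.
by rewrite sumr_ge0.
Qed.

End hardy_theory.
Arguments coef_sqsum {R} f.
Arguments coefP {R} f.

Section inner_product.
Variables (R : realType) (V : lmodType R[i]) (ip : V -> V -> R[i]).
Hypothesis ipP : forall k x y z, ip (k *: x + y) z = k * ip x z + ip y z.
Hypothesis ipC : forall x y, ip y x = (ip x y)^*.
Hypothesis ip_gt0 : forall x, x != 0 -> 0 < ip x x.

Let ip0l x : ip 0 x = 0.
Proof. by have := ipP (-1) 0 0 x; rewrite scaler0 addr0 mulN1r addNr. Qed.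

Let ipDl x y z : ip (x + y) z = ip x z + ip y z.
Proof. by rewrite -[x]scale1r ipP scale1r mul1r. Qed.

Let ipZl k x z : ip (k *: x) z = k * ip x z.
Proof. by rewrite -[k *: x]addr0 ipP ip0l !addr0. Qed.

Let ipDr x y z : ip z (x + y) = ip z x + ip z y.
Proof. by rewrite ipC ipDl rmorphD/= -!ipC. Qed.

Let ipZr k x z : ip z (k *: x) = k^* * ip z x.
Proof. by rewrite ipC ipZl rmorphM/= -ipC. Qed.

Let ip_ge0 x : 0 <= ip x x.
Proof. by have [->|/ip_gt0/ltW] := eqVneq x 0; rewrite ?ip0l. Qed.

Lemma cauchy_schwarz x y : `|ip x y| ^+ 2 <= ip x x * ip y y.
Proof.
have [->|y0] := eqVneq y 0; first by rewrite ip0l mulr0 ipC ip0l rmorph0 normr0 expr0n.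
have yy := ip_gt0 y0.
rewrite -ler_pdivrMr// -subr_ge0.
have := ip_ge0 (x + (- (ip x y / ip y y)) *: y).
rewrite ipDl !ipDr ipZl !ipZr (ipC x y).
set d := ip x y; set c := ip y y; set b := ip x x.
have cc : c^* = c by rewrite geC0_conj// ltW.
have -> : `|d| ^+ 2 / c = d * d^* / c by rewrite normCK.
rewrite rmorphN rmorphM/= fmorphV/= cc.
rewrite ipZl -/c.
suff -> : b + - (d^* / c) * d + (- (d / c) * d^* + - (d^* / c) * (- (d / c) * c)) = b - d * d^* / c by [].
by field; rewrite gt_eqF.
Qed.

Lemma ip_triangle x y : sqrtC (ip (x + y) (x + y)) <= sqrtC (ip x x) + sqrtC (ip y y).
Proof.
rewrite -(@ler_pXn2r _ 2)// ?nnegrE ?addr_ge0 ?sqrtC_ge0//.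
rewrite sqrtCK sqrrD !sqrtCK ipDl !ipDr (ipC x y).
have -> : ip x x + ip x y + ((ip x y)^* + ip y y) = ip x x + (ip x y + (ip x y)^*) + ip y y by ring.
rewrite lerD2r lerD2l.
have h : ip x y + (ip x y)^* <= `|ip x y| *+ 2.
  rewrite (addcJ (ip x y)) mulr_natl lerMn2r/=.
  by apply: le_trans (normc_ge_Re _); rewrite lecR ler_norm.
apply: (le_trans h); rewrite lerMn2r/=.
rewrite -(@ler_pXn2r _ 2)// ?nnegrE ?mulr_ge0 ?sqrtC_ge0//.
by rewrite exprMn !sqrtCK cauchy_schwarz.
Qed.

Lemma ip_normZ k x : sqrtC (ip (k *: x) (k *: x)) = `|k| * sqrtC (ip x x).
Proof.
rewrite ipZl ipZr mulrA -normCK sqrtCM ?nnegrE ?exprn_ge0//.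
by rewrite sqrCK.
Qed.

Lemma ip_norm_eq0 x : sqrtC (ip x x) = 0 -> x = 0.
Proof.
move=> /eqP; rewrite sqrtC_eq0 => x0; apply/eqP; apply: contraT => /ip_gt0.
by rewrite (eqP x0) ltxx.
Qed.

End inner_product.

Section hardy_norm.
Variable R : realType.
Implicit Types f g : hardy R.

HB.instance Definition _ := @Lmodule_isNormed.Build R[i] (hardy R)
  (fun f => sqrtC (hardy_inner f f))
  (ip_triangle (@hardy_innerP R) (@hardy_innerC R) (@hardy_inner_gt0 R))
  (ip_normZ (@hardy_innerP R) (@hardy_innerC R) (@hardy_inner_gt0 R))
  (ip_norm_eq0 (@hardy_inner_gt0 R)).

Lemma hardy_normE f : hardy_inner f f = `|f| ^+ 2.
Proof. by rewrite /Num.norm/= sqrtCK. Qed.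

Lemma coef_sum_le f N : series (fun n => `|coef f n| ^+ 2) N <= `|f| ^+ 2.
Proof. by rewrite -hardy_normE hardy_innerE; exact: (sqsum_le_lim N (coef_sqsum f)). Qed.

Lemma coef_le f n : `|coef f n| <= `|f|.
Proof.
rewrite -(@ler_pXn2r _ 2)// ?nnegrE//; apply: le_trans (coef_sum_le f n.+1).
by rewrite /series/= big_nat_recr//= lerDr sumr_ge0.
Qed.

Lemma hardy_complete (F : set_system (hardy R)) : ProperFilter F -> cauchy F -> cvg F.
Proof.
move=> FF /cauchy_ballP Fc.
have coefc n : cvg ((fun f => coef f n) @ F).
  apply/cauchy_cvgP/cauchy_ballP => e e0.
  have [[A B] /= [FA FB] AB] := Fc _ e0.
  exists ((fun f => coef f n) @` A, (fun f => coef f n) @` B) => /=.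
    by split; [apply: filterS FA => x Ax; exists x|apply: filterS FB => x Ax; exists x].
  move=> [_ _] /= [[x Ax <-] [y By <-]]; have := AB (x, y) (conj Ax By).
  rewrite -!ball_normE /=; apply: le_lt_trans; rewrite -coefB; exact: coef_le.
pose a n := lim ((fun f => coef f n) @ F).
have ac n : (fun f => coef f n) @ F --> a n by exact: coefc.
have key (e : R[i]) : 0 < e -> \forall f \near F,
    forall N, series (fun n => `|coef f n - a n| ^+ 2) N <= e ^+ 2.
  move=> e0; have [[A B] /= [FA FB] AB] := Fc _ e0.
  apply: filterS FA => f Af N.
  have cN : (fun g => series (fun n => `|coef f n - coef g n| ^+ 2) N) @ F -->
      series (fun n => `|coef f n - a n| ^+ 2) N.
    elim: N => [|N IH].
      rewrite /series/= big_geq//.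
      have -> : (fun g : hardy R => \sum_(0 <= n < 0) `|coef f n - coef g n| ^+ 2) = fun=> 0.
        by apply/funext => g; rewrite big_geq.
      exact: cvg_cst.
    have -> : (fun g => series (fun n => `|coef f n - coef g n| ^+ 2) N.+1) =
       (fun g => series (fun n => `|coef f n - coef g n| ^+ 2) N) \+
       ((fun g => `|coef f N - coef g N|) \* (fun g => `|coef f N - coef g N|)).
      by apply/funext => g; rewrite /series/= big_nat_recr.
    rewrite [X in _ --> X](_ : _ = series (fun n => `|coef f n - a n| ^+ 2) N +
       `|coef f N - a N| * `|coef f N - a N|); last by rewrite /series/= big_nat_recr.
    have cc : (fun g => `|coef f N - coef g N|) @ F --> `|coef f N - a N|.
      exact: (cvg_norm (cvgB (cvg_cst (coef f N)) (ac N))).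
    exact: (cvgD IH (cvgM cc cc)).
  apply: (cvgc_le cN); apply: filterS FB => g Bg.
  have := AB (f, g) (conj Af Bg); rewrite -ball_normE /= => fg.
  apply: (@le_trans _ _ (`|f - g| ^+ 2)).
    apply: le_trans (coef_sum_le (f - g) N).
    by rewrite le_eqVlt; apply/orP; left; apply/eqP; apply: eq_bigr => i _; rewrite coefB.
  by rewrite lerXn2r ?nnegrE// ltW.
have sa : sqsum a.
  have [f fa] := filter_ex (key _ (@ltr01 R[i])).
  have h : sqsum (fun n => coef f n - a n).
    apply: (@is_cvg_cseries _ _ (1 ^+ 2)) => n; [by rewrite exprn_ge0|exact: fa].
  have -> : a = fun n => coef f n + (-1) * (coef f n - a n) by apply/funext => n; ring.
  exact: (sqsumD (coef_sqsum f) (sqsumZ (-1) h)).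
apply/cvg_ex; exists (hardy_of sa).
apply: (@cvgrPdist_le _ _ _ F _ id _).2 => e e0.
apply: filterS (key _ e0) => f fa.
rewrite distrC -(@ler_pXn2r _ 2)// ?nnegrE// ?(ltW e0)//.
rewrite -hardy_normE hardy_innerE.
apply: (cvgc_le (coef_sqsum (f - hardy_of sa))).
apply: nearW => N; apply: le_trans (fa N).
by rewrite le_eqVlt; apply/orP; left; apply/eqP; apply: eq_bigr => i _; rewrite coefB coef_of.
Qed.

HB.instance Definition _ := Uniform_isComplete.Build (hardy R) hardy_complete.
End hardy_norm.

(* [inner] is linear in its first argument and conjugate-linear in the second. *)
HB.mixin Record CompleteNormedModule_isHilbert (R : realType) V
    of CompleteNormedModule R[i] V := {
  inner : V -> V -> R[i];
  innerP : forall k x y z, inner (k *: x + y) z = k * inner x z + inner y z;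
  innerC : forall x y, inner y x = (inner x y)^*;
  inner_normE : forall x, inner x x = `|x| ^+ 2
}.

#[short(type="hilbertType")]
HB.structure Definition Hilbert (R : realType) :=
  {V of CompleteNormedModule R[i] V & CompleteNormedModule_isHilbert R V}.

HB.instance Definition _ (R : realType) :=
  CompleteNormedModule_isHilbert.Build R (hardy R) (@hardy_innerP R)
    (@hardy_innerC R) (@hardy_normE R).

Section shift_kernel.
Variable R : realType.
Local Notation disc := (disc R).
Implicit Types (f : hardy R) (l z : disc).

Let shift_coef (a : nat -> R[i]) n := if n is m.+1 then a m else 0.

Let shift_coef_sqsum a : sqsum a -> sqsum (shift_coef a).
Proof.
move=> ca; apply: (@is_cvg_cseries _ _ (limn (series (fun n => `|a n| ^+ 2)))).
  by move=> n; rewrite exprn_ge0.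
case=> [|n].
  apply: le_trans (sqsum_le_lim 0 ca).
  by rewrite /series/= !big_geq.
apply: le_trans (sqsum_le_lim n ca).
by rewrite /series/= big_nat_recl//= normr0 expr0n add0r.
Qed.

Let shift_taylor (g : disc -> R[i]) a : taylor g a ->
  taylor (fun z => val z * g z) (shift_coef a).
Proof.
move=> ga z; rewrite -cvg_shiftS/=.
have -> : (fun n => series (fun n => shift_coef a n * val z ^+ n) n.+1) =
    (fun=> val z) \* series (fun n => a n * val z ^+ n).
  apply/funext => n; rewrite /series/= big_nat_recl//= mul0r add0r mulr_sumr.
  by apply: eq_bigr => i _; rewrite exprS mulrCA.
exact: (cvgM (cvg_cst (val z)) (ga z)).
Qed.

Lemma hardy_shift_subproof f : (fun z => val z * f z) \in @hardy_pred R.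
Proof.
apply/asboolP; exists (shift_coef (coef f)).
  exact: (shift_coef_sqsum (coef_sqsum f)).
exact: (shift_taylor (coefP f)).
Qed.

Definition hardy_shift f : hardy R := Hardy (hardy_shift_subproof f).

Lemma coef_shift f n :
  coef (hardy_shift f) n = if n is m.+1 then coef f m else 0.
Proof.
by rewrite (coef_uniq (f := hardy_shift f) (shift_coef_sqsum (coef_sqsum f)) (shift_taylor (coefP f))).
Qed.

Let kernel_sqsum l : sqsum (fun n => ((val l)^*) ^+ n).
Proof. by apply: sqsum_geo; rewrite norm_conjC; exact: (valP l). Qed.

Let kernel_taylor l :
  taylor (fun z => (1 - (val l)^* * val z)^-1) (fun n => ((val l)^*) ^+ n).
Proof.
move=> z; set w := (val l)^* * val z.
have w1 : `|w| < 1.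
  by rewrite normrM norm_conjC mulr_ilt1// ?(valP l) ?(valP z).
have w0 : 1 - w != 0.
  by rewrite subr_eq0; apply: contraTneq w1 => <-; rewrite normr1 ltxx.
set u := series _.
have cu : u @ \oo --> limn u := is_cvg_taylor z (@kernel_sqsum l).
suff -> : (1 - w)^-1 = limn u by exact: cu.
have e : limn u = 1 + w * limn u.
  have cs : (fun n => u n.+1) @ \oo --> limn u by rewrite cvg_shiftS.
  apply: (cvg_unique _ cs); first exact: norm_hausdorff.
  have -> : (fun n => u n.+1) = (fun=> 1) \+ ((fun=> w) \* u).
    apply/funext => n; rewrite /u /series/= big_nat_recl//= !expr0 mul1r mulr_sumr.
    by congr (_ + _); apply: eq_bigr => i _; rewrite !exprS mulrACA.
  apply: cvgD; first exact: cvg_cst.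
  apply: cvgM; [exact: cvg_cst|exact: cu].
by apply: (mulfI w0); rewrite divff// mulrBl mul1r {1}e addrK.
Qed.

Lemma hardy_kernel_subproof l :
  (fun z => (1 - (val l)^* * val z)^-1) \in @hardy_pred R.
Proof.
by apply/asboolP; exists (fun n => ((val l)^*) ^+ n);
  [exact: kernel_sqsum|exact: kernel_taylor].
Qed.

Definition hardy_kernel l : hardy R := Hardy (hardy_kernel_subproof l).

Lemma coef_kernel l n : coef (hardy_kernel l) n = ((val l)^*) ^+ n.
Proof. by rewrite (coef_uniq (f := hardy_kernel l) (@kernel_sqsum l) (@kernel_taylor l)). Qed.

Lemma inner_kernel f l : inner f (hardy_kernel l) = f l.
Proof.
apply: (cvg_lim (@norm_hausdorff _ _)).
rewrite (_ : series _ = series (fun n => coef f n * val l ^+ n)); first exact: coefP.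
congr series; apply/funext => n.
by rewrite coef_kernel rmorphXn/= conjCK.
Qed.

End shift_kernel.

Definition separable_space (V : topologicalType) :=
  exists2 D : set V, countable D & dense D.

Section operators.
Variable R : realType.
Implicit Types V W : hilbertType R.

(* The norm |A x| is a nonnegative real number of type R[i]. *)
Definition opnorm V W (A : V -> W) : \bar R :=
  ereal_sup [set (complex.Re `|A x|)%:E | x in [set x | `|x| <= 1]].

Definition power_bounded V (T : V -> V) : Prop :=
  (ereal_sup [set opnorm (iter n T) | n in [set n | (1 <= n)%N]] < +oo)%E.

(* A bounded A has exactly one adjoint; positive definiteness of [inner] makes B
   unique, and B is automatically linear and bounded. *)
Definition is_adjoint V W (A : V -> W) (B : W -> V) :=
  forall x y, inner (A x) y = inner x (B y).

Definition opker V W (A : V -> W) : set V := [set x | A x = 0].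

Definition quasiaffinity V W (X : {linear V -> W}) :=
  [/\ continuous X, opker X = [set 0] & dense (range X)].

(* An orthonormal basis is a maximal orthonormal subset of M. *)
Definition orthonormal_basis V (M B : set V) :=
  [/\ B `<=` M,
      forall x y, B x -> B y -> inner x y = (x == y)%:R &
      forall x, M x -> (forall b, B b -> inner x b = 0) -> x = 0].

End operators.

Variant countable_cardinal := FiniteCard of nat | Aleph0.

(* A set of natural numbers having the given cardinality. *)
Definition card_repr (N : countable_cardinal) : set nat :=
  if N is FiniteCard n then `I_n else [set: nat].

(* Hilbert space dimension of the closed subspace M. *)
Definition hilbert_dim (R : realType) (V : hilbertType R) (M : set V)
    (N : countable_cardinal) :=
  exists2 B, orthonormal_basis M B & (B #= card_repr N)%card.

Definition asymp (K : numDomainType) (I : Type) (a b : I -> K) :=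
  exists c C : K, [/\ 0 < c, 0 < C & forall i, c * b i <= a i <= C * b i].

(* Main.v *)
From HB Require Import structures.
Require Import Defs.
From mathcomp Require Import all_boot all_order all_algebra complex.
From mathcomp Require Import ring zify.
From mathcomp Require Import all_classical all_reals all_analysis.

Set Implicit Arguments.
Unset Strict Implicit.
Unset Printing Implicit Defensive.

Import Order.TTheory GRing.Theory Num.Theory.
Import numFieldNormedType.Exports.

Local Open Scope classical_set_scope.
Local Open Scope complex_scope.
Local Open Scope ring_scope.

(** If [X T = S X] with [X] injective and of dense range, then [X] identifies the
    space of [T] with a dense subspace of [H^2] which carries a finer Hilbert
    norm, is invariant under multiplication by [z], and on which this
    multiplication is power bounded. The kernel of the adjoint of [T] is the
    orthogonal complement of the multiples of [z].

    Suppose that [K0] is such a space, in which the polynomials are dense, and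
    that [v] is a bounded analytic function for which no function of [K0] other
    than [0] lies in [v H^2]. Then a sum [x_0 + v x_1 + v^2 x_2 + ...] with terms
    in [K0] determines [x_0], then [x_1], and so on ([Vseq_head]): the orthogonal
    sum of [N] copies of [K0] is mapped injectively into [H^2] by
    [x |-> sum_j v^j x_j], and every copy contributes one dimension to the kernel
    of the adjoint, spanned by the representative of [f |-> f(0)]
    ([kernel_dim_aux]). Such a [K0] cannot be invariant under multiplication by
    [v], so power boundedness must not come from a functional calculus for
    bounded analytic functions, as it would for contractions.

    The norm of [K0] is the graph norm of a sequence of operators [Phi_b]
    ([graph_family]). Here [Phi_b f] is the average of [4^b] sequences
    [k |-> sum_p r^p f^(p N + b - k)], where [1 <= p <= P], [k < N/2],
    [1 - r = 8^-(b+1)], and [N] runs through a very sparse set of powers of 2.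
    The following properties hold.

    - Were it not for the cutoff at [N/2], each of the [4^b] sequences would
      intertwine the shift with the backward shift. The errors due to the cutoff
      are supported on disjoint sets of [k], and they essentially involve
      disjoint sets of coefficients of [f]. So their sum is bounded by a
      multiple of the square root of [8^b], and their average is small,
      uniformly in the power of the shift ([window_bound], [blockPhi_shift]).
      This is the mechanism of Foguel's power bounded operator.

    - Let [v] be a multiple of [z] times the Blaschke product with zeros at
      the roots of [z^N = r], for all [b] and [N]; it converges since
      [sum_b 4^b (1 - r)] is finite. If [F] is a multiple of [v], then
      [sum_(p >= 0) r^p F^(m + p N) = 0] for [m < N], so that the entry
      [k = b - m] of [Phi_b F] is close to [- F^(m)] for all [b >= m]. As the
      norms of the [Phi_b F] are square summable when [F] belongs to [K0], all
      coefficients of [F] vanish ([blockPhi_bprodoo], [graph_inter]).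

    - A truncation of the kernel at degree about [1 / (1 - |l|^2)] has a norm in
      [K0] comparable to the norm of the kernel in [H^2] ([blockPhi_poly],
      [test_vector_exists]). Testing the adjoint of [X] against it gives the
      lower estimate ([adjoint_lower]); the upper one is the boundedness of
      [X]. *)


(** * Inner product spaces and least norms *)

Section inner_theory.
Variables (R : realType) (V : hilbertType R).
Implicit Types x y z : V.

Lemma innerDl x y z : inner (x + y) z = inner x z + inner y z.
Proof. by rewrite -[x]scale1r innerP scale1r mul1r. Qed.

Lemma inner0l z : inner 0 z = 0 :> R[i].
Proof. by apply: (addrI (inner 0 z)); rewrite -innerDl !addr0. Qed.

Lemma innerZl k x z : inner (k *: x) z = k * inner x z.
Proof. by rewrite -[k *: x]addr0 innerP inner0l addr0. Qed.

Lemma innerDr x y z : inner z (x + y) = inner z x + inner z y.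
Proof. by rewrite innerC innerDl rmorphD/= -!innerC. Qed.

Lemma innerZr k x z : inner z (k *: x) = k^* * inner z x.
Proof. by rewrite innerC innerZl rmorphM/= -innerC. Qed.

Lemma inner0r z : inner z 0 = 0 :> R[i].
Proof. by rewrite innerC inner0l rmorph0. Qed.

Lemma innerNl x z : inner (- x) z = - inner x z.
Proof. by rewrite -scaleN1r innerZl mulN1r. Qed.

Lemma innerNr x z : inner z (- x) = - inner z x.
Proof. by rewrite innerC innerNl rmorphN/= -innerC. Qed.

Lemma innerBl x y z : inner (x - y) z = inner x z - inner y z.
Proof. by rewrite innerDl innerNl. Qed.

Lemma innerBr x y z : inner z (x - y) = inner z x - inner z y.
Proof. by rewrite innerDr innerNr. Qed.

Lemma inner_gt0 x : x != 0 -> 0 < inner x x.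
Proof. by move=> x0; rewrite inner_normE exprn_gt0// normr_gt0. Qed.

Lemma inner_eq0 x : inner x x = 0 -> x = 0.
Proof. by rewrite inner_normE => /eqP; rewrite expf_eq0/= normr_eq0 => /eqP. Qed.

Lemma inner_le x y : `|inner x y| <= `|x| * `|y|.
Proof.
rewrite -(@ler_pXn2r _ 2)// ?nnegrE ?mulr_ge0// exprMn -!inner_normE.
exact: (cauchy_schwarz (@innerP R V) (@innerC R V) inner_gt0).
Qed.

Lemma normD_sqr x y :
  `|x + y| ^+ 2 = `|x| ^+ 2 + `|y| ^+ 2 + (inner x y + (inner x y)^*).
Proof. by rewrite -!inner_normE innerDl !innerDr (innerC x y); ring. Qed.

Lemma parallelogram x y :
  `|x + y| ^+ 2 + `|x - y| ^+ 2 = 2 * (`|x| ^+ 2 + `|y| ^+ 2).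
Proof. by rewrite !normD_sqr normrN innerNr rmorphN/=; ring. Qed.

End inner_theory.

Section bounded_linear.
Variable R : realType.
Implicit Types V W : hilbertType R.

Lemma bounded_continuous V W (A : {linear V -> W}) (C : R[i]) :
  (forall x, `|A x| <= C * `|x|) -> continuous A.
Proof.
move=> AC x; apply/cvgrPdist_le => e e0.
have C0 : 0 < `|C| + 1 by rewrite ltr_wpDl.
near=> y.
rewrite -linearB/=.
have [->|xy] := eqVneq x y; first by rewrite subrr linear0 normr0 ltW.
have xy0 : 0 < `|x - y| by rewrite normr_gt0 subr_eq0.
have Cr : 0 <= C.
  by rewrite -(pmulr_lge0 _ xy0); exact: le_trans (AC _).
apply: le_trans (AC _) _.
apply: (@le_trans _ _ ((`|C| + 1) * `|x - y|)).
  by rewrite ler_wpM2r// ger0_norm// lerDl.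
rewrite -ler_pdivlMl//.
near: y; apply: cvgr_dist_le => //.
by rewrite mulr_gt0// invr_gt0.
Unshelve. all: by end_near. Qed.

Lemma inner_continuousl V (y : V) (T : Type) (F : set_system T) {FF : Filter F}
  (u : T -> V) l : u @ F --> l -> (fun t => inner (u t) y) @ F --> inner l y.
Proof.
move=> ul; apply/cvgrPdist_le => e e0; near=> t.
rewrite -innerBl; apply: le_trans (inner_le _ _) _.
have y0 : 0 < `|y| + 1 by rewrite ltr_wpDl.
apply: (@le_trans _ _ (`|l - u t| * (`|y| + 1))); first by rewrite ler_wpM2l// lerDl.
rewrite -ler_pdivlMr//; near: t.
by move/cvgrPdist_le : ul => /(_ (e / (`|y| + 1))); apply; rewrite divr_gt0.
Unshelve. all: by end_near. Qed.

End bounded_linear.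

Section minimization.
Variables (R : realType) (V : hilbertType R).

Lemma near_inv_le (e : R[i]) : 0 < e -> exists n : nat, n.+1%:R^-1 <= e.
Proof.
move=> /ltc_epsE[-> {}e0].
have [n ne] := ltr_add_invr e0.
exists n; move: ne; rewrite add0r => /ltW.
by rewrite -lecR rmorphV ?unitfE// rmorph_nat.
Qed.

(** By the parallelogram law, a sequence that minimizes the norm over a set
    closed under midpoints is a Cauchy sequence. *)
Lemma least_norm (D : set V) : D !=set0 ->
  (forall x y, D x -> D y -> D (2^-1 *: (x + y))) ->
  exists (u : nat -> V) (p : V), [/\ forall n, D (u n), u @ \oo --> p &
    forall d, D d -> `|p| <= `|d|].
Proof.
move=> [d0 Dd0] Dmid.
pose N := [set complex.Re (`|d| ^+ 2) | d in D].
have NE d : `|d| ^+ 2 = (complex.Re (`|d| ^+ 2))%:C :> R[i].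
  by apply/esym/RRe_real; rewrite ger0_real// exprn_ge0.
have Ninf : has_inf N.
  split; first by exists (complex.Re (`|d0| ^+ 2)); exists d0.
  exists 0 => _ [d _ <-]; rewrite -lecR -NE exprn_ge0//.
pose delta := (inf N)%:C : R[i].
have dle d : D d -> delta <= `|d| ^+ 2.
  move=> Dd; rewrite NE lecR; apply: ge_inf; [exact: Ninf.2|by exists d].
have /choice[u uP] : forall n, exists d, D d /\ `|d| ^+ 2 <= delta + n.+1%:R^-1.
  move=> n.
  have [|_ [d Dd <-] dn] := @inf_adherent _ N (n.+1%:R^-1) _ Ninf.
    by rewrite invr_gt0.
  exists d; split=> //; rewrite NE; move/ltW: dn.
  by rewrite -lecR rmorphD/= rmorphV ?unitfE// rmorph_nat.
have Du n : D (u n) by have [] := uP n.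
have udist n m : `|u n - u m| ^+ 2 <= 2 * (n.+1%:R^-1 + m.+1%:R^-1).
  have := parallelogram (u n) (u m).
  have := dle _ (Dmid _ _ (Du n) (Du m)).
  rewrite normrZ exprMn normfV gtr0_norm// exprVn => h.
  have {}h : 4 * delta <= `|u n + u m| ^+ 2.
    rewrite -ler_pdivlMl//; apply: le_trans h _.
    by rewrite [leRHS](_ : _ = 2 ^- 2 * `|u n + u m| ^+ 2)// ; congr (_ * _); field.
  move=> e; rewrite -(lerD2l (`|u n + u m| ^+ 2)) e.
  apply: (@le_trans _ _ (4 * delta + 2 * (n.+1%:R^-1 + m.+1%:R^-1))); last first.
    by rewrite lerD2r.
  have := lerD (uP n).2 (uP m).2; rewrite -(ler_pM2l (_ : 0 < 2))// => /le_trans; apply.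
  by rewrite le_eqVlt; apply/orP; left; apply/eqP; ring.
have : cauchy (u @ \oo).
  apply/cauchy_ballP => e e0.
  have e20 : 0 < e ^+ 2 / 8 by rewrite divr_gt0// exprn_gt0.
  have [k ke] := near_inv_le e20.
  exists (u @` [set n | (k <= n)%N], u @` [set n | (k <= n)%N]) => /=.
    by split; exists k => // n /= kn; exists n.
  move=> [_ _] /= [[n kn <-] [m km <-]]; rewrite -ball_normE /=.
  rewrite -(@ltr_pXn2r _ 2)// ?nnegrE// ?(ltW e0)//.
  apply: le_lt_trans (udist n m) _.
  have inv_le a : (k <= a)%N -> a.+1%:R^-1 <= e ^+ 2 / 8.
    by move=> ka; apply: le_trans ke; rewrite lef_pV2 ?posrE// ler_nat.
  apply: (@le_lt_trans _ _ (2 * (e ^+ 2 / 8 + e ^+ 2 / 8))).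
    by rewrite ler_wpM2l// lerD// inv_le.
  have -> : 2 * (e ^+ 2 / 8 + e ^+ 2 / 8) = e ^+ 2 / 2 by field.
  by rewrite ltr_pdivrMr// mulr_natr mulr2n ltrDl exprn_gt0.
move=> /cauchy_cvgP/cvg_ex[p up].
exists u, p; split => // d Dd.
rewrite -(@ler_pXn2r _ 2)// ?nnegrE//.
apply: (le_trans _ (dle _ Dd)).
have up2 : (fun n => `|u n| ^+ 2) @ \oo --> `|p| ^+ 2.
  have nu : (fun n => `|u n|) @ \oo --> (`|p| : R[i]) by exact: (cvg_norm up).
  rewrite expr2.
  have -> : (fun n => `|u n| ^+ 2) = (fun n => `|u n|) \* (fun n => `|u n|) by [].
  exact: (cvgM nu nu).
have dl : (fun n => delta + n.+1%:R^-1) @ \oo --> delta.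
  rewrite -[X in _ --> X]addr0; apply: cvgD; first exact: cvg_cst.
  apply/cvgrPdist_le => e e0; have [k ke] := near_inv_le e0.
  exists k => // n /= kn; rewrite sub0r normrN ger0_norm ?invr_ge0//.
  by apply: le_trans ke; rewrite lef_pV2 ?posrE// ler_nat.
rewrite -subr_le0.
apply: (cvgc_le (cvgB up2 dl)).
by apply: nearW => n /=; rewrite subr_le0; have [] := uP n.
Qed.

End minimization.

(** * Riesz representation, adjoints, separability *)

Definition imag_unit (R : realType) : R[i] := 'i%C.

Section riesz_section.
Variable R : realType.

Lemma cvg_invn : (fun n : nat => n.+1%:R^-1 : R[i]) @ \oo --> (0 : R[i]).
Proof.
apply/cvgrPdist_le => e e0; have [k ke] := near_inv_le e0.
exists k => // n /= kn; rewrite sub0r normrN ger0_norm ?invr_ge0//.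
by apply: le_trans ke; rewrite lef_pV2 ?posrE// ler_nat.
Qed.

Lemma ge0_limit (A B : R[i]) : (forall n : nat, 0 <= A * n.+1%:R^-1 + B) -> 0 <= B.
Proof.
move=> h.
have AB : (fun n : nat => A * n.+1%:R^-1 + B) @ \oo --> A * 0 + B.
  have := cvgD (cvgM (cvg_cst A) cvg_invn) (cvg_cst B); exact.
move: AB; rewrite mulr0 add0r => AB.
by apply: (cvgc_ge AB); apply: nearW.
Qed.

Variable V : hilbertType R.

(** Rational multipliers suffice: letting the multiplier tend to [0] in the four
    directions [1], [-1], [i], [-i] makes the derivative of the squared norm
    vanish. *)
Lemma least_norm_orth (x w : V) :
  (forall s t : rat, `|x| <= `|x + (ratr s + imag_unit R * ratr t) *: w|) ->
  inner x w = 0.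
Proof.
move=> h; set z := inner x w.
have key (s t : rat) : 0 <= (ratr s + imag_unit R * ratr t)^* * z + ((ratr s + imag_unit R * ratr t)^* * z)^*.
  set a := ratr s + imag_unit R * ratr t.
  apply: (@ge0_limit (`|a| ^+ 2 * `|w| ^+ 2)) => n.
  have := h (s / n.+1%:R) (t / n.+1%:R).
  have -> : ratr (s / n.+1%:R) + imag_unit R * ratr (t / n.+1%:R) = a * n.+1%:R^-1 :> R[i].
    by rewrite !rmorphM/= !fmorphV/= !ratr_nat /a; ring.
  rewrite -(@ler_pXn2r _ 2)// ?nnegrE// normD_sqr innerZr.
  rewrite -addrA lerDl normrZ -/z.
  have n0 : 0 < n.+1%:R :> R[i] by [].
  have nc : (n.+1%:R^-1 : R[i])^* = n.+1%:R^-1 by rewrite geC0_conj// invr_ge0.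
  rewrite rmorphM/= nc normrM [`|n.+1%:R^-1|]ger0_norm ?invr_ge0//.
  move=> h1; rewrite -(pmulr_rge0 _ (_ : 0 < n.+1%:R^-1))//.
  apply: le_trans h1 _; rewrite le_eqVlt; apply/orP; left; apply/eqP.
  by rewrite !rmorphM/= nc; ring.
have k1 := key 1 0; have k2 := key (-1) 0; have k3 := key 0 1; have k4 := key 0 (-1).
have zz : z + z^* = 0.
  apply/eqP; rewrite eq_le; apply/andP; split.
    move: k2; rewrite !rmorph0 !mulr0 !addr0 !(rmorphN, rmorph1).
    by rewrite !mulN1r rmorphN/= -opprD oppr_ge0.
  by move: k1; rewrite !rmorph0 !mulr0 !addr0 !rmorph1 !mul1r.
have ii : (imag_unit R)^* = - imag_unit R by exact: conjCi.
have cM (a b : R[i]) : (a * b)^* = a^* * b^* by rewrite rmorphM.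
have cN (a : R[i]) : (- a)^* = - a^* by rewrite rmorphN.
have zi : z = z^*.
  have i0 : imag_unit R != 0 by exact: neq0Ci.
  apply: (mulfI i0); apply/eqP; rewrite eq_le; apply/andP; split.
    move: k3; rewrite !rmorph0 !add0r !rmorph1 !mulr1 cM !ii cN ii opprK mulNr.
    by rewrite addrC subr_ge0.
  move: k4; rewrite !rmorph0 !add0r !(rmorphN, rmorph1) !mulrN1 cM !cN !ii !opprK mulNr.
  by rewrite cN ii opprK subr_ge0.
by apply/eqP; move/eqP: zz; rewrite -zi -mulr2n mulrn_eq0.
Qed.

(** The vector representing a functional is a multiple of the shortest vector
    on which the functional takes the value 1. *)
Lemma riesz (phi : V -> R[i]) (C : R[i]) :
  (forall k x y, phi (k *: x + y) = k * phi x + phi y) ->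
  (forall x, `|phi x| <= C * `|x|) ->
  exists v, forall x, phi x = inner x v.
Proof.
move=> phiP phiC.
have phi0 : phi 0 = 0.
  by have := phiP (-1) 0 0; rewrite scaler0 addr0 mulN1r addNr.
have phiD x y : phi (x + y) = phi x + phi y by rewrite -[x]scale1r phiP scale1r mul1r.
have phiZ k x : phi (k *: x) = k * phi x by rewrite -[k *: x]addr0 phiP phi0 !addr0.
have phiN x : phi (- x) = - phi x by rewrite -scaleN1r phiZ mulN1r.
have [[x0 x0P]|nx] := pselect (exists x, phi x != 0); last first.
  exists 0 => x; rewrite inner0r; apply/eqP; apply: contraT => ?; case: nx.
  by exists x.
have [||u [p [Du up pmin]]] := @least_norm R V [set x | phi x = 1].
- by exists ((phi x0)^-1 *: x0) => /=; rewrite phiZ mulVf.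
- by move=> x y /= x1 y1; rewrite phiZ phiD x1 y1; field.
have phip : phi p = 1.
  apply/eqP; rewrite -subr_eq0 -normr_le0.
  have cu : (fun n => C * `|p - u n|) @ \oo --> (0 : R[i]).
    rewrite -[X in _ --> X](mulr0 C); apply: cvgM; first exact: cvg_cst.
    rewrite -[X in _ --> X](@normr0 _ V) -(subrr p).
    exact: (cvg_norm (cvgB (cvg_cst p) up)).
  apply: (cvgc_ge cu); apply: nearW => n.
  have -> : phi p - 1 = phi (p - u n) by rewrite phiD phiN Du.
  exact: phiC.
have porth w : phi w = 0 -> inner w p = 0.
  move=> w0; rewrite innerC least_norm_orth ?rmorph0// => s t.
  by apply: pmin => /=; rewrite phiD phiZ w0 mulr0 addr0.
have p0 : p != 0.
  by apply/eqP => pE; move: phip; rewrite pE phi0 => /eqP; rewrite eq_sym oner_eq0.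
have pp := inner_gt0 p0.
exists ((inner p p)^-1 *: p) => x.
have : inner (x - phi x *: p) p = 0.
  by apply: porth; rewrite phiD phiN !phiZ phip; ring.
rewrite innerBl innerZl => /eqP; rewrite subr_eq0 innerZr => /eqP ->.
by rewrite fmorphV/= geC0_conj ?ltW// mulrC mulfK// gt_eqF.
Qed.

End riesz_section.

Section adjoint_section.
Variables (R : realType) (V W : hilbertType R).

Lemma adjoint_exists (A : {linear V -> W}) (C : R[i]) :
  (forall x, `|A x| <= C * `|x|) -> exists B : W -> V, is_adjoint A B.
Proof.
move=> AC.
have /choice[B BP] : forall y, exists v, forall x, inner (A x) y = inner x v.
  move=> y; apply: (@riesz _ _ (fun x => inner (A x) y) (C * `|y|)).
    by move=> k u v; rewrite linearP innerP.
  by move=> x; apply: le_trans (inner_le _ _) _; rewrite mulrAC ler_wpM2r.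
by exists B => x y; exact: BP.
Qed.

End adjoint_section.

Section separable.
Variables (R : realType) (V : hilbertType R) (v : nat -> V).

Let comb (pq : {poly rat} * {poly rat}) : V :=
  \sum_(i < maxn (size pq.1) (size pq.2)) (ratr pq.1`_i + imag_unit R * ratr pq.2`_i) *: v i.

Let combE (p q : {poly rat}) n : (size p <= n)%N -> (size q <= n)%N ->
  comb (p, q) = \sum_(i < n) (ratr p`_i + imag_unit R * ratr q`_i) *: v i.
Proof.
move=> pn qn; rewrite /comb/=.
have mn : (maxn (size p) (size q) <= n)%N by rewrite geq_max pn.
rewrite (big_ord_widen n (fun i => (ratr p`_i + imag_unit R * ratr q`_i) *: v i) mn).
rewrite big_mkcond/=; apply: eq_bigr => i _; case: ltnP => //.
rewrite geq_max => /andP[pi qi].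
by rewrite !nth_default// !rmorph0 mulr0 addr0 scale0r.
Qed.

Let combD p q p' q' : comb (p, q) + comb (p', q') = comb (p + p', q + q').
Proof.
set n := maxn (maxn (size p) (size q)) (maxn (size p') (size q')).
have hp : (size p <= n)%N by rewrite /n !leq_max leqnn.
have hq : (size q <= n)%N by rewrite /n !leq_max leqnn orbT.
have hp' : (size p' <= n)%N by rewrite /n !leq_max leqnn !orbT.
have hq' : (size q' <= n)%N by rewrite /n !leq_max leqnn !orbT.
rewrite (combE hp hq) (combE hp' hq') (@combE _ _ n); last first.
- by apply: leq_trans (size_polyD _ _) _; rewrite geq_max hq.
- by apply: leq_trans (size_polyD _ _) _; rewrite geq_max hp.
rewrite -big_split/=; apply: eq_bigr => i _.
by rewrite -scalerDl !coefD !rmorphD/=; congr (_ *: _); ring.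
Qed.

Let combZ (c : rat) p q : ratr c *: comb (p, q) = comb (c *: p, c *: q).
Proof.
set n := maxn (size p) (size q).
have hp : (size p <= n)%N by rewrite /n !leq_max leqnn.
have hq : (size q <= n)%N by rewrite /n !leq_max leqnn orbT.
rewrite (combE hp hq) (@combE _ _ n); last first.
- by apply: leq_trans (size_scale_leq _ _) _.
- by apply: leq_trans (size_scale_leq _ _) _.
rewrite scaler_sumr; apply: eq_bigr => i _.
by rewrite scalerA !coefZ !rmorphM/=; congr (_ *: _); ring.
Qed.

Let combX (s t : rat) k : comb (s *: 'X^k, t *: 'X^k) = (ratr s + imag_unit R * ratr t) *: v k.
Proof.
have h (c : rat) : (size (c *: 'X^k) <= k.+1)%N.
  by apply: leq_trans (size_scale_leq _ _) _; rewrite size_polyXn.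
rewrite (combE (h s) (h t)) (bigD1 ord_max)//= big1 ?addr0.
  by rewrite !coefZ !coefXn !eqxx !mulr1.
move=> i /negPf ik; rewrite !coefZ !coefXn.
have -> : (i == k :> nat) = false by apply: contraFF ik => /eqP e; apply/eqP/val_inj.
by rewrite !mulr0 rmorph0 mulr0 addr0 scale0r.
Qed.

(** The dense set consists of the combinations with coefficients in [Q[i]]. The
    shortest vector from its closure to a given point is orthogonal to the
    sequence, hence zero. *)
Lemma separable_total :
  (forall x, (forall n, inner x (v n) = 0) -> x = 0) -> separable_space V.
Proof.
move=> vtot; exists (range comb).
  apply: (@sub_countable _ _ _ [set: {poly rat} * {poly rat}]).
    exact: card_image_le.
  exact: countableP.
move=> O [x Ox] Oo.
have [||u [p [Du up pmin]]] := @least_norm R V [set x - d | d in range comb].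
- by exists (x - comb (0, 0)); exists (comb (0, 0)) => //; exists (0, 0).
- move=> _ _ [_ [[p q] _ <-] <-] [_ [[p' q'] _ <-] <-].
  exists (comb (2^-1 *: (p + p'), 2^-1 *: (q + q'))); first by exists (2^-1 *: (p + p'), 2^-1 *: (q + q')).
  rewrite -combZ -combD fmorphV/= rmorph_nat addrACA -opprD scalerBr; congr (_ - _).
  by rewrite -mulr2n -[x *+ 2]scaler_nat scalerA mulVf ?scale1r.
have p0 : p = 0.
  apply: vtot => k; apply: least_norm_orth => s t.
  set w := (_ *: v k).
  have cu : (fun n => `|u n + w|) @ \oo --> (`|p + w| : R[i]).
    exact: (cvg_norm (cvgD up (cvg_cst w))).
  apply: (cvgc_ge cu); apply: nearW => n.
  have [_ [[q q'] _ <-] <-] := Du n.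
  apply: pmin; exists (comb (q, q') - w); last by rewrite opprB addrA addrAC.
  rewrite /w -[- _]scaleN1r -(rmorph1 (@ratr R[i])) -rmorphN/= -combX combZ combD.
  by eexists; first by [].
have : (fun n => x - u n) @ \oo --> x.
  by rewrite -[X in _ --> X](subr0 x) -p0; exact: (cvgB (cvg_cst x) up).
move=> /(_ O) []; first exact: open_nbhs_nbhs.
move=> n _ /(_ n (leqnn n)) /= On; exists (x - u n); split => //.
by have [_ [q _ <-] <-] := Du n; rewrite subKr; exists q.
Qed.

End separable.

(** * Square-summable families as Hilbert spaces *)

(** The maps [l2fun n] play the part of coordinates on [l2dom]. The last
    condition, that coordinatewise limits stay in the domain, is what makes the
    space of square summable families complete. *)
Record l2family (R : realType) (E : lmodType R[i]) (V : hilbertType R) := L2Family {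
  l2fun :> nat -> {linear E -> V};
  l2dom : set E;
  l2dom0 : l2dom 0;
  l2domP : forall k x y, l2dom x -> l2dom y -> l2dom (k *: x + y);
  l2sep : forall x, l2dom x -> (forall n, l2fun n x = 0) -> x = 0;
  l2closed : forall (I : Type) (F : set_system I), ProperFilter F ->
    forall (x : I -> E) (l : nat -> V), (forall i, l2dom (x i)) ->
    (forall n, (fun i => l2fun n (x i)) @ F --> l n) ->
    exists2 y, l2dom y & forall n, l2fun n y = l n
}.

Section l2pred.
Variables (R : realType) (E : lmodType R[i]) (V : hilbertType R).
Variable L : l2family E V.

Definition sqfam (x : E) := sqsum (fun n => `|L n x|).

Definition l2pred : {pred E} := fun x => `[< l2dom L x /\ sqfam x >].

Lemma sqfamP (k : R[i]) x y : sqfam x -> sqfam y -> sqfam (k *: x + y).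
Proof.
move=> sx sy; have h := sqsumD (sqsumZ `|k| sx) sy.
apply: (sqsum_le (M := 1) h) => // n; rewrite mul1r !normr_id.
rewrite ler_pXn2r ?nnegrE// linearP.
by rewrite [leRHS]ger0_norm ?addr_ge0 ?mulr_ge0// -normrZ ler_normD.
Qed.

Lemma l2_submod : submod_closed l2pred.
Proof.
split.
  apply/asboolP; split; first exact: l2dom0.
  rewrite /sqfam (_ : (fun n => _) = fun=> 0); first exact: sqsum0.
  by apply/funext => n; rewrite linear0 normr0.
move=> k x y /asboolP[dx sx] /asboolP[dy sy]; apply/asboolP; split.
  exact: l2domP.
exact: sqfamP.
Qed.
HB.instance Definition _ := GRing.isSubmodClosed.Build _ _ l2pred l2_submod.

End l2pred.

Record l2space (R : realType) (E : lmodType R[i]) (V : hilbertType R)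
    (L : l2family E V) := L2space { l2val : E; _ : l2val \in l2pred L }.

Section l2space_theory.
Variables (R : realType) (E : lmodType R[i]) (V : hilbertType R).
Variable L : l2family E V.
Local Notation H := (l2space L).
Implicit Types x y z : H.

HB.instance Definition _ := [isSub for @l2val R E V L].
HB.instance Definition _ := [Choice of H by <:].
HB.instance Definition _ := [SubChoice_isSubLmodule of H by <:].

Lemma l2valP x : l2dom L (l2val x) /\ sqfam L (l2val x).
Proof. by apply/asboolP; exact: (valP x). Qed.

Definition l2inner x y : R[i] := limn (series (fun n => inner (L n (l2val x)) (L n (l2val y)))).

Lemma l2inner_cvg x y :
  series (fun n => inner (L n (l2val x)) (L n (l2val y))) @ \oo --> l2inner x y.
Proof.
have [_ sx] := l2valP x; have [_ sy] := l2valP y.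
suff : cvgn (series (fun n => inner (L n (l2val x)) (L n (l2val y)))) by [].
apply: normed_ccvg; apply: (sqsumD2 (K := 1) sx sy) => // n.
rewrite mul1r !normr_id; apply: le_trans (inner_le _ _) _.
set a := `|_|; set b := `|L n (l2val y)|.
have a0 : 0 <= a := normr_ge0 _; have b0 : 0 <= b := normr_ge0 _.
have [ab|ba] := real_leP (ger0_real a0) (ger0_real b0).
  by rewrite (le_trans (ler_wpM2r _ ab))// -expr2 lerDr exprn_ge0.
by rewrite (le_trans (ler_wpM2l _ (ltW ba)))// -expr2 lerDl exprn_ge0.
Qed.

Lemma l2innerP k x y z : l2inner (k *: x + y) z = k * l2inner x z + l2inner y z.
Proof.
apply: cvg_lim; first exact: norm_hausdorff.
have -> : series (fun n => inner (L n (l2val (k *: x + y))) (L n (l2val z))) =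
  ((fun=> k) \* series (fun n => inner (L n (l2val x)) (L n (l2val z)))) \+
  series (fun n => inner (L n (l2val y)) (L n (l2val z))).
  apply/funext => n; rewrite /series/= mulr_sumr -big_split/=.
  by apply: eq_bigr => i _; rewrite linearP innerP.
exact: (cvgD (cvgM (cvg_cst k) (@l2inner_cvg x z)) (@l2inner_cvg y z)).
Qed.

Lemma l2innerC x y : l2inner y x = (l2inner x y)^*.
Proof.
apply: cvg_lim; first exact: norm_hausdorff.
have -> : series (fun n => inner (L n (l2val y)) (L n (l2val x))) =
    fun m => (series (fun n => inner (L n (l2val x)) (L n (l2val y))) m)^*.
  apply/funext => n; rewrite /series/= rmorph_sum/=.
  by apply: eq_bigr => i _; rewrite -innerC.
exact: cvg_conj (@l2inner_cvg x y).
Qed.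

Lemma l2innerE x : l2inner x x = limn (series (fun n => `|L n (l2val x)| ^+ 2)).
Proof.
by rewrite /l2inner; congr (limn (series _)); apply/funext => n; rewrite inner_normE.
Qed.

Lemma sqfamE (x : E) : sqfam L x = cvgn (series (fun n => `|L n x| ^+ 2)).
Proof.
by rewrite /sqfam/sqsum; congr (cvgn (series _)); apply/funext => n; rewrite normr_id.
Qed.

Lemma l2sum_le_lim x n :
  series (fun n => `|L n (l2val x)| ^+ 2) n <= limn (series (fun n => `|L n (l2val x)| ^+ 2)).
Proof.
apply: cseries_le_lim; first by move=> m; rewrite exprn_ge0.
by rewrite -sqfamE; have [] := l2valP x.
Qed.

Lemma l2inner_gt0 x : x != 0 -> 0 < l2inner x x.
Proof.
move=> x0.
have [n xn0] : exists n, L n (l2val x) != 0.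
  apply: contrapT => nx; move/negP: x0; apply; apply/eqP/val_inj => /=.
  apply: (l2sep (l2valP x).1) => n.
  by apply/eqP; apply: contraT => xn; case: nx; exists n.
rewrite l2innerE; apply: lt_le_trans (l2sum_le_lim x n.+1).
rewrite /series/= big_nat_recr//= ltr_wpDl ?exprn_gt0 ?normr_gt0//.
by rewrite sumr_ge0.
Qed.

HB.instance Definition _ := @Lmodule_isNormed.Build R[i] H
  (fun x => sqrtC (l2inner x x))
  (ip_triangle l2innerP l2innerC l2inner_gt0)
  (ip_normZ l2innerP l2innerC l2inner_gt0)
  (ip_norm_eq0 l2inner_gt0).

Lemma l2normE x : l2inner x x = `|x| ^+ 2.
Proof. by rewrite /Num.norm/= sqrtCK. Qed.

Lemma l2norm_cvg x : series (fun n => `|L n (l2val x)| ^+ 2) @ \oo --> `|x| ^+ 2.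
Proof. by rewrite -l2normE l2innerE -sqfamE; have [] := l2valP x. Qed.

Lemma l2sum_le x n : series (fun n => `|L n (l2val x)| ^+ 2) n <= `|x| ^+ 2.
Proof. by rewrite -l2normE l2innerE; exact: l2sum_le_lim. Qed.

Lemma l2fun_le x n : `|L n (l2val x)| <= `|x|.
Proof.
rewrite -(@ler_pXn2r _ 2)// ?nnegrE//; apply: le_trans (l2sum_le x n.+1).
by rewrite /series/= big_nat_recr//= lerDr sumr_ge0.
Qed.

Lemma l2norm_le x (M : R[i]) : (forall n, series (fun n => `|L n (l2val x)| ^+ 2) n <= M) ->
  `|x| ^+ 2 <= M.
Proof. by move=> h; apply: (cvgc_le (@l2norm_cvg x)); apply: nearW. Qed.

(** A Cauchy filter converges coordinatewise; bounds on the partial sums pass to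
    the limit and turn this into convergence in norm. *)
Lemma l2_complete (F : set_system H) : ProperFilter F -> cauchy F -> cvg F.
Proof.
move=> FF /cauchy_ballP Fc.
have cL n : cvg ((fun x : H => L n (l2val x)) @ F).
  apply/cauchy_cvgP/cauchy_ballP => e e0.
  have [[A B] /= [FA FB] AB] := Fc _ e0.
  exists ((fun x : H => L n (l2val x)) @` A, (fun x : H => L n (l2val x)) @` B) => /=.
    by split; [apply: filterS FA => x Ax; exists x|apply: filterS FB => x Ax; exists x].
  move=> [_ _] /= [[x Ax <-] [y By <-]]; have := AB (x, y) (conj Ax By).
  by rewrite -!ball_normE /=; apply: le_lt_trans; rewrite -linearB; exact: (l2fun_le (x - y) n).
have [a da aE] := @l2closed _ _ _ L H F FF (@l2val _ _ _ L)
  (fun n => lim ((fun x : H => L n (l2val x)) @ F)) (fun x => (l2valP x).1) cL.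
have ac n : (fun x : H => L n (l2val x)) @ F --> L n a by rewrite aE; exact: cL.
have key (e : R[i]) : 0 < e -> \forall x \near F,
    forall N, series (fun n => `|L n (l2val x) - L n a| ^+ 2) N <= e ^+ 2.
  move=> e0; have [[A B] /= [FA FB] AB] := Fc _ e0.
  apply: filterS FA => x Ax N.
  have cN : (fun y : H => series (fun n => `|L n (l2val x) - L n (l2val y)| ^+ 2) N) @ F -->
      series (fun n => `|L n (l2val x) - L n a| ^+ 2) N.
    elim: N => [|N IH].
      rewrite /series/= big_geq//.
      have -> : (fun y : H => \sum_(0 <= n < 0) `|L n (l2val x) - L n (l2val y)| ^+ 2) = fun=> 0.
        by apply/funext => y; rewrite big_geq.
      exact: cvg_cst.
    have -> : (fun y : H => series (fun n => `|L n (l2val x) - L n (l2val y)| ^+ 2) N.+1) =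
       (fun y : H => series (fun n => `|L n (l2val x) - L n (l2val y)| ^+ 2) N) \+
       ((fun y : H => `|L N (l2val x) - L N (l2val y)|) \* (fun y : H => `|L N (l2val x) - L N (l2val y)|)).
      by apply/funext => y; rewrite /series/= big_nat_recr.
    rewrite [X in _ --> X](_ : _ = series (fun n => `|L n (l2val x) - L n a| ^+ 2) N +
       `|L N (l2val x) - L N a| * `|L N (l2val x) - L N a|); last by rewrite /series/= big_nat_recr.
    have cc : (fun y : H => `|L N (l2val x) - L N (l2val y)|) @ F --> (`|L N (l2val x) - L N a| : R[i]).
      exact: (cvg_norm (cvgB (cvg_cst (L N (l2val x))) (ac N))).
    exact: (cvgD IH (cvgM cc cc)).
  apply: (cvgc_le cN); apply: filterS FB => y By.
  have := AB (x, y) (conj Ax By); rewrite -ball_normE /= => xy.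
  apply: (@le_trans _ _ (`|x - y| ^+ 2)).
    apply: le_trans (l2sum_le (x - y) N).
    by rewrite le_eqVlt; apply/orP; left; apply/eqP; apply: eq_bigr => i _; rewrite -linearB.
  by rewrite lerXn2r ?nnegrE// ltW.
have sa : a \in l2pred L.
  apply/asboolP; split => //.
  have [x xa] := filter_ex (key _ (@ltr01 R[i])).
  have h : sqfam L (l2val x - a).
    rewrite sqfamE; apply: (@is_cvg_cseries _ _ (1 ^+ 2)) => n; first by rewrite exprn_ge0.
    apply: le_trans (xa n); rewrite le_eqVlt; apply/orP; left; apply/eqP.
    by apply: eq_bigr => i _; rewrite linearB.
  have -> : a = (-1) *: (l2val x - a) + l2val x by rewrite scaleN1r opprB subrK.
  exact: sqfamP h (l2valP x).2.
apply/cvg_ex; exists (L2space sa).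
apply: (@cvgrPdist_le _ _ _ F _ id _).2 => e e0.
apply: filterS (key _ e0) => x xa.
rewrite distrC -(@ler_pXn2r _ 2)// ?nnegrE// ?(ltW e0)//.
apply: l2norm_le => N; apply: le_trans (xa N).
by rewrite le_eqVlt; apply/orP; left; apply/eqP; apply: eq_bigr => i _; rewrite -linearB.
Qed.

HB.instance Definition _ := Uniform_isComplete.Build H l2_complete.

HB.instance Definition _ :=
  CompleteNormedModule_isHilbert.Build R H l2innerP l2innerC l2normE.

End l2space_theory.

(** * Finite sums *)

Section finite_sums.
Variable R : realType.
Implicit Types (g : nat -> R[i]) (G : R[i]).

Lemma cauchy_schwarz_sum (I : Type) (s : seq I) (u x : I -> R[i]) :
  `|\sum_(p <- s) u p * x p| ^+ 2 <=
  (\sum_(p <- s) `|u p| ^+ 2) * (\sum_(p <- s) `|x p| ^+ 2).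
Proof.
elim: s => [|p s IH]; first by rewrite !big_nil normr0 expr0n mul0r.
rewrite !big_cons; move: IH.
set z := \sum_(j <- s) u j * x j.
set A := \sum_(j <- s) `|u j| ^+ 2; set B := \sum_(j <- s) `|x j| ^+ 2 => zAB.
have A0 : 0 <= A by rewrite sumr_ge0// => i _; rewrite exprn_ge0.
have B0 : 0 <= B by rewrite sumr_ge0// => i _; rewrite exprn_ge0.
set c := `|u p|; set d := `|x p|.
have c0 : 0 <= c := normr_ge0 _; have d0 : 0 <= d := normr_ge0 _.
have z0 : 0 <= `|z| := normr_ge0 _.
apply: (@le_trans _ _ ((c * d + `|z|) ^+ 2)).
  rewrite ler_pXn2r ?nnegrE ?addr_ge0 ?mulr_ge0//.
  by apply: le_trans (ler_normD _ _) _; rewrite normrM.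
have key : 2 * (c * d) * `|z| <= A * d ^+ 2 + B * c ^+ 2.
  rewrite -(@ler_pXn2r _ 2)// ?nnegrE ?addr_ge0 ?mulr_ge0 ?exprn_ge0//.
  apply: (@le_trans _ _ (4 * (c * d) ^+ 2 * (A * B))).
    have -> : (2 * (c * d) * `|z|) ^+ 2 = 4 * (c * d) ^+ 2 * `|z| ^+ 2 by ring.
    by rewrite ler_wpM2l// mulr_ge0// exprn_ge0// mulr_ge0.
  rewrite -subr_ge0.
  have -> : (A * d ^+ 2 + B * c ^+ 2) ^+ 2 - 4 * (c * d) ^+ 2 * (A * B) =
    (A * d ^+ 2 - B * c ^+ 2) ^+ 2 by ring.
  rewrite real_exprn_even_ge0// rpredB// ger0_real// mulr_ge0// exprn_ge0//.
rewrite sqrrD.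
have -> : (c ^+ 2 + A) * (d ^+ 2 + B) =
  (c * d) ^+ 2 + (A * d ^+ 2 + B * c ^+ 2) + A * B by ring.
rewrite lerD// lerD// -mulr_natl mulrA.
exact: key.
Qed.

Lemma sqr_sum_le (n : nat) (x : 'I_n -> R[i]) :
  `|\sum_(i < n) x i| ^+ 2 <= n%:R * \sum_(i < n) `|x i| ^+ 2.
Proof.
have := cauchy_schwarz_sum (index_enum 'I_n) (fun=> 1) x.
under eq_bigr do rewrite mul1r.
move=> h; apply: le_trans h _; rewrite ler_wpM2r//.
  by rewrite sumr_ge0// => i _; rewrite exprn_ge0.
under eq_bigr do rewrite normr1 expr1n.
by rewrite sumr_const card_ord.
Qed.

Lemma sqrD_le (x y : R[i]) : `|x + y| ^+ 2 <= 2 * (`|x| ^+ 2 + `|y| ^+ 2).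
Proof.
have := @sqr_sum_le 2 (fun i => if i == 0 :> nat then x else y).
by rewrite !big_ord_recl !big_ord0/= !addr0.
Qed.

(** Terms of which no two are nonzero together behave like orthogonal ones. *)
Lemma sqr_sum_single (I : finType) (P : pred I) (x : I -> R[i]) :
  (forall i j, P i -> P j -> i != j -> x i = 0 \/ x j = 0) ->
  `|\sum_(i | P i) x i| ^+ 2 = \sum_(i | P i) `|x i| ^+ 2.
Proof.
move=> h.
have [[i0 [Pi0 xi0]]|no] := pselect (exists i, P i /\ x i != 0); last first.
  have x0 i : P i -> x i = 0.
    by move=> Pi; apply/eqP; apply: contraT => xi; case: no; exists i.
  by rewrite !big1 ?normr0 ?expr0n// => i /x0 ->; rewrite normr0 expr0n.
have x0 i : P i && (i != i0) -> x i = 0.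
  move=> /andP[Pi ii0]; have [//|/eqP] := h _ _ Pi Pi0 ii0.
  by rewrite (negPf xi0).
rewrite (bigD1 i0)//= big1 ?addr0// [RHS](bigD1 i0)//= big1 ?addr0//.
by move=> i /x0 ->; rewrite normr0 expr0n.
Qed.

Lemma sum_single_le (I : finType) (P : pred I) (x : I -> R[i]) (M : R[i]) : 0 <= M ->
  (forall i, P i -> x i <= M) ->
  (forall i j, P i -> P j -> i != j -> x i = 0 \/ x j = 0) ->
  \sum_(i | P i) x i <= M.
Proof.
move=> M0 xM h.
have [[i0 [Pi0 xi0]]|no] := pselect (exists i, P i /\ x i != 0); last first.
  by rewrite big1// => i Pi; apply/eqP; apply: contraT => xi; case: no; exists i.
rewrite (bigD1 i0)//= big1 ?addr0 ?xM// => i /andP[Pi ii0].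
by have [//|/eqP] := h _ _ Pi Pi0 ii0; rewrite (negPf xi0).
Qed.

Lemma sum_inj_le (T : finType) (P : pred T) (idx : T -> nat) g G :
  (forall K, \sum_(j < K) `|g j| ^+ 2 <= G) -> {in P &, injective idx} ->
  \sum_(t | P t) `|g (idx t)| ^+ 2 <= G.
Proof.
move=> gG inj; set s := [seq idx t | t <- enum P].
have us : uniq s by rewrite map_inj_in_uniq ?enum_uniq// => x y; rewrite !mem_enum; exact: inj.
have -> : \sum_(t | P t) `|g (idx t)| ^+ 2 = \sum_(j <- s) `|g j| ^+ 2.
  by rewrite big_map big_enum.
pose K := (\max_(j <- s) j).+1.
apply: le_trans (gG K).
rewrite -(big_mkord xpredT (fun j => `|g j| ^+ 2)).
rewrite (@perm_big _ _ _ _ s [seq j <- index_iota 0 K | j \in s]).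
  by rewrite big_filter [leRHS](bigID (mem s))/= lerDl sumr_ge0.
apply: uniq_perm => //; first by rewrite filter_uniq// iota_uniq.
move=> j; rewrite mem_filter mem_index_iota/= /K ltnS.
case js : (j \in s) => //=; apply/esym.
exact: (@leq_bigmax_seq _ s xpredT id j js).
Qed.

Lemma geo_sum_le0 (r : R[i]) (W : R[i]) P : 0 <= r -> 0 < W -> r = 1 - W^-1 ->
  \sum_(p < P) r ^+ p <= W.
Proof.
move=> r0 W0 rW.
have h : (r - 1) * \sum_(p < P) r ^+ p = r ^+ P - 1 by rewrite -subrX1.
have -> : \sum_(p < P) r ^+ p = W * (1 - r ^+ P).
  rewrite -[1 - _]opprB -h rW; set s := \sum_(_ < _) _.
  by field; rewrite gt_eqF.
by rewrite ler_piMr ?gerBl ?exprn_ge0// ltW.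
Qed.

Lemma geo_sum_le (r : R[i]) (W : R[i]) P : 0 <= r -> 0 < W -> r = 1 - W^-1 ->
  \sum_(p < P) r ^+ p.+1 <= W.
Proof.
move=> r0 W0 rW; apply: le_trans (geo_sum_le0 P r0 W0 rW).
have r1 : r <= 1 by rewrite rW gerBl invr_ge0 ltW.
by apply: ler_sum => p _; rewrite exprS ler_piMl// exprn_ge0.
Qed.

(** The weights [r^p] with [1 - r = 1/W] cost only a factor [W], however many
    terms there are. *)
Lemma geo_weight_le (r : R[i]) (W : R[i]) P (x : 'I_P -> R[i]) :
  0 <= r -> 0 < W -> r = 1 - W^-1 ->
  `|\sum_(p < P) r ^+ p.+1 * x p| ^+ 2 <= W * \sum_(p < P) `|x p| ^+ 2.
Proof.
move=> r0 W0 rW.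
apply: le_trans (cauchy_schwarz_sum _ (fun p : 'I_P => r ^+ p.+1) x) _.
rewrite ler_wpM2r//; first by rewrite sumr_ge0// => i _; rewrite exprn_ge0.
apply: le_trans (geo_sum_le P r0 W0 rW); apply: ler_sum => p _.
have r1 : r <= 1 by rewrite rW gerBl invr_ge0 ltW.
rewrite ger0_norm ?exprn_ge0// expr2 ler_piMl ?exprn_ge0//.
by rewrite exprn_ile1.
Qed.

End finite_sums.

(** * Lacunary blocks *)

Section block_parameters.
Implicit Types b i n p k : nat.

(** In block [b], the zeros have modulus governed by [r = 1 - 1 / blockR b], sums
    over [p] are cut off at [blockP b], so that [r ^ blockP b] is negligible even
    after multiplication by [blockR b], and the half periods [blockM b i] grow
    with [i] by the factor [8 * blockP b]. *)
Definition blockR b := (8 ^ b.+1)%N.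
Definition blockP b := (blockR b ^ 3)%N.
Definition blockM b i := (2 ^ ((9 * b + 12) * i.+1))%N.
Definition blockidx b i p k := (2 * p.+1 * blockM b i + b - k)%N.

Lemma blockM_gt0 b i : (0 < blockM b i)%N. Proof. by rewrite expn_gt0. Qed.

Lemma ltn_blockM b i : (b < blockM b i)%N.
Proof. by apply: (leq_trans (ltn_expl b (ltnSn 1))); rewrite leq_exp2l//; nia. Qed.

Lemma blockPE b : (8 * blockP b = 2 ^ (9 * b + 12))%N.
Proof. by rewrite /blockP /blockR (_ : 8 = 2 ^ 3)%N// -!expnM -expnD; congr (_ ^ _)%N; lia. Qed.

Lemma blockM_lacunary b i j : (i < j)%N -> (8 * blockP b * blockM b i <= blockM b j)%N.
Proof. by move=> ij; rewrite blockPE -expnD leq_exp2l//; nia. Qed.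

Lemma blockM_double b i j : (i < j)%N -> exists q, blockM b j = (2 * q * blockM b i)%N.
Proof.
move=> ij; exists (2 ^ ((9 * b + 12) * (j - i) - 1))%N.
by rewrite -expnS -expnD; congr (_ ^ _)%N; nia.
Qed.

Lemma blockidx_inj b i p k p' k' : (k < blockM b i)%N -> (k' < blockM b i)%N ->
  blockidx b i p k = blockidx b i p' k' -> p = p' /\ k = k'.
Proof.
rewrite /blockidx; move: (blockM b i) => M kM kM' e.
have {}e : (2 * p.+1 * M + k' = 2 * p'.+1 * M + k)%N by nia.
have pp : p = p'.
  have [pp|pp|//] := ltngtP p p'.
    have : (2 * p'.+1 * M >= 2 * p.+1 * M + 2 * M)%N by nia.
    lia.
  have : (2 * p.+1 * M >= 2 * p'.+1 * M + 2 * M)%N by nia.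
  lia.
by split => //; move: e; rewrite pp; lia.
Qed.

(** Up to the offset [b], the indices read in a window of length [n] lie within
    distance [n] of odd multiples of [blockM b i], while the multiples of a later
    [blockM b i'] are even multiples of it. *)
Lemma blockidx_window_inj b n i p k i' p' k' :
  (k < blockM b i <= k + n)%N -> (2 * n <= blockM b i)%N ->
  (k' < blockM b i' <= k' + n)%N -> (2 * n <= blockM b i')%N ->
  blockidx b i p k = blockidx b i' p' k' -> [/\ i = i', p = p' & k = k'].
Proof.
wlog ii : i p k i' p' k' / (i <= i')%N.
  move=> h h1 h2 h3 h4 e; have [ii|/ltnW ii] := leqP i i'; first exact: h.
  by have [] := h _ _ _ _ _ _ ii h3 h4 h1 h2 (esym e); split.
move=> /andP[kM Mk] nM /andP[kM' Mk'] nM' e.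
move: ii; rewrite leq_eqVlt => /predU1P[ii|ii].
  rewrite -ii in kM' Mk' e *.
  by have [-> ->] := blockidx_inj kM kM' e.
exfalso; have [q qE] := blockM_double b ii.
move: e kM' Mk' nM'; rewrite /blockidx qE.
have M0 := blockM_gt0 b i.
move: (blockM b i) kM Mk nM M0 => M kM Mk nM M0 e kM' Mk' nM'.
set B := (p'.+1 * q)%N.
have e2 : (2 * p.+1 * M + k' = 4 * B * M + k)%N by rewrite /B; nia.
pose c := (M - k)%N; pose c' := (2 * q * M - k')%N.
have e3 : ((2 * p + 1) * M + c = 2 * (2 * B - q) * M + c')%N.
  have : (q <= B)%N by rewrite /B leq_pmull.
  rewrite /c /c'; nia.
have cn : (0 < c <= n)%N by rewrite /c; lia.
have cn' : (0 < c' <= n)%N by rewrite /c'; lia.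
move: e3; set Q := (2 * B - q)%N => e3.
have [pQ|pQ] := ltnP p Q.
  have : (2 * Q * M >= (2 * p + 1) * M + M)%N by nia.
  lia.
have : ((2 * p + 1) * M >= 2 * Q * M + M)%N by nia.
lia.
Qed.

End block_parameters.

Section window.
Variables (R : realType) (b : nat).

Definition blockW : R[i] := (blockR b)%:R.
Definition blockr : R[i] := 1 - blockW^-1.

Lemma blockW_ge1 : 1 <= blockW.
Proof. by rewrite /blockW ler1n expn_gt0. Qed.

Lemma blockW_gt0 : 0 < blockW.
Proof. exact: lt_le_trans blockW_ge1. Qed.

Lemma blockr_ge0 : 0 <= blockr.
Proof. by rewrite subr_ge0 invf_le1 ?blockW_ge1 ?blockW_gt0. Qed.

Definition blockC i (a : nat -> R[i]) k : R[i] :=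
  if (k < blockM b i)%N
  then \sum_(p < blockP b) blockr ^+ p.+1 * a (blockidx b i p k) else 0.

Variables (g : nat -> R[i]) (G : R[i]).
Hypothesis gG : forall K, \sum_(j < K) `|g j| ^+ 2 <= G.

Let G0 : 0 <= G. Proof. by apply: le_trans (gG 0); rewrite big_ord0. Qed.

Lemma blockC_le i k : `|blockC i g k| ^+ 2 <=
  blockW * \sum_(p < blockP b) (if (k < blockM b i)%N then `|g (blockidx b i p k)| ^+ 2 else 0).
Proof.
rewrite /blockC; case: ifP => _.
  exact: (geo_weight_le _ blockr_ge0 blockW_gt0 (erefl _)).
by rewrite normr0 expr0n/= mulr_ge0// ?(ltW blockW_gt0)// sumr_ge0.
Qed.

Lemma blockC_bound i K : \sum_(k < K) `|blockC i g k| ^+ 2 <= blockW * G.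
Proof.
apply: (@le_trans _ _ (\sum_(k < K) (blockW * \sum_(p < blockP b)
    (if (k < blockM b i)%N then `|g (blockidx b i p k)| ^+ 2 else 0)))).
  by apply: ler_sum => k _; exact: blockC_le.
rewrite -mulr_sumr ler_wpM2l ?(ltW blockW_gt0)//.
rewrite pair_big/= -big_mkcond/=.
apply: (@sum_inj_le _ _ _ (fun t : 'I_K * 'I_(blockP b) => blockidx b i t.2 t.1) _ _ gG).
move=> [k p] [k' p']; rewrite !unfold_in/= => kM kM' e.
by have [/val_inj -> /val_inj ->] := blockidx_inj kM kM' e.
Qed.

Variable n : nat.
Hypothesis g0 : forall m, (m < n)%N -> g m = 0.

Let win i k := (k < blockM b i <= k + n)%N.

(* The part of [blockC i g] lost when the cutoff and a shift by [n] are
   exchanged. *)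
Let D i k := if win i k then blockC i g k else 0.

Let D_neq0 i k : D i k != 0 ->
  win i k /\ (n <= 2 * blockP b * blockM b i + b)%N.
Proof.
rewrite /D; case: ifP => [w|_]; last by rewrite eqxx.
move=> Dk; split => //; rewrite leqNgt; apply: contra Dk => nP.
rewrite /blockC; case: ifP => // _; rewrite big1// => p _.
rewrite g0 ?mulr0// /blockidx; have := ltn_ord p; nia.
Qed.

(* If [D i] is nonzero then [n] is at most about [2 * blockP b * blockM b i], far
   below the next half period. *)
Let bad_single i j : i != j -> (blockM b i < 2 * n)%N -> (blockM b j < 2 * n)%N ->
  (forall k, D i k = 0) \/ (forall k, D j k = 0).
Proof.
wlog ij : i j / (i < j)%N.
  move=> h ne; have [ij|ij] := ltnP i j; first exact: h.
  move=> bi bj; have : (j < i)%N by rewrite ltn_neqAle eq_sym ne.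
  by move=> ji; have [] := h _ _ ji _ bj bi; rewrite 1?eq_sym//; [right|left].
move=> _ bi bj; left => k; apply/eqP; apply: contraT => /D_neq0[/andP[kM _] nP].
have := blockM_lacunary b ij; have := ltn_blockM b i.
have : (0 < blockP b)%N by rewrite !expn_gt0.
move: bj nP; move: (blockM b i) (blockM b j) (blockP b) => M M' P; nia.
Qed.

Let disjointD k i j : i != j -> D i k = 0 \/ D j k = 0.
Proof.
wlog ij : i j / (i < j)%N.
  move=> h ne; have [ij|ij] := ltnP i j; first exact: h.
  have : (j < i)%N by rewrite ltn_neqAle eq_sym ne.
  by move=> ji; have [] := h _ _ ji; rewrite 1?eq_sym//; [right|left].
move=> _; have [->|/D_neq0[/andP[ki _] nP]] := eqVneq (D i k) 0; first by left.
right; rewrite /D /win; case: ifP => // /andP[_ Mk]; exfalso.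
have := blockM_lacunary b ij; have := ltn_blockM b i.
have : (0 < blockP b)%N by rewrite !expn_gt0.
move: Mk ki nP; move: (blockM b i) (blockM b j) (blockP b) => M M' P; nia.
Qed.

Let D_le i k : `|D i k| ^+ 2 <=
  blockW * \sum_(p < blockP b) (if win i k then `|g (blockidx b i p k)| ^+ 2 else 0).
Proof.
rewrite /D; case: ifP => [/andP[kM _]|_].
  by apply: le_trans (blockC_le i k) _; rewrite kM.
by rewrite normr0 expr0n/= mulr_ge0// ?(ltW blockW_gt0)// sumr_ge0.
Qed.

(** The bound does not depend on the number [I] of indices: for each [k] at most
    one index contributes, and, apart from at most one index with
    [blockM b i < 2 * n], different indices read different coefficients. *)
Lemma window_bound I K :
  \sum_(k < K) `|\sum_(i < I) D i k| ^+ 2 <= 2 * blockW * G.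
Proof.
have W0 := blockW_gt0.
have -> : \sum_(k < K) `|\sum_(i < I) D i k| ^+ 2 =
    \sum_(i < I) \sum_(k < K) `|D i k| ^+ 2.
  rewrite exchange_big; apply: eq_bigr => k _.
  by apply: sqr_sum_single => i j _ _ ij; exact: disjointD.
rewrite (bigID (fun i : 'I_I => (2 * n <= blockM b i)%N))/=.
have -> : 2 * blockW * G = blockW * G + blockW * G by ring.
apply: lerD.
  apply: (@le_trans _ _ (blockW * \sum_(i < I | (2 * n <= blockM b i)%N)
      \sum_(k < K) \sum_(p < blockP b)
        (if win i k then `|g (blockidx b i p k)| ^+ 2 else 0))).
    rewrite mulr_sumr; apply: ler_sum => i _; rewrite mulr_sumr.
    by apply: ler_sum => k _; exact: D_le.
  rewrite ler_wpM2l ?(ltW W0)//.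
  under eq_bigr do rewrite pair_big/=.
  rewrite pair_big/= -big_mkcondr/=.
  apply: (@sum_inj_le _ _ _ (fun t : 'I_I * ('I_K * 'I_(blockP b)) =>
    blockidx b t.1 t.2.2 t.2.1) _ _ gG).
  move=> [i [k p]] [i' [k' p']]; rewrite !unfold_in/= !andbT => /andP[nM w] /andP[nM' w'] e.
  by have [/val_inj -> /val_inj -> /val_inj ->] := blockidx_window_inj w nM w' nM' e.
apply: sum_single_le; first by rewrite mulr_ge0// ltW.
  move=> i _; apply: le_trans (blockC_bound i K); apply: ler_sum => k _.
  by rewrite /D; case: ifP => // _; rewrite normr0 expr0n/= exprn_ge0.
move=> i j; rewrite -!ltnNge => bi bj ij.
have [h|h] := bad_single ij bi bj; [left|right]; rewrite big1// => k _.
  by rewrite h normr0 expr0n.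
by rewrite h normr0 expr0n.
Qed.

End window.

(** * The block averages *)

Section block_average.
Variable R : realType.
Implicit Types (a g : nat -> R[i]) (G : R[i]) (b i n k m : nat).

Definition shseq n a m : R[i] := if (m < n)%N then 0 else a (m - n)%N.

Definition blockPhi b a k : R[i] := (4 ^ b)%:R^-1 * \sum_(i < 4 ^ b) blockC b i a k.

Lemma shseq_bound n a G : (forall K, \sum_(j < K) `|a j| ^+ 2 <= G) ->
  forall K, \sum_(j < K) `|shseq n a j| ^+ 2 <= G.
Proof.
move=> aG K; pose P := fun j : 'I_K => (n <= j)%N.
have -> : \sum_(j < K) `|shseq n a j| ^+ 2 = \sum_(j < K | P j) `|a (j - n)%N| ^+ 2.
  rewrite [RHS]big_mkcond; apply: eq_bigr => j _; rewrite /P /shseq.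
  by case: ltnP => // _; rewrite normr0 expr0n.
apply: (@sum_inj_le _ _ _ (fun j : 'I_K => (j - n)%N) _ _ aG).
move=> j j'; rewrite !unfold_in /P => nj nj' e; apply: val_inj => /=; lia.
Qed.

Lemma W4E b : blockW R b / (4 ^ b)%:R ^+ 2 = 8 * (2^-1) ^+ b.
Proof.
have e : (8 ^ b.+1 * 2 ^ b = 8 * (4 ^ b) ^ 2)%N.
  rewrite expnS -mulnA; congr (8 * _)%N.
  by rewrite -expnMn -expnM [(b * 2)%N]mulnC expnM.
have {}e : blockW R b * 2 ^+ b = 8 * (4 ^ b)%:R ^+ 2.
  by rewrite /blockW /blockR -!natrX -!natrM -e.
have b2 : 2 ^+ b != 0 :> R[i] by rewrite expf_neq0.
have b4 : (4 ^ b)%:R != 0 :> R[i] by rewrite pnatr_eq0 expn_eq0.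
rewrite exprVn; apply: (mulIf b2); rewrite mulfVK// mulrAC e mulfK// expf_neq0.
Qed.

Lemma blockPhi_sqr b a k :
  `|blockPhi b a k| ^+ 2 = `|\sum_(i < 4 ^ b) blockC b i a k| ^+ 2 / (4 ^ b)%:R ^+ 2.
Proof.
by rewrite /blockPhi normrM exprMn mulrC normfV normr_nat exprVn.
Qed.

Lemma blockPhi_bound b a G : (forall K, \sum_(j < K) `|a j| ^+ 2 <= G) ->
  forall K, \sum_(k < K) `|blockPhi b a k| ^+ 2 <= blockW R b * G.
Proof.
move=> aG K.
have n0 : 0 < (4 ^ b)%:R :> R[i] by rewrite ltr0n expn_gt0.
under eq_bigr do rewrite blockPhi_sqr.
rewrite -mulr_suml ler_pdivrMr ?exprn_gt0//.
apply: (@le_trans _ _ (\sum_(k < K) ((4 ^ b)%:R * \sum_(i < 4 ^ b) `|blockC b i a k| ^+ 2))).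
  by apply: ler_sum => k _; exact: sqr_sum_le.
rewrite -mulr_sumr exchange_big/=.
apply: (@le_trans _ _ ((4 ^ b)%:R * \sum_(i < 4 ^ b) (blockW R b * G))).
  by rewrite ler_wpM2l ?(ltW n0)//; apply: ler_sum => i _; exact: blockC_bound.
rewrite sumr_const card_ord -mulr_natl le_eqVlt; apply/orP; left; apply/eqP.
by ring.
Qed.

Lemma blockC_shift b i n a k :
  blockC b i (shseq n a) k = blockC b i a (k + n) +
  (if (k < blockM b i <= k + n)%N then blockC b i (shseq n a) k else 0).
Proof.
have [Mk|kM] /= := leqP (blockM b i) (k + n).
  rewrite andbT [in X in _ = X + _]/blockC ltnNge Mk/= add0r.
  by case: ifP => // /negbT; rewrite -leqNgt => Mk'; rewrite /blockC ltnNge Mk'.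
rewrite andbF addr0 /blockC kM (leq_trans _ kM) ?ltnS ?leq_addr//.
apply: eq_bigr => p _; congr (_ * _).
rewrite /shseq /blockidx; case: ifP => h.
  by exfalso; move: h kM; move: (blockM b i) => M; nia.
by congr (a _); move: h kM; move: (blockM b i) => M; nia.
Qed.

(** The error is small uniformly in [n], because the average divides by [4 ^ b]
    what [window_bound] estimates by the square root of [blockW], about [8 ^ b]. *)
Lemma blockPhi_shift b n a G : (forall K, \sum_(j < K) `|a j| ^+ 2 <= G) ->
  forall K, \sum_(k < K) `|blockPhi b (shseq n a) k| ^+ 2 <=
    2 * \sum_(k < K) `|blockPhi b a (k + n)| ^+ 2 + 32 * (2^-1) ^+ b * G.
Proof.
move=> aG K.
have n0 : 0 < (4 ^ b)%:R :> R[i] by rewrite ltr0n expn_gt0.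
pose D i k : R[i] :=
  if (k < blockM b i <= k + n)%N then blockC b i (shseq n a) k else 0.
have PhiE k : blockPhi b (shseq n a) k = blockPhi b a (k + n) +
    (4 ^ b)%:R^-1 * \sum_(i < 4 ^ b) D i k.
  rewrite /blockPhi -mulrDr -big_split/=; congr (_ * _).
  by apply: eq_bigr => i _; rewrite {1}blockC_shift.
have DG : \sum_(k < K) `|\sum_(i < 4 ^ b) D i k| ^+ 2 <= 2 * blockW R b * G.
  apply: window_bound; first exact: shseq_bound.
  by move=> m mn; rewrite /shseq mn.
apply: (@le_trans _ _ (\sum_(k < K) 2 * (`|blockPhi b a (k + n)| ^+ 2 +
    `|\sum_(i < 4 ^ b) D i k| ^+ 2 / (4 ^ b)%:R ^+ 2))).
  apply: ler_sum => k _; rewrite PhiE; apply: le_trans (sqrD_le _ _) _.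
  rewrite ler_pM2l// lerD2l normrM exprMn mulrC.
  by rewrite normfV normr_nat exprVn.
rewrite -mulr_sumr big_split/= mulrDr lerD2l -mulr_suml.
have -> : 32 * (2^-1) ^+ b * G = 2 * (2 * blockW R b * G / (4 ^ b)%:R ^+ 2).
  rewrite (_ : 2 * _ = 4 * (blockW R b / (4 ^ b)%:R ^+ 2) * G); last by ring.
  by rewrite W4E; ring.
rewrite ler_pM2l// ler_wpM2r// invr_ge0 exprn_ge0// ltW//.
Qed.

(** The indices with [blockM b i >= L] contribute nothing, those with [blockM b i]
    much smaller than [L] have small support, and at most one other is left. *)
Lemma blockPhi_poly b L g G : (forall K, \sum_(j < K) `|g j| ^+ 2 <= G) ->
  (forall m, (L <= m)%N -> g m = 0) -> (forall m, `|g m| <= 1) ->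
  forall K, \sum_(k < K) `|blockPhi b g k| ^+ 2 <=
    16 * (2^-1) ^+ b * G + L%:R * (2^-1) ^+ b.
Proof.
move=> gG gL g1 K.
have n0 : 0 < (4 ^ b)%:R :> R[i] by rewrite ltr0n expn_gt0.
have W0 := blockW_gt0 R b; have r0 := blockr_ge0 R b.
have G0 : 0 <= G by apply: le_trans (gG 0); rewrite big_ord0.
have CL i k : (L <= blockM b i)%N -> blockC b i g k = 0.
  move=> LM; rewrite /blockC; case: ifP => // kM; rewrite big1// => p _.
  rewrite gL ?mulr0// /blockidx; move: kM LM; move: (blockM b i) => M; nia.
pose big (i : 'I_(4 ^ b)) := (L <= 8 * blockP b * blockM b i)%N.
have bigB k : \sum_(i < 4 ^ b) blockC b i g k =
    \sum_(i < 4 ^ b | big i) blockC b i g k + \sum_(i < 4 ^ b | ~~ big i) blockC b i g k.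
  by rewrite (bigID big).
have single2 (i j : 'I_(4 ^ b)) k : big i -> big j -> i != j -> blockC b i g k = 0 \/ blockC b j g k = 0.
  move=> bi bj ij; have [lij|lji] := ltnP i j.
    right; apply: CL; have := blockM_lacunary b lij; rewrite /big in bi; lia.
  have {}lji : (j < i)%N by rewrite ltn_neqAle eq_sym ij.
  left; apply: CL; have := blockM_lacunary b lji; rewrite /big in bj; lia.
have bigle : \sum_(k < K) `|\sum_(i < 4 ^ b | big i) blockC b i g k| ^+ 2 <= blockW R b * G.
  have -> : \sum_(k < K) `|\sum_(i < 4 ^ b | big i) blockC b i g k| ^+ 2 =
      \sum_(k < K) \sum_(i < 4 ^ b | big i) `|blockC b i g k| ^+ 2.
    by apply: eq_bigr => k _; apply: sqr_sum_single => i j; exact: single2.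
  rewrite exchange_big/=; apply: sum_single_le.
  - by rewrite mulr_ge0// ltW.
  - by move=> i _; exact: blockC_bound.
  move=> i j bi bj ij; have [lij|lji] := ltnP i j.
    right; rewrite big1// => k _; rewrite CL ?normr0 ?expr0n//.
    by have := blockM_lacunary b lij; rewrite /big in bi; lia.
  have {}lji : (j < i)%N by rewrite ltn_neqAle eq_sym ij.
  left; rewrite big1// => k _; rewrite CL ?normr0 ?expr0n//.
  by have := blockM_lacunary b lji; rewrite /big in bj; lia.
have CW i k : `|blockC b i g k| <= blockW R b.
  rewrite /blockC; case: ifP => _; last by rewrite normr0 ltW.
  apply: le_trans (ler_norm_sum _ _ _) _.
  apply: le_trans (geo_sum_le (blockP b) r0 W0 (erefl _)); apply: ler_sum => p _.
  by rewrite normrM (ger0_norm (exprn_ge0 _ r0)) ler_piMr// exprn_ge0.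
have smallC (i : 'I_(4 ^ b)) : ~~ big i ->
    \sum_(k < K) `|blockC b i g k| ^+ 2 <= L%:R / (8 * blockW R b).
  rewrite /big -ltnNge => si.
  apply: (@le_trans _ _ (\sum_(k < K | (k < blockM b i)%N) blockW R b ^+ 2)).
    rewrite [leRHS]big_mkcond; apply: ler_sum => k _; case: ifP => kM.
      by rewrite ler_pXn2r ?nnegrE ?CW// ltW.
    by rewrite /blockC kM normr0 expr0n.
  rewrite sumr_const -[leLHS]mulr_natl.
  have cardM : (#|[pred k : 'I_K | (k < blockM b i)%N]| <= blockM b i)%N.
    rewrite cardE -(size_map val) -[leqRHS](size_iota 0).
    apply: uniq_leq_size; first by rewrite (map_inj_uniq val_inj) enum_uniq.
    by move=> _ /mapP[k + ->]; rewrite mem_enum mem_iota.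
  apply: (@le_trans _ _ ((blockM b i)%:R * blockW R b ^+ 2)).
    by rewrite ler_wpM2r ?exprn_ge0 ?(ltW W0)// ler_nat.
  rewrite ler_pdivlMr ?mulr_gt0//.
  rewrite (_ : _ * _ = (8 * blockP b * blockM b i)%:R); last first.
    by rewrite !natrM /blockP natrX -/(blockW R b); ring.
  by rewrite ler_nat ltnW.
have smallle : \sum_(k < K) `|\sum_(i < 4 ^ b | ~~ big i) blockC b i g k| ^+ 2 <=
    (4 ^ b)%:R ^+ 2 * (L%:R / (8 * blockW R b)).
  apply: (@le_trans _ _ (\sum_(k < K) ((4 ^ b)%:R *
      \sum_(i < 4 ^ b) (if big i then 0 else `|blockC b i g k| ^+ 2)))).
    apply: ler_sum => k _; rewrite big_mkcond/=.
    apply: le_trans (sqr_sum_le _) _; rewrite ler_wpM2l ?(ltW n0)//.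
    by apply: ler_sum => i _; case: (big i) => //=; rewrite normr0 expr0n.
  rewrite -mulr_sumr expr2 -mulrA ler_wpM2l ?(ltW n0)// exchange_big/=.
  rewrite [leRHS](_ : _ = \sum_(i < 4 ^ b) (L%:R / (8 * blockW R b))); last first.
    by rewrite sumr_const card_ord mulr_natl.
  apply: ler_sum => i _; case bi : (big i); last by move/negbT/smallC : bi.
  by rewrite big1// divr_ge0// mulr_ge0// ltW.
under eq_bigr do rewrite blockPhi_sqr bigB.
rewrite -mulr_suml ler_pdivrMr ?exprn_gt0//.
apply: (@le_trans _ _ (2 * (blockW R b * G + (4 ^ b)%:R ^+ 2 * (L%:R / (8 * blockW R b))))).
  apply: (@le_trans _ _ (\sum_(k < K) 2 *
      (`|\sum_(i < 4 ^ b | big i) blockC b i g k| ^+ 2 +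
       `|\sum_(i < 4 ^ b | ~~ big i) blockC b i g k| ^+ 2))).
    by apply: ler_sum => k _; exact: sqrD_le.
  by rewrite -mulr_sumr ler_pM2l// big_split/= lerD.
have -> : blockW R b = 8 * (2^-1) ^+ b * (4 ^ b)%:R ^+ 2.
  by rewrite -W4E mulfVK// expf_neq0// gt_eqF.
set x := (2^-1) ^+ b; set y := (4 ^ b)%:R.
have x0 : 0 < x by rewrite exprn_gt0// invr_gt0.
have y0 : 0 < y by [].
rewrite [leLHS]mulrDr [leRHS]mulrDl lerD//; first by rewrite le_eqVlt; apply/orP; left; apply/eqP; ring.
have xy : 1 <= 8 * x * y ^+ 2 * (4 * x).
  rewrite (_ : _ * _ = 32 * ((x * y) ^+ 2)); last by ring.
  have -> : x * y = 2 ^+ b.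
    by rewrite /x /y exprVn (_ : 4 = 2 ^ 2)%N// -expnM mulnC expnM natrX natrX expr2 mulKf// expf_neq0.
  rewrite -exprM -natrX -natrM ler1n muln_gt0 expn_gt0//.
rewrite (_ : 2 * _ = y ^+ 2 * L%:R * (4^-1 / (8 * x * y ^+ 2))); last by field; rewrite !gt_eqF.
rewrite [leRHS](_ : _ = y ^+ 2 * L%:R * x); last by ring.
rewrite ler_wpM2l ?mulr_ge0 ?exprn_ge0 ?(ltW y0)//.
rewrite ler_pdivrMr ?mulr_gt0 ?exprn_gt0// -[leLHS]mulr1 ler_pdivrMl//.
by rewrite (le_trans xy)// le_eqVlt; apply/orP; left; apply/eqP; ring.
Qed.

End block_average.

(** * A normalized Blaschke product with equally spaced zeros *)

Section blaschke.
Variable R : realType.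
Implicit Types (a f g x : nat -> R[i]) (n k N : nat) (c r : R[i]).

(** Multiplication by [1 - c z^N]. *)
Definition onesub c N x k := x k - c * shseq N x k.

Lemma shseq_shseq n N x : shseq n (shseq N x) = shseq (n + N) x.
Proof.
apply/funext => k; rewrite /shseq; have [kn|nk] := ltnP k n.
  by rewrite (leq_trans kn (leq_addr _ _)).
by rewrite ltn_subLR// subnDA.
Qed.

Lemma shseqP c n x y k : shseq n (fun m => c * x m + y m) k = c * shseq n x k + shseq n y k.
Proof. by rewrite /shseq; case: ifP => // _; rewrite mulr0 addr0. Qed.

Lemma shseq_onesub c n N x : shseq n (onesub c N x) = onesub c N (shseq n x).
Proof.
apply/funext => k; rewrite /onesub.
have -> : shseq N (shseq n x) k = shseq n (shseq N x) k by rewrite !shseq_shseq addnC.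
by move: (shseq N x) => y; rewrite /shseq; case: ifP => // _; rewrite mulr0 subr0.
Qed.

Lemma onesubC c N c' N' x : onesub c N (onesub c' N' x) = onesub c' N' (onesub c N x).
Proof.
apply/funext => k; rewrite {1 3}/onesub !shseq_onesub /onesub.
have -> : shseq N (shseq N' x) k = shseq N' (shseq N x) k by rewrite !shseq_shseq addnC.
by ring.
Qed.

Lemma onesub_inj c N x y : (0 < N)%N -> onesub c N x = onesub c N y -> x = y.
Proof.
move=> N0 xy; apply/funext => k; elim/ltn_ind: k => k IH.
have := congr1 (fun z => z k) xy; rewrite /onesub /shseq.
case: ltnP => kN; first by rewrite !mulr0 !subr0.
by rewrite (IH (k - N)%N) ?ltn_subrL ?N0 ?(leq_trans N0)//; exact: addIr.
Qed.

Lemma shseq_sum_le n x K : \sum_(j < K) `|shseq n x j| ^+ 2 <= \sum_(j < K) `|x j| ^+ 2.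
Proof.
apply: (@le_trans _ _ (\sum_(j < n + K) `|shseq n x j| ^+ 2)).
  rewrite addnC big_split_ord/= lerDl.
  by rewrite sumr_ge0// => i _; rewrite exprn_ge0.
rewrite big_split_ord/= big1 ?add0r; last first.
  by move=> i _; rewrite /shseq ltn_ord normr0 expr0n.
apply: ler_sum => i _.
by rewrite /shseq ltnNge leq_addr/= addKn.
Qed.

(** Division by [1 - r z^N]. *)
Definition geodiv r N f k := \sum_(p < k.+1) r ^+ p * shseq (p * N) f k.

Lemma geodiv_widen r N f k m : (0 < N)%N -> (k < m)%N ->
  geodiv r N f k = \sum_(p < m) r ^+ p * shseq (p * N) f k.
Proof.
move=> N0 km; rewrite /geodiv.
rewrite (big_ord_widen m (fun p => r ^+ p * shseq (p * N) f k) km) big_mkcond/=.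
apply: eq_bigr => p _; case: ltnP => // kp.
rewrite /shseq (_ : (k < p * N)%N) ?mulr0//.
by rewrite (leq_trans kp)// leq_pmulr.
Qed.

Lemma geodivE r N f k : (0 < N)%N -> geodiv r N f k = f k + r * shseq N (geodiv r N f) k.
Proof.
move=> N0; rewrite {1}/geodiv big_ord_recl/= expr0 mul1r mul0n.
congr (_ + _); first by rewrite /shseq/= subn0.
have -> : shseq N (geodiv r N f) k = \sum_(p < k) r ^+ p * shseq (p.+1 * N) f k.
  rewrite {1}/shseq; case: ltnP => kN.
    by rewrite big1// => p _; rewrite /shseq mulSn (leq_trans kN (leq_addr _ _)) mulr0.
  rewrite (@geodiv_widen _ _ _ _ k)//; last by rewrite ltn_subrL N0 (leq_trans N0).
  apply: eq_bigr => p _; congr (_ * _).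
  rewrite mulSn -shseq_shseq {2}/shseq ltnNge kN/=.
  by [].
rewrite mulr_sumr; apply: eq_bigr => p _.
by rewrite /bump/= add1n exprS mulrA.
Qed.

Lemma onesub_geodiv r N f : (0 < N)%N -> onesub r N (geodiv r N f) = f.
Proof. by move=> N0; apply/funext => k; rewrite /onesub {1}geodivE// addrK. Qed.

Lemma geodivP r N c f g k :
  geodiv r N (fun m => c * f m + g m) k = c * geodiv r N f k + geodiv r N g k.
Proof.
rewrite /geodiv mulr_sumr -big_split/=; apply: eq_bigr => p _.
by rewrite shseqP; ring.
Qed.

Lemma geodiv_local r N f g k : (forall j, (j <= k)%N -> f j = g j) ->
  geodiv r N f k = geodiv r N g k.
Proof.
move=> fg; apply: eq_bigr => p _; congr (_ * _); rewrite /shseq.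
by case: ifP => // _; rewrite fg// leq_subr.
Qed.

Lemma geodiv_le r N f (B W : R[i]) k : 0 <= r -> 0 < W -> r = 1 - W^-1 -> 0 <= B ->
  (forall j, `|f j| <= B) -> `|geodiv r N f k| <= W * B.
Proof.
move=> r0 W0 rW B0 fB; apply: le_trans (ler_norm_sum _ _ _) _.
apply: (@le_trans _ _ (\sum_(p < k.+1) r ^+ p * B)).
  apply: ler_sum => p _; rewrite normrM (ger0_norm (exprn_ge0 _ r0)).
  rewrite ler_wpM2l ?exprn_ge0// /shseq; case: ifP => // _.
  by rewrite normr0.
by rewrite -mulr_suml ler_wpM2r// geo_sum_le0.
Qed.

(** Multiplication by [(1 - z^N / r) / (1 - r z^N)], which is a Blaschke product
    with [N] zeros divided by its value [r] at the origin. *)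
Definition blaschke r N f := onesub r^-1 N (geodiv r N f).

Lemma onesub_blaschke r N f : (0 < N)%N ->
  onesub r N (blaschke r N f) = onesub r^-1 N f.
Proof. by move=> N0; rewrite /blaschke onesubC onesub_geodiv. Qed.

Lemma blaschkeC r N r' N' f : (0 < N)%N -> (0 < N')%N ->
  blaschke r N (blaschke r' N' f) = blaschke r' N' (blaschke r N f).
Proof.
move=> N0 N0'; apply: (onesub_inj (c := r) N0); apply: (onesub_inj (c := r') N0').
rewrite onesub_blaschke// (onesubC r' N' r^-1) onesub_blaschke//.
by rewrite (onesubC r') onesub_blaschke// (onesubC r N) onesub_blaschke// onesubC.
Qed.

Lemma blaschke_shseq r N n f : (0 < N)%N ->
  blaschke r N (shseq n f) = shseq n (blaschke r N f).
Proof.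
move=> N0; apply: (onesub_inj (c := r) N0).
by rewrite onesub_blaschke// -!shseq_onesub onesub_blaschke.
Qed.

Lemma blaschkeP r N c f g k :
  blaschke r N (fun m => c * f m + g m) k = c * blaschke r N f k + blaschke r N g k.
Proof.
rewrite /blaschke /onesub geodivP.
have -> : geodiv r N (fun m => c * f m + g m) =
    fun m => c * geodiv r N f m + geodiv r N g m.
  by apply/funext => m; exact: geodivP.
by rewrite shseqP; ring.
Qed.

Lemma blaschke_local r N f g k : (forall j, (j <= k)%N -> f j = g j) ->
  blaschke r N f k = blaschke r N g k.
Proof.
move=> fg; rewrite /blaschke /onesub (geodiv_local r N fg); congr (_ - _ * _).
rewrite /shseq; case: ifP => // _; apply: geodiv_local => j jk.
by apply: fg; exact: leq_trans jk (leq_subr _ _).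
Qed.

Lemma blaschke_low r N f k : (0 < N)%N -> (k < N)%N -> blaschke r N f k = f k.
Proof.
by move=> N0 kN; rewrite /blaschke /onesub geodivE// /shseq kN !mulr0 subr0 addr0.
Qed.

Lemma blaschke_lead r N f k : (0 < N)%N -> (forall j, (j < k)%N -> f j = 0) ->
  blaschke r N f k = f k.
Proof.
move=> N0 f0; rewrite /blaschke /onesub geodivE//.
have -> : shseq N (geodiv r N f) k = 0.
  rewrite /shseq; case: ltnP => // kN; rewrite /geodiv big1// => p _.
  rewrite /shseq; case: ifP => // _; rewrite ?f0 ?mulr0//.
  by rewrite (leq_ltn_trans (leq_subr _ _))// ltn_subrL N0 (leq_trans N0).
by rewrite !mulr0 addr0 subr0.
Qed.

(** The identity [|r u - v|^2 = |u - r v|^2 - (1 - r^2) (|u|^2 - |v|^2)] is summed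
    with [v] the shift of [u], which has smaller partial sums of squares. *)
Lemma blaschke_le r N f K : (0 < N)%N -> 0 < r -> r <= 1 ->
  \sum_(k < K) `|blaschke r N f k| ^+ 2 <= r ^- 2 * \sum_(k < K) `|f k| ^+ 2.
Proof.
move=> N0 r0 r1; set h := geodiv r N f.
have rr : r^* = r by rewrite geC0_conj// ltW.
have key k : r ^+ 2 * `|blaschke r N f k| ^+ 2 =
    `|f k| ^+ 2 - (1 - r ^+ 2) * (`|h k| ^+ 2 - `|shseq N h k| ^+ 2).
  have -> : f k = h k - r * shseq N h k by rewrite /h {1}geodivE// addrK.
  rewrite -[r ^+ 2 as X in X * _ = _]mulr1.
  rewrite /blaschke /onesub -/h; set u := h k; set v := shseq N h k.
  rewrite mulr1 !normCK !rmorphB !rmorphM/= fmorphV/= rr.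
  by field; rewrite gt_eqF.
rewrite -(ler_pM2l (_ : 0 < r ^+ 2)) ?exprn_gt0// mulrA mulfV ?mul1r; last first.
  by rewrite expf_neq0// gt_eqF.
rewrite mulr_sumr; under eq_bigr do rewrite key.
rewrite big_split/= gerDl sumrN oppr_le0 -mulr_sumr mulr_ge0//.
  by rewrite subr_ge0 exprn_ile1// ltW.
by rewrite big_split/= sumrN subr_ge0 shseq_sum_le.
Qed.

(** A multiple of the Blaschke product vanishes at the roots of [z^N = r], which
    amounts to [sum_(p >= 0) r^p g^(m + p N) = 0] for [m < N]. The partial sums
    telescope. *)
Lemma blaschke_relation r N f m P : (0 < N)%N -> r != 0 -> (m < N)%N ->
  \sum_(p < P.+1) r ^+ p * blaschke r N f (m + p * N) =
  r ^+ P * geodiv r N f (m + P * N).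
Proof.
move=> N0 r0 mN; elim: P => [|P IH].
  rewrite big_ord_recl big_ord0 /= !expr0 !mul1r addr0 !mul0n !addn0.
  by rewrite blaschke_low// geodivE// /shseq mN mulr0 addr0.
rewrite big_ord_recr/= IH /blaschke /onesub.
rewrite {1}/shseq ltnNge mulSn addnCA leq_addr/= addKn.
by rewrite exprS; field.
Qed.

End blaschke.

(** * The infinite product *)

Section blaschke_product.
Variable R : realType.
Implicit Types (f g : nat -> R[i]) (n k b i : nat) (q : nat * nat) (s t : seq (nat * nat)).

Definition blockN q := (2 * blockM q.1 q.2)%N.

Definition bprod s f := foldr (fun q => blaschke (blockr R q.1) (blockN q)) f s.

Fixpoint blockseq n : seq (nat * nat) :=
  if n is m.+1 then [seq (m, i) | i <- iota 0 (4 ^ m)] ++ blockseq m else [::].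

Lemma blockN_gt0 q : (0 < blockN q)%N.
Proof. by rewrite muln_gt0 blockM_gt0. Qed.

Lemma blockr_le1 b : blockr R b <= 1.
Proof. by rewrite gerBl invr_ge0 ltW// blockW_gt0. Qed.

Lemma blockW_gt1 b : 1 < blockW R b.
Proof. by rewrite /blockW ltr1n /blockR; apply: (@leq_trans 8%N) => //; rewrite expnS leq_pmulr ?expn_gt0. Qed.

Lemma blockr_gt0 b : 0 < blockr R b.
Proof. by rewrite subr_gt0 invf_lt1 ?blockW_gt0// blockW_gt1. Qed.

Lemma bprodP s c f g k :
  bprod s (fun m => c * f m + g m) k = c * bprod s f k + bprod s g k.
Proof.
elim: s k => //= q s IH k.
have -> : bprod s (fun m => c * f m + g m) = fun m => c * bprod s f m + bprod s g m.
  by apply/funext.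
exact: blaschkeP.
Qed.

Lemma bprod_shseq s n f : bprod s (shseq n f) = shseq n (bprod s f).
Proof. by elim: s => //= q s ->; rewrite blaschke_shseq// blockN_gt0. Qed.

Lemma bprod_local s f g k : (forall j, (j <= k)%N -> f j = g j) ->
  forall j, (j <= k)%N -> bprod s f j = bprod s g j.
Proof.
move=> fg; elim: s => //= q s IH j jk; apply: blaschke_local => j' j'j.
by apply: IH; exact: leq_trans jk.
Qed.

Lemma bprod_lead s f k : (forall j, (j < k)%N -> f j = 0) ->
  forall j, (j <= k)%N -> bprod s f j = f j.
Proof.
move=> f0; elim: s => //= q s IH j jk.
rewrite blaschke_lead ?IH ?blockN_gt0// => j' j'j.
by rewrite IH ?f0// ?(leq_trans j'j)// ltnW// (leq_trans j'j).
Qed.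

Lemma bprod_low s t f k : (forall q, q \in s -> (k < blockN q)%N) ->
  bprod (s ++ t) f k = bprod t f k.
Proof.
elim: s => //= q s IH qs; rewrite blaschke_low ?IH ?blockN_gt0 ?qs ?mem_head//.
by move=> q' q's; rewrite qs// inE q's orbT.
Qed.

Lemma bprod_extract s t q f :
  bprod (s ++ q :: t) f = blaschke (blockr R q.1) (blockN q) (bprod (s ++ t) f).
Proof. by elim: s => //= q' s ->; rewrite blaschkeC// blockN_gt0. Qed.

Lemma bprod_le s f K : \sum_(k < K) `|bprod s f k| ^+ 2 <=
  (\prod_(q <- s) blockr R q.1) ^- 2 * \sum_(k < K) `|f k| ^+ 2.
Proof.
elim: s => [|q s IH] /=; first by rewrite big_nil expr1n invr1 mul1r.
rewrite big_cons exprMn invfM -mulrA.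
apply: le_trans (blaschke_le _ _ (blockN_gt0 q) (blockr_gt0 _) (blockr_le1 _)) _.
by rewrite ler_wpM2l// invr_ge0 exprn_ge0// blockr_ge0.
Qed.

Lemma prod_ge_sum (I : Type) (s : seq I) (x : I -> R[i]) :
  (forall l, 0 <= x l <= 1) -> 1 - \sum_(i <- s) x i <= \prod_(i <- s) (1 - x i) <= 1.
Proof.
move=> x01; elim: s => [|l s /andP[IH1 IH2]]; first by rewrite !big_nil subr0 lexx.
rewrite !big_cons; have /andP[x0 x1]  := x01 l.
have p0 : 0 <= \prod_(j <- s) (1 - x j).
  by apply: prodr_ge0 => j _; rewrite subr_ge0; have /andP[] := x01 j.
apply/andP; split; last first.
  by rewrite mulr_ile1// ?subr_ge0// gerBl.
rewrite mulrBl mul1r opprD addrA addrAC lerB//.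
by rewrite ler_piMr.
Qed.

Lemma sum_pow2_le n : \sum_(b < n) (2^-1) ^+ b <= 2 :> R[i].
Proof.
have h : (2^-1 : R[i]) = 1 - 2^-1 by field.
by apply: (geo_sum_le0 n _ _ h); rewrite ?invr_ge0.
Qed.

Lemma prod_blockseq n : 3 / 4 <= \prod_(q <- blockseq n) blockr R q.1 <= 1.
Proof.
have x01 q : 0 <= (blockW R q.1)^-1 <= 1.
  by rewrite invr_ge0 ltW ?blockW_gt0//= invf_le1 ?blockW_gt0// blockW_ge1.
have /andP[h ->] := prod_ge_sum (blockseq n) x01; rewrite andbT.
apply: le_trans h.
have -> : \sum_(q <- blockseq n) (blockW R q.1)^-1 = 8^-1 * \sum_(b < n) (2^-1) ^+ b.
  elim: n => [|n IH]; first by rewrite big_nil big_ord0 mulr0.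
  rewrite big_cat/= IH big_ord_recr/= mulrDr addrC; congr (_ + _).
  rewrite big_map/= big_const_seq count_predT size_iota iter_addr addr0.
  have W0 := blockW_gt0 R n.
  have n0 : 0 < (4 ^ n)%:R :> R[i] by rewrite ltr0n expn_gt0.
  rewrite -[LHS]mulr_natl.
  have -> : blockW R n = 8 * 2 ^+ n * (4 ^ n)%:R.
    rewrite /blockW /blockR -natrX -!natrM; congr (_%:R).
    by rewrite expnS -mulnA -expnMn.
  rewrite exprVn; field.
  by rewrite expf_neq0 ?gt_eqF// (lt_le_trans _ (exprn_ge0 _ _)).
have := sum_pow2_le n; set x := \sum_(_ < _) _ => x2.
have -> : 3 / 4 = 1 - 8^-1 * 2 :> R[i] by field.
by rewrite lerB// ler_wpM2l// invr_ge0.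
Qed.

(** Multiplication by the product over all blocks. The factors of the blocks from
    the [k]-th on are [1] up to order [k], so no limit is needed: this is where
    normalizing the factors by their value at [0] pays off. *)
Definition bprodoo f k := bprod (blockseq k) f k.

Lemma mem_blockseq n b i : (b, i) \in blockseq n = (b < n)%N && (i < 4 ^ b)%N.
Proof.
elim: n => //= n IH; rewrite mem_cat IH ltnS.
have [->|bn] := eqVneq b n.
  rewrite ltnn leqnn/= orbF; apply/mapP/idP => [[j + [->]]|ib].
    by rewrite mem_iota.
  by exists i => //; rewrite mem_iota.
rewrite [(b <= n)%N]leq_eqVlt (negPf bn)/=.
case: mapP => // -[j _ [e _]]; by rewrite e eqxx in bn.
Qed.

Lemma bprodooE n f k : (k <= n)%N -> bprod (blockseq n) f k = bprodoo f k.
Proof.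
elim: n => [|n IH]; first by rewrite leqn0 => /eqP ->.
rewrite leq_eqVlt => /predU1P[->//|]; rewrite ltnS => kn.
rewrite /= bprod_low ?IH// => _ /mapP[i _ ->].
rewrite /blockN/= (leq_ltn_trans kn)// (ltn_trans (ltn_blockM n i))//.
by rewrite -[X in (X < _)%N]mul1n ltn_pmul2r// blockM_gt0.
Qed.

Lemma bprodooP c f g k :
  bprodoo (fun m => c * f m + g m) k = c * bprodoo f k + bprodoo g k.
Proof. exact: bprodP. Qed.

Lemma bprodoo_local f g k : (forall j, (j <= k)%N -> f j = g j) ->
  bprodoo f k = bprodoo g k.
Proof. by move=> fg; exact: (bprod_local _ fg). Qed.

Lemma bprodoo_lead f k : (forall j, (j < k)%N -> f j = 0) -> bprodoo f k = f k.
Proof. by move=> f0; exact: (bprod_lead _ f0). Qed.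

Lemma bprodooZ c f k : bprodoo (fun m => c * f m) k = c * bprodoo f k.
Proof.
have -> : (fun m => c * f m) = (fun m => c * f m + (fun=> 0) m).
  by apply/funext => m; rewrite addr0.
by rewrite bprodooP [bprodoo (fun=> 0) k]bprodoo_lead// addr0.
Qed.

Lemma bprodoo_shseq n f : bprodoo (shseq n f) = shseq n (bprodoo f).
Proof.
apply/funext => k; rewrite /bprodoo bprod_shseq /shseq; case: ifP => // _.
by rewrite bprodooE// leq_subr.
Qed.

Lemma prod_blockseq_inv n : (\prod_(q <- blockseq n) blockr R q.1) ^- 2 <= 4.
Proof.
have /andP[h _] := prod_blockseq n; set x := \prod_(_ <- _) _ in h *.
have x0 : 0 < x by apply: lt_le_trans h; rewrite divr_gt0.
rewrite -[4]invrK lef_pV2 ?posrE ?exprn_gt0 ?invr_gt0//.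
apply: (@le_trans _ _ ((3 / 4) ^+ 2)).
  rewrite -subr_ge0 (_ : _ - _ = 5 / 16); last by field.
  by rewrite divr_ge0.
by rewrite ler_pXn2r ?nnegrE ?divr_ge0// ltW.
Qed.

Lemma bprodoo_le f K :
  \sum_(k < K) `|bprodoo f k| ^+ 2 <= 4 * \sum_(k < K) `|f k| ^+ 2.
Proof.
have -> : \sum_(k < K) `|bprodoo f k| ^+ 2 = \sum_(k < K) `|bprod (blockseq K) f k| ^+ 2.
  by apply: eq_bigr => k _; rewrite bprodooE// ltnW.
apply: le_trans (bprod_le _ _ _) _; rewrite ler_wpM2r ?prod_blockseq_inv//.
by rewrite sumr_ge0// => i _; rewrite exprn_ge0.
Qed.

Lemma blockr_pow b : blockr R b ^+ blockP b <= blockW R b ^- 2.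
Proof.
have W0 := blockW_gt0 R b; have r0 := blockr_ge0 R b.
have h : (blockP b)%:R * blockr R b ^+ blockP b <= blockW R b.
  apply: le_trans (geo_sum_le0 (blockP b) r0 W0 (erefl _)).
  rewrite mulr_natl -[X in _ *+ X]card_ord -sumr_const; apply: ler_sum => p _.
  by rewrite ler_wiXn2l// ?blockr_le1// ltnW.
have P0 : 0 < (blockP b)%:R :> R[i] by rewrite ltr0n !expn_gt0.
rewrite -(ler_pM2l P0) (le_trans h)// /blockP natrX -/(blockW R b).
by rewrite le_eqVlt; apply/orP; left; apply/eqP; field; rewrite gt_eqF.
Qed.

Variables (f : nat -> R[i]) (B : R[i]).
Hypothesis B0 : 0 <= B.
Hypothesis fB : forall K, \sum_(k < K) `|f k| ^+ 2 <= B ^+ 2.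

(** The factor [(b, i)] can be moved in front, so [blaschke_relation] applies. *)
Lemma blockC_bprodoo b i m : (i < 4 ^ b)%N -> (m <= b)%N ->
  `|bprodoo f m + blockC b i (bprodoo f) (b - m)| <= 2 * B / blockW R b.
Proof.
move=> ib mb; set N := blockN (b, i); set r := blockr R b.
have W0 := blockW_gt0 R b; have r0 := blockr_gt0 b.
have bM : (b < blockM b i)%N by exact: ltn_blockM.
have mN : (m < N)%N by rewrite /N /blockN/=; lia.
set n := (m + blockP b * N + b.+1)%N.
have qn : (b, i) \in blockseq n by rewrite mem_blockseq ib andbT /n; lia.
have [s [t stE]] : exists s t, blockseq n = s ++ (b, i) :: t.
  by case/splitPr: qn => s t; exists s, t.
set g := bprod (s ++ t) f.
have UE k : (k <= n)%N -> bprodoo f k = blaschke r N g k.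
  by move=> kn; rewrite -(@bprodooE n)// stE bprod_extract.
have gB j : `|g j| <= 2 * B.
  rewrite -(@ler_pXn2r _ 2)// ?nnegrE ?mulr_ge0//.
  apply: (@le_trans _ _ (\sum_(k < j.+1) `|g k| ^+ 2)).
    by rewrite big_ord_recr/= lerDr sumr_ge0// => k _; rewrite exprn_ge0.
  apply: le_trans (bprod_le _ _ _) _; rewrite exprMn.
  have p0 (u : seq (nat * nat)) : 0 < \prod_(q <- u) blockr R q.1.
    by apply: prodr_gt0 => q _; exact: blockr_gt0.
  rewrite ler_pM ?invr_ge0 ?exprn_ge0 ?(ltW (p0 _)) ?sumr_ge0//.
  have -> : 2 ^+ 2 = 4 :> R[i] by rewrite -natrX.
  apply: le_trans (prod_blockseq_inv n).
  rewrite lef_pV2 ?posrE ?exprn_gt0// ler_pXn2r ?nnegrE ?(ltW (p0 _))// stE.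
  rewrite !big_cat/= big_cons ler_pM2l// ler_piMl ?(ltW (p0 _))//.
  exact: blockr_le1.
have -> : bprodoo f m + blockC b i (bprodoo f) (b - m) =
    \sum_(p < (blockP b).+1) r ^+ p * blaschke r N g (m + p * N).
  rewrite big_ord_recl/= expr0 mul1r mul0n addn0 -UE ?/n; last by lia.
  congr (_ + _); rewrite /blockC (leq_ltn_trans (leq_subr _ _) bM).
  apply: eq_bigr => p _; rewrite /bump/= add1n; congr (_ * _).
  have -> : blockidx b i p (b - m) = (m + p.+1 * N)%N.
    rewrite /blockidx /N /blockN/=; move: (blockM b i) => M; nia.
  rewrite UE// /n; have := ltn_ord p; nia.
rewrite blaschke_relation ?blockN_gt0 ?gt_eqF// normrM.
have h1 : `|geodiv r N g (m + blockP b * N)| <= blockW R b * (2 * B).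
  by apply: (geodiv_le _ _ (ltW r0) W0 (erefl _)) => //; rewrite mulr_ge0.
apply: (@le_trans _ _ (blockW R b ^- 2 * (blockW R b * (2 * B)))).
  rewrite ler_pM// ger0_norm ?exprn_ge0 ?(ltW r0)//; exact: blockr_pow.
by rewrite le_eqVlt; apply/orP; left; apply/eqP; field; rewrite gt_eqF.
Qed.

Lemma blockPhi_bprodoo b m : (m <= b)%N ->
  `|bprodoo f m| <= `|blockPhi b (bprodoo f) (b - m)| + 2 * B / blockW R b.
Proof.
move=> mb.
have n0 : 0 < (4 ^ b)%:R :> R[i] by rewrite ltr0n expn_gt0.
have E : bprodoo f m + blockPhi b (bprodoo f) (b - m) = (4 ^ b)%:R^-1 *
    \sum_(i < 4 ^ b) (bprodoo f m + blockC b i (bprodoo f) (b - m)).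
  rewrite big_split/= mulrDr; congr (_ + _).
  by rewrite sumr_const card_ord -[X in _ * X]mulr_natl mulKf// gt_eqF.
have h : `|bprodoo f m + blockPhi b (bprodoo f) (b - m)| <= 2 * B / blockW R b.
  rewrite E normrM normfV normr_nat ler_pdivrMl//.
  apply: le_trans (ler_norm_sum _ _ _) _.
  apply: (@le_trans _ _ (\sum_(i < 4 ^ b) (2 * B / blockW R b))).
    by apply: ler_sum => i _; exact: blockC_bprodoo.
  by rewrite sumr_const card_ord -[leLHS]mulr_natl.
rewrite -[leLHS](_ : `|(bprodoo f m + blockPhi b (bprodoo f) (b - m)) -
  blockPhi b (bprodoo f) (b - m)| = _); last by rewrite addrK.
by apply: le_trans (ler_normB _ _) _; rewrite addrC lerD2l.
Qed.

End blaschke_product.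

Arguments blockseq : simpl never.
Arguments bprod : simpl never.
Arguments bprodoo : simpl never.

(** * Operators on the Hardy space and the graph space *)

Section hardy_tools.
Variable R : realType.
Implicit Types (f g : hardy R) (M : R[i]).

Lemma hardy_ext f g : (forall n, coef f n = coef g n) -> f = g.
Proof.
move=> fg; apply/eqP; rewrite -subr_eq0; apply/eqP; apply: coef_eq0 => n.
by rewrite Defs.coefB fg subrr.
Qed.

Lemma hcoef0 n : coef (0 : hardy R) n = 0.
Proof. by rewrite -[X in coef X](subrr 0) Defs.coefB subrr. Qed.

Lemma coef_sum_le_ord f K : \sum_(k < K) `|coef f k| ^+ 2 <= `|f| ^+ 2.
Proof.
have := coef_sum_le f K; rewrite /series/= big_mkord; exact.
Qed.

Lemma hardy_norm_le f M : (forall K, \sum_(k < K) `|coef f k| ^+ 2 <= M) -> `|f| ^+ 2 <= M.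
Proof.
move=> h; rewrite -hardy_normE hardy_innerE.
by apply: (cvgc_le (coef_sqsum f)); apply: nearW => K; rewrite /series/= big_mkord.
Qed.

Lemma sqsum_bound (a : nat -> R[i]) M : (forall K, \sum_(k < K) `|a k| ^+ 2 <= M) -> sqsum a.
Proof.
move=> h; apply: (@is_cvg_cseries _ _ M) => n; first by rewrite exprn_ge0.
by rewrite /series/= big_mkord.
Qed.

Lemma hcoef_sum (I : Type) (s : seq I) (F : I -> hardy R) k :
  coef (\sum_(i <- s) F i) k = \sum_(i <- s) coef (F i) k.
Proof.
by elim: s => [|i s IH]; rewrite ?big_nil ?hcoef0// !big_cons Defs.coefD IH.
Qed.

Lemma hardy_shift_linear : linear (@hardy_shift R).
Proof.
move=> k f g; apply: hardy_ext => n; rewrite Defs.coefD Defs.coefZ !coef_shift.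
by case: n => [|n]; rewrite ?mulr0 ?addr0// Defs.coefD Defs.coefZ.
Qed.
HB.instance Definition _ := GRing.isLinear.Build R[i] (hardy R) (hardy R) *:%R
  (@hardy_shift R) hardy_shift_linear.

Lemma coef_iter_shift n f : coef (iter n (@hardy_shift R) f) = shseq n (coef f).
Proof.
elim: n => [|n IH]; apply/funext => k /=; first by rewrite /shseq/= subn0.
rewrite coef_shift IH /shseq; case: k => [|k]; first by [].
by rewrite ltnS subSS.
Qed.

End hardy_tools.

(** The bound is stated on partial sums of squares, which avoids any convergence
    question until the operator is carried to [hardy R] by [hop]. *)
Record seqop (R : realType) := SeqOp {
  seqfun :> (nat -> R[i]) -> nat -> R[i];
  seqbd : R[i];
  seqbd_ge0 : 0 <= seqbd;
  seqfunP : forall (c : R[i]) (a b : nat -> R[i]) k,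
    seqfun (fun m => c * a m + b m) k = c * seqfun a k + seqfun b k;
  seqfun_le : forall (a : nat -> R[i]) (G : R[i]), (forall K, \sum_(k < K) `|a k| ^+ 2 <= G) ->
    forall K, \sum_(k < K) `|seqfun a k| ^+ 2 <= seqbd * G
}.

Section hardy_operators.
Variables (R : realType) (A : seqop R).
Implicit Types f g : hardy R.

Let hop_le f K : \sum_(k < K) `|A (coef f) k| ^+ 2 <= seqbd A * `|f| ^+ 2.
Proof. by apply: seqfun_le; exact: coef_sum_le_ord. Qed.

Definition hop f : hardy R := hardy_of (sqsum_bound (hop_le f)).

Lemma coef_hop f : coef (hop f) = A (coef f).
Proof. exact: coef_of. Qed.

Lemma hop_linear : linear hop.
Proof.
move=> c f g; apply: hardy_ext => k; rewrite Defs.coefD Defs.coefZ !coef_hop -seqfunP.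
by congr (A _ k); apply/funext => m; rewrite Defs.coefD Defs.coefZ.
Qed.
HB.instance Definition _ := GRing.isLinear.Build R[i] (hardy R) (hardy R) *:%R
  hop hop_linear.

Lemma hop_sqr f : `|hop f| ^+ 2 <= seqbd A * `|f| ^+ 2.
Proof. by apply: hardy_norm_le => K; rewrite coef_hop; exact: hop_le. Qed.

Lemma hop_norm f : `|hop f| <= (1 + seqbd A) * `|f|.
Proof.
have A0 := seqbd_ge0 A.
rewrite -(@ler_pXn2r _ 2)// ?nnegrE ?mulr_ge0 ?addr_ge0//.
apply: le_trans (hop_sqr f) _; rewrite exprMn ler_wpM2r ?exprn_ge0//.
have -> : (1 + seqbd A) ^+ 2 = seqbd A + (1 + seqbd A + seqbd A ^+ 2) by ring.
by rewrite lerDl !addr_ge0// exprn_ge0.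
Qed.

Lemma hop_continuous : continuous (hop : hardy R -> hardy R).
Proof. exact: (@bounded_continuous _ _ _ (hop : {linear hardy R -> hardy R}) _ hop_norm). Qed.

End hardy_operators.

Section block_operators.
Variable R : realType.

Lemma blockPhiP (n : nat) c (a b : nat -> R[i]) k :
  blockPhi n (fun m => c * a m + b m) k = c * blockPhi n a k + blockPhi n b k.
Proof.
rewrite /blockPhi.
have -> : \sum_(i < 4 ^ n) blockC n i (fun m => c * a m + b m) k =
    c * \sum_(i < 4 ^ n) blockC n i a k + \sum_(i < 4 ^ n) blockC n i b k.
  rewrite mulr_sumr -big_split/=; apply: eq_bigr => i _; rewrite /blockC.
  case: ifP => _; last by rewrite mulr0 addr0.
  by rewrite mulr_sumr -big_split/=; apply: eq_bigr => p _; ring.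
by ring.
Qed.

Definition PhiOp b : seqop R :=
  SeqOp (ltW (blockW_gt0 R b)) (blockPhiP b) (@blockPhi_bound R b).

(** The factor [1/4] makes this an operator of norm at most [1/2], and the shift
    makes its powers vanish at [0] to increasing orders. *)
Definition blaschkeSeq (a : nat -> R[i]) k := 4^-1 * shseq 1 (bprodoo a) k.

Lemma shseq10 (a : nat -> R[i]) : shseq 1 a 0 = 0. Proof. by []. Qed.

Lemma shseq1S (a : nat -> R[i]) k : shseq 1 a k.+1 = a k.
Proof. by rewrite /shseq ltnS ltn0 subSS subn0. Qed.

Lemma blaschkeSeq0 (a : nat -> R[i]) : blaschkeSeq a 0 = 0.
Proof. by rewrite /blaschkeSeq shseq10 mulr0. Qed.

Lemma blaschkeSeqS (a : nat -> R[i]) k : blaschkeSeq a k.+1 = 4^-1 * bprodoo a k.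
Proof. by rewrite /blaschkeSeq shseq1S. Qed.

Lemma blaschkeSeqP c (a b : nat -> R[i]) k :
  blaschkeSeq (fun m => c * a m + b m) k = c * blaschkeSeq a k + blaschkeSeq b k.
Proof.
rewrite /blaschkeSeq.
have -> : bprodoo (fun m => c * a m + b m) = fun m => c * bprodoo a m + bprodoo b m.
  by apply/funext => m; exact: bprodooP.
by rewrite shseqP; ring.
Qed.

Lemma blaschkeSeq_le (a : nat -> R[i]) G :
  (forall K, \sum_(k < K) `|a k| ^+ 2 <= G) ->
  forall K, \sum_(k < K) `|blaschkeSeq a k| ^+ 2 <= 4^-1 * G.
Proof.
move=> aG K.
under eq_bigr do rewrite normrM exprMn.
rewrite -mulr_sumr normfV normr_nat.
apply: (@le_trans _ _ (4^-1 ^+ 2 * (4 * \sum_(k < K) `|a k| ^+ 2))).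
  rewrite ler_wpM2l ?exprn_ge0 ?invr_ge0//.
  exact: le_trans (shseq_sum_le _ _ _) (bprodoo_le _ _).
rewrite mulrA (_ : 4^-1 ^+ 2 * 4 = 4^-1); last by field.
by rewrite ler_wpM2l ?invr_ge0.
Qed.

Lemma quarter_ge0 : 0 <= 4^-1 :> R[i]. Proof. by rewrite invr_ge0. Qed.

Definition VOp : seqop R := SeqOp quarter_ge0 blaschkeSeqP blaschkeSeq_le.

End block_operators.

Arguments shseq : simpl never.
Arguments blaschkeSeq : simpl never.

Section graph_space.
Variable R : realType.
Local Notation S := (@hardy_shift R).
Local Notation Phi b := (hop (PhiOp R b)).

Definition graphfun n : {linear hardy R -> hardy R} :=
  if n is b.+1 then (Phi b : {linear hardy R -> hardy R}) else idfun.

Lemma graph_sep (f : hardy R) : [set: hardy R] f -> (forall n, graphfun n f = 0) -> f = 0.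
Proof. by move=> _ /(_ 0%N). Qed.

Lemma graph_closed (I : Type) (F : set_system I) : ProperFilter F ->
  forall (x : I -> hardy R) (l : nat -> hardy R), (forall i, [set: hardy R] (x i)) ->
  (forall n, (fun i => graphfun n (x i)) @ F --> l n) ->
  exists2 y, [set: hardy R] y & forall n, graphfun n y = l n.
Proof.
move=> FF x l _ xl; exists (l 0%N) => // -[|b] //.
apply: (@cvg_unique _ (@norm_hausdorff _ (hardy R)) _ _ _ _ _ (xl b.+1)).
apply: (@cvg_comp _ _ _ x (Phi b) F (nbhs (l 0%N)) (nbhs (Phi b (l 0%N)))).
  exact: (xl 0%N).
exact: hop_continuous.
Qed.

Definition graph_family : l2family (hardy R) (hardy R) :=
  @L2Family _ _ _ graphfun [set: hardy R] I (fun _ _ _ _ _ => I) graph_sep graph_closed.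

(** As [graphfun 0] is the identity, the norm is the graph norm of the sequence
    of the operators [Phi b]. *)
Definition graphsp := l2space graph_family.

Implicit Types x y : graphsp.

Lemma graph_series (f : hardy R) n : series (fun n => `|graphfun n f| ^+ 2) n.+1 =
  `|f| ^+ 2 + \sum_(b < n) `|Phi b f| ^+ 2.
Proof. by rewrite /series/= big_mkord big_ord_recl/=. Qed.

Lemma graph_sum_le x n :
  `|l2val x| ^+ 2 + \sum_(b < n) `|Phi b (l2val x)| ^+ 2 <= `|x| ^+ 2.
Proof. by rewrite -graph_series; exact: l2sum_le. Qed.

Lemma graph_norm_le x M : (forall n,
  `|l2val x| ^+ 2 + \sum_(b < n) `|Phi b (l2val x)| ^+ 2 <= M) -> `|x| ^+ 2 <= M.
Proof.
move=> h; apply: l2norm_le => -[|n]; last by rewrite graph_series.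
by rewrite /series/= big_geq//; apply: le_trans (h 0%N); rewrite big_ord0 addr0 exprn_ge0.
Qed.

Lemma mem_graph (f : hardy R) M : (forall n, \sum_(b < n) `|Phi b f| ^+ 2 <= M) ->
  f \in l2pred graph_family.
Proof.
move=> h; apply/asboolP; split => //; rewrite sqfamE.
apply: (@is_cvg_cseries _ _ (`|f| ^+ 2 + M)) => -[|n]; rewrite ?exprn_ge0//.
  rewrite /series/= big_geq// addr_ge0 ?exprn_ge0//.
  by apply: le_trans (h 0%N); rewrite big_ord0.
by rewrite graph_series lerD2l.
Qed.

Lemma graph_val_le x : `|l2val x| <= `|x|.
Proof.
rewrite -(@ler_pXn2r _ 2)// ?nnegrE//.
by have := graph_sum_le x 0; rewrite big_ord0 addr0.
Qed.

Lemma Phi_shift b n (f : hardy R) :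
  `|Phi b (iter n S f)| ^+ 2 <= 2 * `|Phi b f| ^+ 2 + 32 * (2^-1) ^+ b * `|f| ^+ 2.
Proof.
apply: hardy_norm_le => K; rewrite coef_hop coef_iter_shift.
apply: le_trans (blockPhi_shift b n (coef_sum_le_ord f) K) _.
rewrite lerD2r ler_wpM2l//.
have -> : \sum_(k < K) `|blockPhi b (coef f) (k + n)| ^+ 2 =
   \sum_(k < K) `|coef (Phi b f) (n + k)| ^+ 2.
  by apply: eq_bigr => k _; rewrite coef_hop addnC.
apply: le_trans (coef_sum_le_ord (Phi b f) (n + K)).
by rewrite big_split_ord/= lerDr sumr_ge0// => i _; rewrite exprn_ge0.
Qed.

Lemma iter_shift_norm n (f : hardy R) : `|iter n S f| ^+ 2 <= `|f| ^+ 2.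
Proof.
apply: hardy_norm_le => K; rewrite coef_iter_shift.
exact: shseq_bound (coef_sum_le_ord f) _.
Qed.

Lemma Phi_shift_sum x n B :
  `|iter n S (l2val x)| ^+ 2 + \sum_(b < B) `|Phi b (iter n S (l2val x))| ^+ 2 <=
  65 * `|x| ^+ 2.
Proof.
pose f := l2val x; pose s := \sum_(b < B) `|Phi b f| ^+ 2.
have h : `|f| ^+ 2 + s <= `|x| ^+ 2 := graph_sum_le x B.
have s0 : 0 <= s by rewrite sumr_ge0// => i _; rewrite exprn_ge0.
have f0 : 0 <= `|f| ^+ 2 by rewrite exprn_ge0.
pose t : R[i] := \sum_(b < B) (2^-1) ^+ b.
have t2 : t <= 2 := sum_pow2_le R B.
have Phis : \sum_(b < B) `|Phi b (iter n S f)| ^+ 2 <= 2 * s + 32 * t * `|f| ^+ 2.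
  have -> : 2 * s + 32 * t * `|f| ^+ 2 =
      \sum_(b < B) (2 * `|Phi b f| ^+ 2 + 32 * (2^-1) ^+ b * `|f| ^+ 2).
    by rewrite /s /t [2 * _]mulr_sumr [32 * _]mulr_sumr mulr_suml -big_split.
  by apply: ler_sum => b _; exact: Phi_shift.
apply: le_trans (lerD (iter_shift_norm n f) Phis) _.
apply: (@le_trans _ _ (65 * (`|f| ^+ 2 + s))); last by rewrite ler_wpM2l.
clear Phis h; move: (`|f| ^+ 2) s t f0 s0 t2 => {f} F s t F0 s0 t2.
rewrite -subr_ge0 (_ : _ - _ = 63 * s + 32 * (2 - t) * F); last by ring.
by rewrite addr_ge0// mulr_ge0// mulr_ge0// subr_ge0.
Qed.

Lemma graph_shift_proof x : S (l2val x) \in l2pred graph_family.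
Proof.
apply: (@mem_graph _ (65 * `|x| ^+ 2)) => n.
apply: le_trans (Phi_shift_sum x 1 n); by rewrite lerDr exprn_ge0.
Qed.

Definition graph_shift x : graphsp := L2space (graph_shift_proof x).

Lemma graph_shift_linear : linear graph_shift.
Proof. by move=> k x y; apply: val_inj; rewrite /= linearP. Qed.
HB.instance Definition _ := GRing.isLinear.Build R[i] graphsp graphsp *:%R
  graph_shift graph_shift_linear.

Lemma val_iter_shift n x : l2val (iter n graph_shift x) = iter n S (l2val x).
Proof. by elim: n => //= n ->. Qed.

Lemma graph_shift_sqr n x : `|iter n graph_shift x| ^+ 2 <= 65 * `|x| ^+ 2.
Proof. by apply: graph_norm_le => B; rewrite val_iter_shift; exact: Phi_shift_sum. Qed.

Lemma graph_shift_norm n x : `|iter n graph_shift x| <= 65 * `|x|.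
Proof.
rewrite -(@ler_pXn2r _ 2)// ?nnegrE ?mulr_ge0//.
apply: le_trans (graph_shift_sqr n x) _; rewrite exprMn ler_wpM2r ?exprn_ge0//.
by rewrite expr2 ler_peMl// ler1n.
Qed.

Definition delta0 k : R[i] := (k == 0%N)%:R.

Lemma delta0_sqsum : sqsum delta0.
Proof.
apply: (@sqsum_bound _ _ 1) => -[|K]; first by rewrite big_ord0.
rewrite big_ord_recl/= big1 ?addr0 ?normr1 ?expr1n// => i _.
by rewrite /delta0/= normr0 expr0n.
Qed.

Lemma Phi_one b : Phi b (hardy_of delta0_sqsum) = 0.
Proof.
apply: hardy_ext => k; rewrite coef_hop coef_of hcoef0 /= /blockPhi big1 ?mulr0// => i _.
rewrite /blockC; case: ifP => // kM; rewrite big1// => p _; rewrite /delta0.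
rewrite (_ : (_ == _) = false) ?mulr0//; apply/negbTE; rewrite -lt0n /blockidx.
by move: kM; move: (blockM b i) => M; nia.
Qed.

Lemma graph_one_proof : hardy_of delta0_sqsum \in l2pred graph_family.
Proof.
apply: (@mem_graph _ 0) => n; rewrite big1// => b _.
by rewrite Phi_one normr0 expr0n.
Qed.

Definition graph_one : graphsp := L2space graph_one_proof.

End graph_space.

(** * Polynomials in the graph space *)

Section graph_polynomials.
Variable R : realType.
Local Notation Phi b := (hop (PhiOp R b)).
Local Notation graphsp := (graphsp R).
Implicit Types (x y : graphsp) (h : hardy R).

Definition graph_mono n : graphsp := iter n (@graph_shift R) (graph_one R).

Lemma coef_mono n k : coef (l2val (graph_mono n)) k = (k == n)%:R.
Proof.
rewrite /graph_mono val_iter_shift coef_iter_shift coef_of /shseq /delta0.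
case: ltnP => kn; first by rewrite ltn_eqF.
by rewrite subn_eq0 eqn_leq kn andbT.
Qed.

Lemma l2val_sum (I : Type) (s : seq I) (F : I -> graphsp) :
  l2val (\sum_(i <- s) F i) = \sum_(i <- s) l2val (F i).
Proof. by elim/big_rec2: _ => // i u v _ <-. Qed.

Lemma coef_mono_comb L (c : nat -> R[i]) k :
  coef (l2val (\sum_(n < L) c n *: graph_mono n)) k = if (k < L)%N then c k else 0.
Proof.
rewrite l2val_sum hcoef_sum.
under eq_bigr do rewrite Defs.coefZ coef_mono.
case: ltnP => kL.
  rewrite (bigD1 (Ordinal kL))//= eqxx mulr1 big1 ?addr0// => i ik.
  by rewrite (_ : (k == i) = false) ?mulr0//; apply: contraNF ik => /eqP ki; apply/eqP/val_inj.
by rewrite big1// => i _; rewrite gtn_eqF ?mulr0// (leq_trans (ltn_ord i)).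
Qed.

(** The lowest nonzero coefficient of a multiple of the infinite product would
    bound the norms of almost all the [Phi b] from below. *)
Lemma graph_inter x h : l2val x = hop (VOp R) h -> h = 0.
Proof.
move=> xh; apply: contrapT => h0.
have [m0 hm0 hlow] : exists2 m, coef h m != 0 & forall j, (j < m)%N -> coef h j = 0.
  have ex : exists m, coef h m != 0.
    apply: contrapT => no; apply: h0; apply: coef_eq0 => n.
    by apply/eqP; apply: contraT => hn; case: no; exists n.
  case: (ex_minnP ex) => m hm mmin; exists m => // j jm.
  by apply/eqP; apply: contraT => /mmin; rewrite leqNgt jm.
pose f k : R[i] := 4^-1 * shseq 1 (coef h) k.
have FE k : coef (l2val x) k = bprodoo f k.
  rewrite xh coef_hop /= /blaschkeSeq -bprodoo_shseq.
  by rewrite /f bprodooZ.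
have fB K : \sum_(k < K) `|f k| ^+ 2 <= `|h| ^+ 2.
  apply: le_trans (shseq_bound 1 (coef_sum_le_ord h) K); apply: ler_sum => k _.
  rewrite ler_pXn2r ?nnegrE// normrM ler_piMl// normfV normr_nat invf_le1//.
  by rewrite ler1n.
pose m := m0.+1.
have fm : f m != 0.
  by rewrite mulf_neq0 ?invr_neq0// /shseq/= subSS subn0.
have Fm : bprodoo f m = f m.
  apply: bprodoo_lead => j; rewrite ltnS leq_eqVlt /f /shseq.
  case: j => [|j]; first by rewrite mulr0.
  by move=> jm; rewrite /= subSS subn0 hlow ?mulr0//; move: jm => /predU1P[->//|/ltnW].
have key b : (m <= b)%N ->
    `|f m| <= `|Phi b (l2val x)| + 2 * `|h| / blockW R b.
  move=> mb; rewrite -Fm.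
  apply: le_trans (blockPhi_bprodoo (normr_ge0 h) fB mb) _; rewrite lerD2r.
  apply: le_trans (coef_le _ (b - m)); rewrite coef_hop /=.
  by have -> : coef (l2val x) = bprodoo f by apply/funext.
have d0 : 0 < `|f m| by rewrite normr_gt0.
have [N1 N1P] : exists N1, forall b, (N1 <= b)%N -> 2 * `|h| / blockW R b <= `|f m| / 2.
  have h1 : 0 < 4 * `|h| + 1 by rewrite ltr_wpDl// mulr_ge0.
  have [N1 N1P] := near_inv_le (divr_gt0 d0 h1).
  exists N1 => b Nb.
  have W0 := blockW_gt0 R b.
  have Wb : (blockW R b)^-1 <= `|f m| / (4 * `|h| + 1).
    apply: le_trans N1P; rewrite lef_pV2 ?posrE// /blockW ler_nat.
    apply: leq_trans (_ : b.+1 <= _)%N; first by rewrite ltnS.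
    by rewrite /blockR; exact: ltnW (ltn_expl _ _).
  apply: (@le_trans _ _ (2 * `|h| * (`|f m| / (4 * `|h| + 1)))).
    by rewrite ler_wpM2l// mulr_ge0.
  rewrite mulrA ler_pdivrMr//.
  rewrite -subr_ge0 (_ : _ - _ = `|f m| * 2^-1); last by field.
  by rewrite mulr_ge0// invr_ge0.
have big b : (maxn m N1 <= b)%N -> (`|f m| / 2) ^+ 2 <= `|Phi b (l2val x)| ^+ 2.
  rewrite geq_max => /andP[mb Nb]; rewrite ler_pXn2r ?nnegrE ?divr_ge0//.
  have := lerB (key _ mb) (N1P _ Nb).
  by rewrite addrK (_ : `|f m| - `|f m| / 2 = `|f m| / 2)//; field.
have c0 : 0 < (`|f m| / 2) ^+ 2 by rewrite exprn_gt0// divr_gt0.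
have x1 : 0 < `|x| ^+ 2 + 1 by rewrite ltr_wpDl// exprn_ge0.
have [n nP] := near_inv_le (divr_gt0 c0 x1).
have := graph_sum_le x (maxn m N1 + n.+1); rewrite big_split_ord/=.
set s1 := \sum_(i < maxn m N1) _; set s2 := \sum_(i < n.+1) _ => hle.
have s10 : 0 <= s1 by rewrite sumr_ge0// => i _; rewrite exprn_ge0.
have s2le : n.+1%:R * (`|f m| / 2) ^+ 2 <= s2.
  rewrite mulr_natl -[X in _ *+ X]card_ord -sumr_const; apply: ler_sum => i _.
  by apply: big; rewrite leq_addr.
have : `|x| ^+ 2 + 1 <= n.+1%:R * (`|f m| / 2) ^+ 2.
  by move: nP; rewrite ler_pdivlMr// ler_pdivrMl.
move=> /le_trans/(_ s2le) h1.
have : `|x| ^+ 2 + 1 <= `|x| ^+ 2.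
  apply: le_trans h1 _; apply: le_trans hle.
  by rewrite addrA lerDr addr_ge0// exprn_ge0.
by rewrite gerDl ler10.
Qed.

End graph_polynomials.

Section test_vector.
Variables (R : realType) (l : disc R).
Local Notation graphsp := (graphsp R).
Local Notation Phi b := (hop (PhiOp R b)).
Let x : R[i] := `|val l| ^+ 2.

Let x0 : 0 <= x. Proof. by rewrite exprn_ge0. Qed.
Let x1 : x < 1. Proof. by rewrite expr_lt1// (valP l). Qed.
Let y0 : 0 < 1 - x. Proof. by rewrite subr_gt0. Qed.

Lemma hardy_kernel_norm : `|hardy_kernel l| ^+ 2 = (1 - `|val l| ^+ 2)^-1.
Proof. by rewrite -inner_normE inner_kernel /= normCK mulrC. Qed.

Lemma test_degree : exists L : nat, 1 <= L%:R * (1 - x) <= 2.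
Proof.
have ex : exists n : nat, n.+1%:R^-1 <= 1 - x by exact: near_inv_le.
case: (ex_minnP ex) => n nP nmin; exists n.+1; apply/andP; split.
  by rewrite -ler_pdivrMl// mulr1.
case: n nP nmin => [_ _|n _ nmin].
  by rewrite mul1r lerBlDr -[leLHS]addr0 lerD// ler1n.
have : ~~ (n.+1%:R^-1 <= 1 - x).
  by apply/negP => /nmin; rewrite ltnn.
rewrite -real_ltNge ?ger0_real ?invr_ge0 ?(ltW y0)// => ny.
rewrite -[n.+2]addn1 natrD mulrDl mul1r.
have -> : 2 = 1 + 1 :> R[i] by rewrite -mulr2n.
rewrite lerD//; last by rewrite gerBl.
by rewrite -ler_pdivlMl// mulr1 ltW.
Qed.

Lemma geo_disc n : \sum_(k < n) x ^+ k = (1 - x ^+ n) / (1 - x).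
Proof.
have yn0 : 1 - x != 0 by rewrite gt_eqF.
apply: (mulIf yn0); rewrite mulfVK//.
have := subrX1 x n; rewrite -[1 - x ^+ n]opprB => ->.
by ring.
Qed.

(** The kernel is truncated at the degree [L] given by [test_degree]: large enough
    to keep half of the value at [l], small enough for [blockPhi_poly]. *)
Lemma test_vector_exists : exists L (g := \sum_(n < L) ((val l)^*) ^+ n *: graph_mono R n),
  `|g| ^+ 2 <= 37 / (1 - x) /\ (1 - x)^-1 / 2 <= inner (l2val g) (hardy_kernel l).
Proof.
have [L /andP[L1 L2]] := test_degree; exists L => g.
have gE k : coef (l2val g) k = if (k < L)%N then ((val l)^*) ^+ k else 0.
  exact: (coef_mono_comb L (fun n => ((val l)^*) ^+ n)).
have gG K : \sum_(k < K) `|coef (l2val g) k| ^+ 2 <= (1 - x)^-1.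
  apply: (@le_trans _ _ (\sum_(k < K) x ^+ k)).
    apply: ler_sum => k _; rewrite gE; case: ifP => _.
      by rewrite normrX norm_conjC /x -!exprM mulnC.
    by rewrite normr0 expr0n exprn_ge0.
  by rewrite geo_disc ler_piMl ?invr_ge0 ?(ltW y0)// gerBl exprn_ge0.
have gL k : (L <= k)%N -> coef (l2val g) k = 0 by rewrite gE ltnNge => ->.
have g1 k : `|coef (l2val g) k| <= 1.
  rewrite gE; case: ifP => _; last by rewrite normr0.
  by rewrite normrX norm_conjC exprn_ile1// ltW// (valP l).
split.
  apply: graph_norm_le => B.
  have LG : L%:R <= 2 / (1 - x) by rewrite ler_pdivlMr.
  apply: (@le_trans _ _ ((1 - x)^-1 + \sum_(b < B) (18 / (1 - x)) * (2^-1) ^+ b)).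
    apply: lerD; first by apply: hardy_norm_le.
    apply: ler_sum => b _; apply: hardy_norm_le => K; rewrite coef_hop.
    apply: le_trans (blockPhi_poly b gG gL g1 K) _.
    apply: (@le_trans _ _ (16 * 2^-1 ^+ b * (1 - x)^-1 + 2 / (1 - x) * 2^-1 ^+ b)).
      by rewrite lerD2l ler_wpM2r// exprn_ge0// invr_ge0.
    by rewrite le_eqVlt; apply/orP; left; apply/eqP; ring.
  rewrite -mulr_sumr.
  apply: (@le_trans _ _ ((1 - x)^-1 + 18 / (1 - x) * 2)).
    by rewrite lerD2l ler_wpM2l ?sum_pow2_le// divr_ge0// ltW.
  by rewrite le_eqVlt; apply/orP; left; apply/eqP; ring.
rewrite inner_kernel.
have -> : l2val g l = \sum_(k < L) x ^+ k.
  apply: (cvg_unique _ (coefP (l2val g) l)); first exact: norm_hausdorff.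
  apply: cvg_near_cst; near=> n.
  have Ln : (L <= n)%N by near: n; exact: nbhs_infty_ge.
  have tail0 : \sum_(L <= k < n) coef (l2val g) k * val l ^+ k = 0.
    by rewrite big_nat big1// => k /andP[Lk _]; rewrite gL// mul0r.
  rewrite /series/= (big_cat_nat (n := L))//= tail0 addr0.
  rewrite big_mkord; apply: eq_bigr => k _; rewrite gE ltn_ord.
  by rewrite -exprMn [(val l)^* * _]mulrC -normCK.
have xL : x ^+ L <= 2^-1.
  have : L%:R * x ^+ L <= (1 - x ^+ L) / (1 - x).
    rewrite -geo_disc mulr_natl -[X in _ *+ X]card_ord -sumr_const; apply: ler_sum => k _.
    by rewrite ler_wiXn2l ?(ltW x1)// ltnW.
  rewrite ler_pdivlMr// => h.
  have : x ^+ L <= 1 - x ^+ L.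
    apply: le_trans h; rewrite mulrAC -[leLHS]mul1r ler_wpM2r// exprn_ge0//.
  rewrite lerBrDr => h2.
  by rewrite -[leRHS]mul1r ler_pdivlMr// mulr_natr mulr2n.
rewrite geo_disc mulrC ler_wpM2r ?invr_ge0 ?(ltW y0)//.
rewrite lerBrDr -lerBrDl (le_trans xL)// le_eqVlt; apply/orP; left; apply/eqP.
by field.
Unshelve. all: by end_near. Qed.

End test_vector.

(** * The orthogonal sum *)

Section poly_closure.
Variable R : realType.
Local Notation graphsp := (graphsp R).
Implicit Types x y g : graphsp.

(** The closure of the polynomials in the graph space, as a bi-orthogonal. In
    this subspace the closure of the multiples of [z] has codimension one. *)
Definition pcl x := forall g, (forall n, inner (graph_mono R n) g = 0) -> inner x g = 0.

Lemma pcl0 : pcl 0. Proof. by move=> g _; rewrite inner0l. Qed.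

Lemma pclP k x y : pcl x -> pcl y -> pcl (k *: x + y).
Proof. by move=> px py g gn; rewrite innerP px// py// mulr0 addr0. Qed.

Lemma pcl_mono n : pcl (graph_mono R n). Proof. by move=> g gn; exact: gn. Qed.

Lemma pcl_comb L (c : nat -> R[i]) : pcl (\sum_(n < L) c n *: graph_mono R n).
Proof.
elim/big_ind: _ => [|x y px py|n _]; first exact: pcl0.
  by rewrite -[x]scale1r; exact: pclP.
by rewrite -[X in pcl X]addr0; apply: pclP; [exact: pcl_mono|exact: pcl0].
Qed.

Lemma pcl_shift x : pcl x -> pcl (graph_shift x).
Proof.
move=> px g gn.
have [B BP] := @adjoint_exists _ _ _ (@graph_shift R : {linear graphsp -> graphsp}) _
  (@graph_shift_norm R 1).
have -> : inner (graph_shift x) g = inner x (B g) by exact: BP.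
apply: px => n; have <- := BP (graph_mono R n) g; exact: (gn n.+1).
Qed.

Lemma pcl_orth x : pcl x -> (forall n, inner (graph_mono R n) x = 0) -> x = 0.
Proof. by move=> px xn; apply: inner_eq0; exact: px. Qed.

Lemma pcl_cvg (I : Type) (F : set_system I) {FF : ProperFilter F} (u : I -> graphsp) l :
  (forall i, pcl (u i)) -> u @ F --> l -> pcl l.
Proof.
move=> pu ul g gn; have h : (fun t => inner (u t) g) @ F --> inner l g by exact: inner_continuousl.
apply: (cvg_unique _ h); first exact: norm_hausdorff.
have -> : (fun t => inner (u t) g) = fun=> 0 by apply/funext => t; exact: pu.
exact: cvg_cst.
Qed.

End poly_closure.

Section direct_sum.
Variables (R : realType) (J : set nat).
Local Notation graphsp := (graphsp R).

Definition evseq n (x : nat -> graphsp) := x n.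

Lemma evseq_linear n : linear (evseq n). Proof. by []. Qed.
HB.instance Definition _ n := GRing.isLinear.Build R[i] (nat -> graphsp) graphsp *:%R
  (evseq n) (evseq_linear n).

Definition dsum_dom : set (nat -> graphsp) :=
  [set x | (forall j, ~ J j -> x j = 0) /\ forall j, pcl (x j)].

Lemma dsum_dom0 : dsum_dom 0.
Proof. by split => // j; exact: pcl0. Qed.

Lemma dsum_domP k x y : dsum_dom x -> dsum_dom y -> dsum_dom (k *: x + y).
Proof.
move=> [x0 px] [y0 py]; split => j; last exact: pclP.
move=> Jj; have -> : (k *: x + y) j = k *: x j + y j by [].
by rewrite x0// y0// addr0 scaler0.
Qed.

Lemma dsum_sep x : dsum_dom x -> (forall n, evseq n x = 0) -> x = 0.
Proof. by move=> _ h; apply/funext => n; exact: h. Qed.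

Lemma dsum_closed (I : Type) (F : set_system I) : ProperFilter F ->
  forall (x : I -> nat -> graphsp) (l : nat -> graphsp), (forall i, dsum_dom (x i)) ->
  (forall n, (fun i => evseq n (x i)) @ F --> l n) ->
  exists2 y, dsum_dom y & forall n, evseq n y = l n.
Proof.
move=> FF x l dx xl; exists l => //; split => j.
  move=> Jj; apply: (cvg_unique _ (xl j)); first exact: norm_hausdorff.
  have -> : (fun i => evseq j (x i)) = fun=> 0.
    by apply/funext => i; exact: (dx i).1.
  exact: cvg_cst.
by apply: (pcl_cvg _ (xl j)) => i; exact: (dx i).2.
Qed.

Definition dsum_family : l2family (nat -> graphsp) graphsp :=
  @L2Family _ _ _ (fun n => evseq n : {linear (nat -> graphsp) -> graphsp})
    dsum_dom dsum_dom0 dsum_domP dsum_sep dsum_closed.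

(** Orthogonal sum of copies, indexed by [J], of the closure of the polynomials
    in the graph space. *)
Definition dsum := l2space dsum_family.
Implicit Types x : dsum.

Definition summand x j : graphsp := l2val x j.
Arguments summand : simpl never.

Lemma summand_le x j : `|summand x j| <= `|x|.
Proof. exact: (@l2fun_le _ _ _ dsum_family x j). Qed.

Lemma summandP k x y j : summand (k *: x + y) j = k *: summand x j + summand y j.
Proof. by []. Qed.

Lemma summand_out x j : ~ J j -> summand x j = 0.
Proof. exact: (l2valP x).1.1. Qed.

Lemma summand_pcl x j : pcl (summand x j).
Proof. exact: (l2valP x).1.2. Qed.

Lemma summand_ext x y : (forall j, summand x j = summand y j) -> x = y.
Proof. by move=> xy; apply: val_inj; apply/funext. Qed.

Lemma summand_sum_le x n : \sum_(j < n) `|summand x j| ^+ 2 <= `|x| ^+ 2.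
Proof. by have := l2sum_le x n; rewrite /series/= big_mkord. Qed.

Lemma dsum_norm_le x M : (forall n, \sum_(j < n) `|summand x j| ^+ 2 <= M) -> `|x| ^+ 2 <= M.
Proof. by move=> h; apply: l2norm_le => n; rewrite /series/= big_mkord; exact: h. Qed.

Lemma dsum_inner x y n : (forall j, (n <= j)%N -> summand x j = 0 \/ summand y j = 0) ->
  inner x y = \sum_(j < n) inner (summand x j) (summand y j).
Proof.
move=> h; apply: (cvg_lim (@norm_hausdorff _ _)); apply: cvg_near_cst.
near=> m; have nm : (n <= m)%N by near: m; exact: nbhs_infty_ge.
rewrite /series/= (big_cat_nat (n := n))//=.
have -> : \sum_(n <= i < m) inner (evseq i (l2val x)) (evseq i (l2val y)) = 0.
  rewrite big_nat big1// => i /andP[ni _].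
  by have [e|e] := h _ ni; rewrite /evseq -/(summand x i) -/(summand y i) e ?inner0l ?inner0r.
by rewrite addr0 big_mkord.
Unshelve. all: by end_near. Qed.

Lemma dsum_shift_proof x : (fun j => graph_shift (summand x j)) \in l2pred dsum_family.
Proof.
have [[x0 px] sx] := l2valP x; apply/asboolP; split.
  split => j; last exact: pcl_shift (px j).
  by move=> Jj; rewrite summand_out// linear0.
have h j : `|graph_shift (summand x j)| ^+ 2 <= 65 * `|summand x j| ^+ 2.
  exact: (graph_shift_sqr 1 (summand x j)).
have sq : sqsum (fun j => `|summand x j|) by exact: sx.
have {}sq : sqsum (fun j => `|graph_shift (summand x j)|).
  apply: (sqsum_le (M := 65) sq); first exact: ler0n.
  move=> j.
  rewrite [X in X ^+ 2 <= _]normr_id.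
  rewrite [X in _ * X ^+ 2]normr_id.
  exact: (h j).
exact: sq.
Qed.

Definition dsum_shift x : dsum := L2space (dsum_shift_proof x).

Lemma summand_shift x j : summand (dsum_shift x) j = graph_shift (summand x j).
Proof. by []. Qed.

Lemma dsum_shift_linear : linear dsum_shift.
Proof. by move=> k x y; apply: summand_ext => j; rewrite summandP !summand_shift summandP linearP. Qed.
HB.instance Definition _ := GRing.isLinear.Build R[i] dsum dsum *:%R
  dsum_shift dsum_shift_linear.

Lemma summand_iter_shift n x j : summand (iter n dsum_shift x) j = iter n (@graph_shift R) (summand x j).
Proof. by elim: n => //= n <-. Qed.

Lemma dsum_shift_norm n x : `|iter n dsum_shift x| <= 65 * `|x|.
Proof.
rewrite -(@ler_pXn2r _ 2)// ?nnegrE ?mulr_ge0//.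
apply: dsum_norm_le => m.
apply: (@le_trans _ _ (\sum_(j < m) (65 * `|summand x j|) ^+ 2)).
  apply: ler_sum => j _; rewrite summand_iter_shift ler_pXn2r ?nnegrE ?mulr_ge0//.
  exact: graph_shift_norm.
under eq_bigr do rewrite exprMn.
by rewrite -mulr_sumr exprMn ler_wpM2l ?exprn_ge0// summand_sum_le.
Qed.

Section embedding.
Variables (j : nat) (y : graphsp).
Hypotheses (Jj : J j) (py : pcl y).

Let f : nat -> graphsp := fun i => if i == j then y else 0.

Lemma dsum_embed_proof : f \in l2pred dsum_family.
Proof.
have df : dsum_dom f.
  split => i; last by rewrite /f; case: (i == j); [exact: py|exact: pcl0].
  by rewrite /f; have [ij nJ|ij _] := eqVneq i j; [case: nJ; rewrite ij|].
have sf : sqsum (fun i => `|f i|).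
  have fE i : `|(`|f i| : R[i])| ^+ 2 = if i == j then `|y| ^+ 2 else 0.
    by rewrite normr_id /f; case: (i == j) => //; rewrite normr0 expr0n.
  apply: (@sqsum_bound _ _ (`|y| ^+ 2)) => K; under eq_bigr do rewrite fE.
  apply: sum_single_le; first by rewrite exprn_ge0.
    by move=> i _; case: (i == j :> nat) => //; rewrite exprn_ge0.
  move=> i i' _ _ ii; have [ij|_] := eqVneq (i : nat) j; last by left.
  have [ij'|_] := eqVneq (i' : nat) j; last by right.
  by move/eqP : ii => []; apply: val_inj; rewrite /= ij.
by apply/asboolP; split; [exact: df|exact: sf].
Qed.

Definition dsum_embed : dsum := L2space dsum_embed_proof.

Lemma summand_embed i : summand dsum_embed i = if i == j then y else 0.
Proof. by []. Qed.

Lemma inner_embed x : inner dsum_embed x = inner y (summand x j).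
Proof.
rewrite (@dsum_inner _ _ j.+1) => [|i ji].
  rewrite big_ord_recr/= summand_embed eqxx big1 ?add0r// => i _.
  by rewrite summand_embed ltn_eqF ?inner0l.
by left; rewrite summand_embed gtn_eqF.
Qed.

Lemma norm_embed : `|dsum_embed| ^+ 2 = `|y| ^+ 2.
Proof. by rewrite -!inner_normE inner_embed summand_embed eqxx. Qed.

End embedding.

End direct_sum.

(** * The intertwining map and the kernel of the adjoint *)

Section superposition.
Variable R : realType.
Local Notation S := (@hardy_shift R).
Local Notation V := (hop (VOp R)).
Local Notation graphsp := (graphsp R).
Implicit Types (a : nat -> hardy R) (f g : hardy R).

Lemma V_norm f : `|V f| <= 2^-1 * `|f|.
Proof.
rewrite -(@ler_pXn2r _ 2)// ?nnegrE ?mulr_ge0 ?invr_ge0//.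
rewrite exprMn; apply: le_trans (hop_sqr (VOp R) f) _; rewrite /= ler_wpM2r ?exprn_ge0//.
by rewrite exprVn -natrX.
Qed.

Lemma V_local f g m : (forall k, (k < m)%N -> coef f k = coef g k) ->
  forall k, (k < m.+1)%N -> coef (V f) k = coef (V g) k.
Proof.
move=> fg k km; rewrite !coef_hop /=.
case: k km => [_|k km]; first exact: etrans (blaschkeSeq0 _) (esym (blaschkeSeq0 _)).
apply: (etrans (blaschkeSeqS _ _)); apply: (etrans _ (esym (blaschkeSeqS _ _))).
apply: (congr1 (fun z => 4^-1 * z)); apply: bprodoo_local => j jk.
by apply: fg; exact: leq_ltn_trans jk km.
Qed.

Lemma V_shift f : V (S f) = S (V f).
Proof.
apply: hardy_ext => k; rewrite coef_shift coef_hop /=.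
have -> : coef (S f) = shseq 1 (coef f) by exact: (coef_iter_shift 1 f).
case: k => [|k]; first exact: blaschkeSeq0.
rewrite blaschkeSeqS bprodoo_shseq coef_hop /=.
by case: k => [|k]; rewrite ?shseq10 ?mulr0 ?blaschkeSeq0// shseq1S blaschkeSeqS.
Qed.

Lemma iterV0 j : iter j V 0 = 0.
Proof. by elim: j => //= j ->; rewrite linear0. Qed.

Lemma iterV_low j f k : (k < j)%N -> coef (iter j V f) k = 0.
Proof.
elim: j k => //= j IH k kj.
have h i : (i < j)%N -> coef (iter j V f) i = coef 0 i.
  by move=> ij; apply: (etrans (IH i ij)); exact: (esym (hcoef0 R i)).
by apply: (etrans (V_local h kj)); rewrite linear0; exact: hcoef0.
Qed.

Lemma iterV_norm j f : `|iter j V f| <= (2^-1) ^+ j * `|f|.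
Proof.
elim: j => [|j IH]; first by rewrite expr0 mul1r.
apply: le_trans (V_norm _) _; rewrite exprS -mulrA ler_wpM2l ?invr_ge0//.
Qed.

(* Finite sums give every coefficient of [sum_j v^j a_j], because [v^j] vanishes
   to order [j] at the origin. *)
Definition Vsum n a : hardy R := \sum_(j < n) iter j V (a j).

Definition Vseq a k := coef (Vsum k.+1 a) k.

Lemma Vsum_stable n a k : (k < n)%N -> coef (Vsum n a) k = Vseq a k.
Proof.
move=> kn; rewrite /Vseq /Vsum !hcoef_sum.
rewrite (big_ord_widen n (fun j => coef (iter j V (a j)) k) kn) [RHS]big_mkcond/=.
by apply: eq_bigr => j _; case: ltnP => // kj; rewrite iterV_low.
Qed.

Lemma Vsum_rec n a : Vsum n.+1 a = a 0%N + V (Vsum n (fun j => a j.+1)).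
Proof. by rewrite /Vsum big_ord_recl/= linear_sum. Qed.

Lemma Vsum_shift n a : Vsum n (fun j => S (a j)) = S (Vsum n a).
Proof.
rewrite /Vsum linear_sum/=; apply: eq_bigr => j _.
elim: (j : nat) (a j) => //= i IH f.
by rewrite IH V_shift.
Qed.

Lemma VsumP n c a b : Vsum n (fun j => c *: a j + b j) = c *: Vsum n a + Vsum n b.
Proof.
rewrite /Vsum scaler_sumr -big_split/=; apply: eq_bigr => j _.
elim: (j : nat) (a j) (b j) => //= i IH f g.
by rewrite IH linearP.
Qed.

Lemma Vseq_shift a k : Vseq (fun j => S (a j)) k = if k is k'.+1 then Vseq a k' else 0.
Proof.
apply: (etrans (congr1 (fun z => coef z k) (Vsum_shift k.+1 a))).
apply: (etrans (coef_shift _ _)); case: k => [|k]; first by [].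
by apply: Vsum_stable; exact: ltnW.
Qed.

Lemma VseqP c a b k : Vseq (fun j => c *: a j + b j) k = c * Vseq a k + Vseq b k.
Proof.
apply: (etrans (congr1 (fun z => coef z k) (VsumP k.+1 c a b))).
by apply: (etrans (Defs.coefD _ _ _)); rewrite Defs.coefZ.
Qed.

Variables (a : nat -> hardy R) (C : R[i]).
Hypothesis aC : forall j, `|a j| <= C.

Let C0 : 0 <= C. Proof. exact: le_trans (aC 0). Qed.

Lemma Vsum_norm n : `|Vsum n a| <= 2 * C.
Proof.
apply: le_trans (ler_norm_sum _ _ _) _.
apply: (@le_trans _ _ (\sum_(j < n) (2^-1) ^+ j * C)).
  apply: ler_sum => j _; apply: le_trans (iterV_norm _ _) _.
  by rewrite ler_wpM2l// exprn_ge0// invr_ge0.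
by rewrite -mulr_suml ler_wpM2r// sum_pow2_le.
Qed.

Lemma Vseq_le K : \sum_(k < K) `|Vseq a k| ^+ 2 <= (2 * C) ^+ 2.
Proof.
apply: (@le_trans _ _ (`|Vsum K a| ^+ 2)).
  apply: le_trans (coef_sum_le_ord (Vsum K a) K).
  by apply: ler_sum => k _; rewrite Vsum_stable.
by rewrite ler_pXn2r ?nnegrE ?mulr_ge0// Vsum_norm.
Qed.

End superposition.

Section superposition_injective.
Variable R : realType.
Local Notation S := (@hardy_shift R).
Local Notation V := (hop (VOp R)).
Local Notation graphsp := (graphsp R).

(** The first term is minus [v] times the sum of the others, so [graph_inter]
    applies. *)
Lemma Vseq_head (x : nat -> graphsp) C : (forall j, `|l2val (x j)| <= C) ->
  (forall k, Vseq (fun j => l2val (x j)) k = 0) ->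
  x 0%N = 0 /\ forall k, Vseq (fun j => l2val (x j.+1)) k = 0.
Proof.
move=> xC x0.
have sq := sqsum_bound (Vseq_le (fun j => xC j.+1)).
pose y := hardy_of sq.
have yE k : coef y k = Vseq (fun j => l2val (x j.+1)) k by rewrite coef_of.
have xy : l2val (x 0%N) = V (- y).
  apply/eqP; rewrite linearN -addr_eq0; apply/eqP; apply: coef_eq0 => k.
  apply: (etrans (Defs.coefD _ _ _)); apply: (etrans _ (x0 k)).
  have e := Vsum_rec k (fun j => l2val (x j)).
  apply: (etrans _ (esym (congr1 (fun z => coef z k) e))).
  apply: (etrans _ (esym (Defs.coefD _ _ _))).
  apply: (congr1 (fun z => coef (l2val (x 0%N)) k + z)).
  apply: (V_local _ (ltnSn k)) => i ik.
  by apply: (etrans (yE i)); exact: esym (Vsum_stable _ ik).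
have y0 : y = 0 by apply/oppr_inj; rewrite oppr0; exact: graph_inter xy.
split; last by move=> k; rewrite -yE y0 hcoef0.
by apply: val_inj; rewrite /= xy y0 oppr0 linear0.
Qed.

Lemma Vseq_injective (x : nat -> graphsp) C : (forall j, `|l2val (x j)| <= C) ->
  (forall k, Vseq (fun j => l2val (x j)) k = 0) -> forall j, x j = 0.
Proof.
move=> xC x0 j.
have h : forall k, Vseq (fun i => l2val (x (j + i)%N)) k = 0.
  elim: j => [//|j IH] k.
  have [_ h] := @Vseq_head (fun i => x (j + i)%N) C (fun i => xC _) IH.
  rewrite -[RHS](h k); congr (Vseq _ k); apply/funext => i.
  by rewrite addnS addSn.
by have [] := @Vseq_head (fun i => x (j + i)%N) C (fun i => xC _) h; rewrite addn0.
Qed.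

End superposition_injective.

Section quasi.
Variables (R : realType) (J : set nat).
Local Notation dsum := (dsum R J).
Implicit Types x : dsum.

Let xa x j := l2val (summand x j).

Let xa_le x j : `|xa x j| <= `|x|.
Proof. exact: le_trans (graph_val_le _) (summand_le _ _). Qed.

Definition dsumX x : hardy R := hardy_of (sqsum_bound (Vseq_le (xa_le x))).

Lemma coef_dsumX x k : coef (dsumX x) k = Vseq (fun j => l2val (summand x j)) k.
Proof. by rewrite coef_of. Qed.

Lemma dsumX_linear : linear dsumX.
Proof.
move=> c x y; apply: hardy_ext => k; apply: (etrans (coef_dsumX _ _)).
rewrite Defs.coefD Defs.coefZ.
have e : (fun j => l2val (summand (c *: x + y) j)) =
    fun j => c *: l2val (summand x j) + l2val (summand y j).
  by apply/funext => j; rewrite summandP; exact: erefl.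
apply: (etrans (congr1 (fun a => Vseq a k) e)).
apply: (etrans (VseqP _ _ _ _)).
exact: esym (congr2 (fun u v => c * u + v) (coef_dsumX x k) (coef_dsumX y k)).
Qed.
HB.instance Definition _ := GRing.isLinear.Build R[i] dsum (hardy R) *:%R
  dsumX dsumX_linear.

Lemma dsumX_norm x : `|dsumX x| <= 2 * `|x|.
Proof.
rewrite -(@ler_pXn2r _ 2)// ?nnegrE ?mulr_ge0//.
apply: hardy_norm_le => K; apply: le_trans (Vseq_le (xa_le x) K).
by apply: ler_sum => k _; rewrite coef_dsumX.
Qed.

Lemma dsumX_shift x : dsumX (dsum_shift x) = hardy_shift (dsumX x).
Proof.
apply: hardy_ext => k; apply: (etrans (coef_dsumX _ _)).
apply: (etrans _ (esym (coef_shift _ _))).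
apply: (etrans (Vseq_shift (fun j => l2val (summand x j)) k)).
by case: k => [|k]; [by []|exact: esym (coef_dsumX x k)].
Qed.

Lemma dsumX_inj x : dsumX x = 0 -> x = 0.
Proof.
move=> x0; apply: summand_ext => j.
apply: (@Vseq_injective _ (summand x) `|x|); first exact: xa_le.
by move=> k; rewrite -coef_dsumX x0 hcoef0.
Qed.

Hypothesis J0 : J 0%N.

Lemma dsumX_embed (y : graphsp R) (py : pcl y) : dsumX (dsum_embed J0 py) = l2val y.
Proof.
apply: hardy_ext => k; rewrite coef_dsumX /Vseq /Vsum big_ord_recl/= big1 ?addr0//.
by move=> i _; rewrite iterV0 linear0.
Qed.

Lemma poly_dense (f : hardy R) :
  (fun L : nat => l2val (\sum_(n < L) coef f n *: graph_mono R n)) @ \oo --> f.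
Proof.
apply/cvgrPdist_le => e e0.
have cf : series (fun n => `|coef f n| ^+ 2) @ \oo --> `|f| ^+ 2.
  by rewrite -hardy_normE hardy_innerE; exact: coef_sqsum.
move/cvgrPdist_le : cf => /(_ (e ^+ 2)); rewrite exprn_gt0// => /(_ isT).
apply: filterS => L h; have pE := coef_mono_comb L (coef f).
move: (l2val _) pE => p pE.
rewrite -(@ler_pXn2r _ 2)// ?nnegrE ?(ltW e0)//.
apply: hardy_norm_le => K.
have tail : `|f| ^+ 2 - \sum_(k < L) `|coef f k| ^+ 2 <= e ^+ 2.
  by move: h; rewrite /series/= big_mkord ger0_norm// subr_ge0; exact: coef_sum_le_ord.
apply: le_trans tail; rewrite lerBrDr.
apply: le_trans (coef_sum_le_ord f (L + K)); rewrite big_split_ord/= [leLHS]addrC lerD2l.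
apply: (@le_trans _ _ (\sum_(k < L + K) `|coef (f - p) k| ^+ 2)).
  by rewrite addnC big_split_ord/= lerDl sumr_ge0// => i _; rewrite exprn_ge0.
rewrite big_split_ord/= big1 ?add0r => [|i _]; last first.
  by rewrite Defs.coefB pE ltn_ord subrr normr0 expr0n.
apply: ler_sum => i _; by rewrite Defs.coefB pE ltnNge leq_addr/= subr0.
Qed.

Lemma dsumX_dense : dense (range dsumX).
Proof.
move=> O [f Of] Oo.
have := @poly_dense f; move=> /(_ O) []; first exact: open_nbhs_nbhs.
move=> L _ /(_ L (leqnn L)) LO.
exists (l2val (\sum_(n < L) coef f n *: graph_mono R n)); split => //.
exists (dsum_embed J0 (pcl_comb L (coef f))) => //; exact: dsumX_embed.
Qed.

Lemma dsumX_quasiaffinity : quasiaffinity (dsumX : {linear dsum -> hardy R}).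
Proof.
split; last exact: dsumX_dense.
  exact: bounded_continuous dsumX_norm.
apply/seteqP; split => x /=; first exact: dsumX_inj.
by move=> ->; exact: linear0.
Qed.

End quasi.

Section kernel.
Variables (R : realType) (J : set nat).
Local Notation dsum := (dsum R J).
Implicit Types x : dsum.

Lemma coef_functional j k : exists w : dsum, forall x, coef (l2val (summand x j)) k = inner x w.
Proof.
apply: (@riesz _ _ (fun x : dsum => coef (l2val (summand x j)) k) 1) => [c x y|x].
  by rewrite summandP /= Defs.coefD Defs.coefZ.
rewrite mul1r; apply: le_trans (coef_le _ _) _.
exact: le_trans (graph_val_le _) (summand_le _ _).
Qed.

Lemma dsum_separable : separable_space dsum.
Proof.
have /choice[w wP] : forall p : nat * nat, exists w : dsum,
    forall x, coef (l2val (summand x p.1)) p.2 = inner x w.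
  by move=> [j k]; exact: coef_functional.
pose v n := if unpickle n is Some p then w p else 0.
apply: (@separable_total _ _ v) => x xv; apply: summand_ext => j; apply: val_inj.
rewrite /=; apply: coef_eq0 => k.
have := xv (pickle (j, k)); rewrite /v pickleK -wP; exact.
Qed.

Variable Tadj : dsum -> dsum.
Hypothesis TadjP : is_adjoint (@dsum_shift R J) Tadj.
Variable w : nat -> dsum.
Hypothesis wP : forall j x, coef (l2val (summand x j)) 0 = inner x (w j).

Let wn j := `|w j|^-1 *: w j.

Let inner_mono_w j n : J j -> inner (graph_mono R n) (summand (w j) j) = (n == 0%N)%:R.
Proof.
move=> Jj; have := wP j (dsum_embed Jj (pcl_mono n)).
by rewrite inner_embed summand_embed eqxx coef_mono eq_sym => <-.
Qed.

Let w_norm_gt0 j : J j -> 0 < `|w j|.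
Proof.
move=> Jj; rewrite normr_gt0; apply/eqP => w0.
have := inner_mono_w 0 Jj; rewrite w0 /= inner0r => /eqP.
by rewrite eq_sym oner_eq0.
Qed.

Let wn_inner j : J j -> inner (wn j) (wn j) = 1.
Proof.
move=> Jj; rewrite inner_normE normrZ normfV normr_id mulVf ?expr1n//.
by rewrite gt_eqF// w_norm_gt0.
Qed.

Let w_orth i j : J i -> J j -> i != j -> inner (w i) (w j) = 0.
Proof.
move=> Ji Jj ij; rewrite -wP.
suff -> : summand (w i) j = 0 by rewrite /= hcoef0.
apply: inner_eq0.
have -> : inner (summand (w i) j) (summand (w i) j) = inner (dsum_embed Jj (@summand_pcl _ _ (w i) j)) (w i).
  by rewrite inner_embed.
by rewrite -wP summand_embed (negPf ij) /= hcoef0.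
Qed.

Let wn_orth i j : J i -> J j -> i != j -> inner (wn i) (wn j) = 0.
Proof. by move=> Ji Jj ij; rewrite innerZl innerZr w_orth// !mulr0. Qed.

Let wn_inj : {in J &, injective wn}.
Proof.
move=> i j /set_mem Ji /set_mem Jj e; apply: contrapT => /eqP ij.
have := wn_orth Ji Jj ij; rewrite -e wn_inner// => /eqP.
by rewrite oner_eq0.
Qed.

(* The component [j] is orthogonal to the multiples of [z], hence proportional to
   the representative of the value at the origin. *)
Let kernel_comp x j : J j -> Tadj x = 0 -> inner x (w j) = 0 -> summand x j = 0.
Proof.
move=> Jj Tx xw; set v := summand (w j) j; set y := summand x j.
have py : pcl y by exact: summand_pcl.
have pv : pcl v by exact: summand_pcl.
have yn n : inner (graph_mono R n.+1) y = 0.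
  have e : dsum_embed Jj (@pcl_mono R n.+1) = dsum_shift (dsum_embed Jj (@pcl_mono R n)).
    apply: summand_ext => i; rewrite summand_embed summand_shift summand_embed.
    by case: (i == j); [|rewrite linear0].
  by have := inner_embed Jj (@pcl_mono R n.+1) x; rewrite e TadjP Tx inner0r => <-.
set c := inner (graph_mono R 0) y.
have yE : y = c^* *: v.
  apply/eqP; rewrite -subr_eq0; apply/eqP; apply: pcl_orth.
    by rewrite addrC -scaleNr; exact: pclP.
  move=> n; rewrite innerBr innerZr conjCK inner_mono_w//.
  by case: n => [|n]; rewrite ?mulr1 ?subrr// yn mulr0 subr0.
have : c^* * `|w j| ^+ 2 = 0.
  transitivity (inner x (w j)); last exact: xw.
  rewrite -inner_normE -(wP j (w j)) -(wP j x) -/v -/y yE.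
  exact: esym (Defs.coefZ _ _ _).
move/eqP; rewrite mulf_eq0 expf_eq0/= (gt_eqF (w_norm_gt0 Jj)) orbF => /eqP c0.
by rewrite yE c0 scale0r.
Qed.

Lemma kernel_dim_aux : exists2 B, orthonormal_basis (opker Tadj) B & (B #= J)%card.
Proof.
exists (wn @` J); last exact: (inj_card_eq wn_inj).
split.
- move=> _ [j Jj <-]; rewrite /opker /=; apply: inner_eq0.
  by rewrite -TadjP innerZr -wP summand_shift /= coef_shift mulr0.
- move=> _ _ [i Ji <-] [j Jj <-]; have [->|ij] := eqVneq i j.
    by rewrite eqxx wn_inner.
  rewrite wn_orth// (_ : (_ == _) = false)//; apply/negbTE; apply: contra ij.
  by move=> /eqP e; apply/eqP; apply: wn_inj => //; exact: mem_set.
move=> x Tx xB; apply: summand_ext => j.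
have [Jj|Jj] := pselect (J j); last by rewrite summand_out.
apply: kernel_comp => //.
have /eqP := xB _ (ex_intro2 _ _ j Jj erefl).
rewrite innerZr mulf_eq0 conjC_eq0 invr_eq0 (gt_eqF (w_norm_gt0 Jj)) orFb => /eqP.
exact.
Qed.

End kernel.

Lemma kernel_dim (R : realType) (N : countable_cardinal) (Tadj : dsum R (card_repr N) -> _) :
  is_adjoint (@dsum_shift R (card_repr N)) Tadj -> hilbert_dim (opker Tadj) N.
Proof.
move=> TP.
have /choice[w wP] : forall j, exists w : dsum R (card_repr N),
    forall x, coef (l2val (summand x j)) 0 = inner x w.
  by move=> j; exact: coef_functional.
exact: (kernel_dim_aux TP wP).
Qed.

(** * The theorem *)

Section conclusion.
Variable R : realType.

Lemma dsum_power_bounded (J : set nat) : power_bounded (@dsum_shift R J).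
Proof.
apply: (@le_lt_trans _ _ (65%:E : \bar R)); last exact: ltry.
apply: ub_ereal_sup => _ [n _ <-]; apply: ub_ereal_sup => _ [x /= x1 <-].
rewrite lee_fin -lecR RRe_real ?normr_real//.
apply: le_trans (dsum_shift_norm n x) _.
rewrite rmorph_nat -[leRHS]mulr1 ler_wpM2l//.
Qed.

Lemma kernel_normE (l : disc R) :
  `|hardy_kernel l| = (sqrtC (1 - `|val l| ^+ 2))^-1.
Proof.
apply/eqP; rewrite -(@eqrXn2 _ 2)// ?invr_ge0 ?sqrtC_ge0.
- by rewrite hardy_kernel_norm exprVn sqrtCK.
- by rewrite subr_ge0 exprn_ile1// ltW// (valP l).
Qed.

Variables (J : set nat) (Xadj : hardy R -> dsum R J).
Hypothesis J0 : J 0%N.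
Hypothesis XP : is_adjoint (@dsumX R J) Xadj.

Lemma adjoint_upper f : `|Xadj f| <= 2 * `|f|.
Proof.
have [->|x0] := eqVneq (Xadj f) 0; first by rewrite normr0 mulr_ge0.
have n0 : 0 < `|Xadj f| by rewrite normr_gt0.
rewrite -(ler_pM2r n0) -expr2 -inner_normE -XP.
have h : 0 <= inner (dsumX (Xadj f)) f by rewrite XP inner_normE exprn_ge0.
rewrite -(ger0_norm h); apply: le_trans (inner_le _ _) _.
rewrite mulrAC ler_wpM2r//; exact: dsumX_norm.
Qed.

Lemma adjoint_lower (l : disc R) :
  13^-1 * `|hardy_kernel l| <= `|Xadj (hardy_kernel l)|.
Proof.
have [L [gle gin]] := test_vector_exists l.
set g := \sum_(n < L) _ in gle gin.
have pg : pcl g by exact: (pcl_comb L (fun n => ((val l)^*) ^+ n)).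
set h := hardy_kernel l in gin *.
have hE : (1 - `|val l| ^+ 2)^-1 = `|h| ^+ 2 by rewrite hardy_kernel_norm.
have h0 : 0 < `|h|.
  rewrite lt_def normr_ge0 andbT; apply/eqP => hz.
  have x1 : `|val l| ^+ 2 < 1 by rewrite expr_lt1// (valP l).
  move/eqP: hE; rewrite hz expr0n/= invr_eq0 subr_eq0 eq_sym => /eqP x1E.
  by rewrite x1E ltxx in x1.
rewrite hE in gin gle.
have e : inner (l2val g) h = inner (dsum_embed J0 pg) (Xadj h).
  by rewrite -(dsumX_embed J0 pg) XP.
have k1 : `|h| ^+ 2 / 2 <= `|g| * `|Xadj h|.
  have i0 : 0 <= inner (l2val g) h by apply: le_trans gin; rewrite divr_ge0// exprn_ge0.
  apply: le_trans gin _; rewrite -(ger0_norm i0) e; apply: le_trans (inner_le _ _) _.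
  rewrite ler_wpM2r// -(@ler_pXn2r _ 2)// ?nnegrE//.
  by rewrite norm_embed.
have g1 : `|g| <= 13 / 2 * `|h|.
  rewrite -(@ler_pXn2r _ 2)// ?nnegrE ?mulr_ge0 ?divr_ge0//.
  apply: le_trans gle _; rewrite exprMn ler_wpM2r ?exprn_ge0//.
  rewrite -subr_ge0 (_ : _ - _ = 21 / 4); last by field.
  by rewrite divr_ge0.
have : `|h| ^+ 2 / 2 <= 13 / 2 * `|h| * `|Xadj h|.
  by apply: le_trans k1 _; rewrite ler_wpM2r.
rewrite (_ : `|h| ^+ 2 / 2 = 13 / 2 * `|h| * (13^-1 * `|h|)); last by field.
by rewrite ler_pM2l// mulr_gt0// divr_gt0.
Qed.

End conclusion.

Unset Implicit Arguments.

Theorem corollary3p2 (R : realType) (N : countable_cardinal)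
    (hN : (card_repr (FiniteCard 1) #<= card_repr N)%card) :
  exists (K : hilbertType R) (T : {linear K -> K}) (Tadj : K -> K)
         (X : {linear K -> hardy R}) (Xadj : hardy R -> K),
    [/\ separable_space K, continuous T, power_bounded T & is_adjoint T Tadj] /\
    [/\ quasiaffinity X, is_adjoint X Xadj &
        forall k : K, X (T k) = hardy_shift (X k)] /\
    hilbert_dim (opker Tadj) N /\
    asymp (fun l : disc R => `|Xadj (hardy_kernel l)|)
          (fun l : disc R => `|hardy_kernel l|) /\
    (forall l : disc R, `|hardy_kernel l| = (sqrtC (1 - `|val l| ^+ 2))^-1).
Proof.
set J := card_repr N.
have J0 : J 0%N.
  rewrite /J; case: N hN {J} => [[|n]|] h //.
  by move: h; rewrite card_le_II.
pose T : {linear dsum R J -> dsum R J} := @dsum_shift R J.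
pose X : {linear dsum R J -> hardy R} := @dsumX R J.
have Tle x : `|T x| <= 65 * `|x| by exact: (dsum_shift_norm 1).
have [Tadj TP] := adjoint_exists Tle.
have [Xadj XP] := adjoint_exists (@dsumX_norm R J : forall x, `|X x| <= 2 * `|x|).
exists (dsum R J), T, Tadj, X, Xadj; split; [|split; [|split; [|split]]].
- split => //; [exact: dsum_separable|exact: bounded_continuous Tle|].
  exact: dsum_power_bounded.
- split => //; [exact: dsumX_quasiaffinity|exact: dsumX_shift].
- exact: kernel_dim.
- exists 13^-1, 2; split; [by rewrite invr_gt0|by []|] => l.
  by rewrite adjoint_lower// adjoint_upper.
- exact: kernel_normE.
Qed.
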